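(* Let $d\ge 1$. Let $(u_{n,0})_{n\in\mathbb{N}}$ be a sequence bounded in $L^2(\mathbb{T}^d)$ and let $(f_n)_{n\in\mathbb{N}}$ be a sequence bounded in $L^1_{\mathrm{loc}}(\mathbb{R}_t; L^2(\mathbb{T}^d))$. Let $u_n$ be the solution of $$(i\partial_t+\Delta)u_n=f_n,\qquad u_n|_{t=0}=u_{n,0},$$ that is, $$u_n(t)=e^{it\Delta}u_{n,0}+\frac1i\int_0^t e^{i(t-s)\Delta}f_n(s)\,ds .$$ Then for any $T>0$, the sequence $(u_n)$ is bounded in $L^2((0,T)\times\mathbb{T}^d)$ by $$T^{1/2}\sup_n\bigl(\|u_{n,0}\|_{L^2(\mathbb{T}^d)}+\|f_n\|_{L^1((0,T);L^2(\mathbb{T}^d))}\bigr),$$ and it satisfies property ($AC_T$).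
   Context: $\mathbb{T}^d=\mathbb{R}^d/\mathbb{Z}^d$, $\Delta$ is the Laplace operator on $\mathbb{T}^d$, functions are complex valued, and $e^{it\Delta}$ is the unitary group on $L^2(\mathbb{T}^d)$ generated by $i\Delta$. A sequence is bounded in $L^1_{\mathrm{loc}}(\mathbb{R}_t;L^2(\mathbb{T}^d))$ if it is bounded in $L^1(I;L^2(\mathbb{T}^d))$ for every bounded interval $I\subset\mathbb{R}$. Property ($AC_T$): let $T>0$ and let $(u_n)$ be a sequence bounded in $L^2((0,T)\times\mathbb{T}^d)$. Set $\nu_n=|u_n(t,x)|^2\,dt\,dx$, a sequence of positive measures of bounded mass on $(0,T)\times\mathbb{T}^d$. The sequence $(u_n)$ satisfies property ($AC_T$) if any weak-$*$ limit $\nu$ of $(\nu_n)$ (i.e. any Radon measure $\nu$ on $(0,T)\times\mathbb{T}^d$ which is the limit of some subsequence of $(\nu_n)$ when tested against continuous compactly supported functions on $(0,T)\times\mathbb{T}^d$) is absolutely continuous with respect to the Lebesgue measure $dt\,dx$ on $(0,T)\times\mathbb{T}^d$. *)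

(* Defs.v *)
From HB Require Import structures.
From mathcomp Require Import all_boot all_order all_algebra.
From mathcomp Require Import all_classical all_reals all_analysis.
From mathcomp Require Import complex.

Set Implicit Arguments.
Unset Strict Implicit.
Unset Printing Implicit Defensive.

Import Order.TTheory GRing.Theory Num.Theory.
Import numFieldNormedType.Exports.

Local Open Scope classical_set_scope.
Local Open Scope ring_scope.
Local Open Scope quotient_scope.
Local Open Scope complex_scope.

Section torus_def.
Variables (R : realType) (d : nat).

Definition congr_int (x y : 'rV[R]_d) : bool :=
  [forall i, (x 0 i - y 0 i) \is a Num.int].

Lemma congr_int_refl : reflexive congr_int.
Proof. by move=> x; apply/forallP => i; rewrite subrr rpred0. Qed.

Lemma congr_int_sym : symmetric congr_int.
Proof.
by move=> x y; apply/forallP/forallP => h i; rewrite -opprB rpredN.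
Qed.

Lemma congr_int_trans : transitive congr_int.
Proof.
move=> y x z /forallP xy /forallP yz; apply/forallP => i.
by rewrite -(subrKA (y 0 i)) rpredD.
Qed.

Canonical congr_int_equiv :=
  EquivRel congr_int congr_int_refl congr_int_sym congr_int_trans.

Definition torus : Type := quotient_topology {eq_quot congr_int}.

HB.instance Definition _ := Quotient.on torus.
HB.instance Definition _ := PointedTopological.on torus.

End torus_def.

Definition tproj (R : realType) (d : nat) (x : 'rV[R]_d) : torus R d :=
  \pi_(torus R d) x.

HB.instance Definition _ (R : realType) (d : nat) :=
  Measurable.copy (torus R d) (g_sigma_algebraType (@open (torus R d))).

Section haar_def.
Variable R : realType.
Local Notation RB := (measurableTypeR R).

Definition unit_lebesgue : set RB -> \bar R :=
  mrestr (@lebesgue_measure R) (measurable_itv `[0, 1[).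

HB.instance Definition _ := Measure.on unit_lebesgue.

Lemma unit_lebesgue_setT : unit_lebesgue setT = 1%E.
Proof.
by rewrite /unit_lebesgue /mrestr setTI lebesgue_measure_itv/= lte_fin ltr01
  oppr0 adde0.
Qed.

HB.instance Definition _ :=
  Measure_isProbability.Build _ _ _ unit_lebesgue unit_lebesgue_setT.

Definition tcons d (p : RB * d.-tuple RB) : d.+1.-tuple RB :=
  [tuple of p.1 :: p.2].

Lemma measurable_tcons d : measurable_fun setT (@tcons d).
Proof. exact: measurable_cons. Qed.

HB.instance Definition _ d := isMeasurableFun.Build _ _ _ _ (@tcons d)
  (@measurable_tcons d).

(* Lebesgue measure on R^d restricted to the cube [0, 1[ ^ d, R^d being here
   d.-tuple R, which carries the product sigma-algebra *)
Fixpoint cube_lebesgue (d : nat) : probability (d.-tuple RB) R :=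
  match d with
  | 0 => \d_[tuple]
  | d'.+1 => distribution (unit_lebesgue \x cube_lebesgue d')%E (@tcons d')
  end.

Variable d : nat.

Definition tuple_torus (s : d.-tuple RB) : torus R d :=
  tproj (\row_i tnth s i).

Lemma measurable_row_open (V : set 'rV[R]_d) :
  open V -> measurable [set s : d.-tuple RB | V (\row_i tnth s i)].
Proof.
move=> oV.
pose c (q : {ffun 'I_d -> rat}) : 'rV[R]_d := \row_i ratr (q i).
pose box (z : {ffun 'I_d -> rat} * nat) : set (d.-tuple RB) :=
  [set s | forall i, ball (ratr (z.1 i) : R) z.2.+1%:R^-1 (tnth s i)].
pose good (z : {ffun 'I_d -> rat} * nat) := ball (c z.1) z.2.+1%:R^-1 `<=` V.
have mbox z : measurable (box z).
  have -> : box z = \bigcap_(i in [set: 'I_d])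
      ((fun s : d.-tuple RB => tnth s i) @^-1`
         ball (ratr (z.1 i) : R) z.2.+1%:R^-1).
    by apply/seteqP; split => [s bs i _|s bs i]; exact: bs.
  apply: fin_bigcap_measurable => // i _; rewrite -[X in measurable X]setTI.
  by apply: measurable_tnth => //; rewrite ball_itv; exact: measurable_itv.
have -> : [set s : d.-tuple RB | V (\row_i tnth s i)] =
    \bigcup_k (if unpickle k is Some z then [set s | good z /\ box z s]
               else set0).
  apply/seteqP; split => [s /= Vs|s [k _]].
    have /nbhs_ballP[e /= e0 sV] := open_nbhs_nbhs (conj oV Vs).
    have [n ne] := @ltr_add_invr R 0 (e / 2) (divr_gt0 e0 (ltr0Sn _ 1)).
    have n0 : 0 < n.+1%:R^-1 :> R by rewrite invr_gt0.
    have q_ex i : {q : rat | ball (ratr q : R) n.+1%:R^-1 (tnth s i)}.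
      apply: cid; have [|q] := @rat_in_itvoo R (tnth s i - n.+1%:R^-1)
          (tnth s i + n.+1%:R^-1).
        by rewrite ltrBlDr -addrA ltrDl addr_gt0.
      by rewrite in_itv/= => qs; exists q; rewrite /ball/= ltr_distl.
    pose q := [ffun i => sval (q_ex i)].
    exists (pickle (q, n)) => //; rewrite pickleK.
    have bq i : ball (ratr (q i) : R) n.+1%:R^-1 (tnth s i).
      by rewrite ffunE; exact: svalP (q_ex i).
    split => // y [_ qy]; apply: sV; split => // i j.
    rewrite add0r in ne; apply: (@le_ball _ _ _ (n.+1%:R^-1 + n.+1%:R^-1)).
      by rewrite [leRHS]splitr lerD// ltW.
    apply: (@ball_triangle _ R (ratr (q j))).
      by rewrite mxE; apply: ball_sym; exact: bq.
    by have := qy i j; rewrite mxE.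
  case: unpickle => // z [gz bz]; apply: gz; split=> // i j.
  by rewrite !mxE; exact: bz.
apply: bigcup_measurable => k _; case: unpickle => // z.
have [gz|ngz] := pselect (good z).
  rewrite (_ : [set _ | _] = box z) //.
  by apply/seteqP; split => s //= -[].
rewrite (_ : [set _ | _] = set0) //.
by apply/seteqP; split => s //= -[].
Qed.

Lemma measurable_tuple_torus : measurable_fun setT tuple_torus.
Proof.
apply: (measurability (@open (torus R d)) erefl).
move=> _ [U oU <-]; rewrite setTI.
by apply: (@measurable_row_open (@tproj R d @^-1` U)); exact: oU.
Qed.

HB.instance Definition _ := isMeasurableFun.Build _ _ _ _ tuple_torus
  measurable_tuple_torus.

Definition haar : probability (torus R d) R :=
  distribution (cube_lebesgue d) tuple_torus.

End haar_def.

Section complex_L2.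
Context {disp : measure_display} {T : measurableType disp} {R : realType}.
Implicit Types (mu : {measure set T -> \bar R}) (f g : T -> R[i]).

Definition cmeasurable f :=
  measurable_fun setT (fun x => complex.Re (f x)) /\
  measurable_fun setT (fun x => complex.Im (f x)).

Definition L2norm mu f : \bar R :=
  Lnorm mu 2%:E (fun x => (Normc.normc (f x))%:E).

Definition in_L2 mu f := cmeasurable f /\ (L2norm mu f < +oo)%E.

Definition Cintegral mu f : R[i] :=
  (\int[mu]_x complex.Re (f x))%R +i* (\int[mu]_x complex.Im (f x))%R.

Definition inner mu f g : R[i] := Cintegral mu (fun x => f x * (g x)^*%C).

End complex_L2.

Section torus_analysis.
Variables (R : realType) (d : nat).
Implicit Types (f g : torus R d -> R[i]) (F : 'rV[R]_d -> R).
Local Notation leb := (@lebesgue_measure R).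

(* The iterated partial derivative along the directions listed in s *)
Fixpoint partials (s : seq 'I_d) F : 'rV[R]_d -> R :=
  if s is j :: s' then fun x => 'D_(delta_mx 0 j) (partials s' F) x else F.

Definition smooth_real F := forall (s : seq 'I_d) (x : 'rV[R]_d),
  {for x, continuous (partials s F)} /\
  forall j, derivable (partials s F) x (delta_mx 0 j).

Definition laplacian_real F (x : 'rV[R]_d) : R :=
  \sum_(j < d) partials [:: j; j] F x.

Definition lift_Re f (x : 'rV[R]_d) : R := complex.Re (f (tproj x)).
Definition lift_Im f (x : 'rV[R]_d) : R := complex.Im (f (tproj x)).

Definition smooth f := smooth_real (lift_Re f) /\ smooth_real (lift_Im f).

(* [repr p] is an arbitrary lift of p to R^d: the lifts of f being periodic,
   the value does not depend on it. *)
Definition laplacian f (p : torus R d) : R[i] :=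
  laplacian_real (lift_Re f) (repr p) +i* laplacian_real (lift_Im f) (repr p).

(* U t is e^{it Laplacian}: the strongly continuous unitary group of L^2 whose
   infinitesimal generator is i times the Laplacian.  Elements of L^2 are
   represented by functions, so that the identities between them hold almost
   everywhere.  The generator is only prescribed on smooth functions, on which
   the Laplacian is essentially self-adjoint: this determines the group. *)
Record is_schrodinger_group (U : R -> (torus R d -> R[i]) -> torus R d -> R[i])
    : Prop := {
  group_L2 : forall t f, in_L2 (haar R d) f -> in_L2 (haar R d) (U t f);
  group_linear : forall t (a : R[i]) f g,
    in_L2 (haar R d) f -> in_L2 (haar R d) g ->
    {ae haar R d, forall x,
      U t (fun y => a * f y + g y) x = a * U t f x + U t g x};
  group_isometry : forall t f, in_L2 (haar R d) f ->
    L2norm (haar R d) (U t f) = L2norm (haar R d) f;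
  group_zero : forall f, in_L2 (haar R d) f ->
    {ae haar R d, forall x, U 0 f x = f x};
  group_add : forall s t f, in_L2 (haar R d) f ->
    {ae haar R d, forall x, U (s + t) f x = U s (U t f) x};
  group_continuous : forall f, in_L2 (haar R d) f ->
    L2norm (haar R d) (fun x => U h f x - f x) @[h --> (0 : R)] --> 0%E;
  group_generator : forall f, smooth f ->
    L2norm (haar R d)
      (fun x => (h^-1)%:C%C * (U h f x - f x) - 'i%C * laplacian f x)
      @[h --> (0 : R)^'] --> 0%E
}.

Definition jointly_measurable (u : R -> torus R d -> R[i]) :=
  cmeasurable (fun p : measurableTypeR R * torus R d => u p.1 p.2).

Definition L1L2norm (a b : R) (f : R -> torus R d -> R[i]) : \bar R :=
  (\int[leb]_(s in `]a, b[) L2norm (haar R d) (f s))%E.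

(* A class in L^1_loc(R; L^2) has a representative that is jointly measurable
   and takes all its values in L^2. *)
Definition bounded_L1loc_L2 (f : nat -> R -> torus R d -> R[i]) :=
  (forall n, jointly_measurable (f n)) /\
  (forall n s, in_L2 (haar R d) (f n s)) /\
  (forall a b : R, exists M : R, forall n, (L1L2norm a b (f n) <= M%:E)%E).

Definition bounded_L2 (u0 : nat -> torus R d -> R[i]) :=
  (forall n, in_L2 (haar R d) (u0 n)) /\
  (exists M : R, forall n, (L2norm (haar R d) (u0 n) <= M%:E)%E).

Definition integral_from0 (t : R) (G : R -> R[i]) : R[i] :=
  if 0 <= t then Cintegral (mrestr leb (measurable_itv `[0, t])) G
  else - Cintegral (mrestr leb (measurable_itv `[t, 0])) G.

(* The L^2-valued integral over (0, t) is characterized by its inner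
   products against the elements g of L^2. *)
Definition duhamel U (u0 : torus R d -> R[i]) (f u : R -> torus R d -> R[i]) :=
  jointly_measurable u /\
  forall t, in_L2 (haar R d) (u t) /\
    forall g, in_L2 (haar R d) g ->
      inner (haar R d) (u t) g =
        inner (haar R d) (U t u0) g +
        'i%C^-1 *
          integral_from0 t (fun s => inner (haar R d) (U (t - s) (f s)) g).

Definition dtdx (T : R) : {measure set (measurableTypeR R * torus R d) -> \bar R}
  := (mrestr leb (measurable_itv (`]0, T[)%R) \x haar R d)%E.

Definition strip (T : R) : set (R * torus R d) := `]0, T[ `*` setT.

(* Radon measures on the open set (0, T) x torus are extended by 0 to
   R x torus.  Finiteness on compact sets is enough, the space being locally
   compact and second countable. *)
Definition radon_on_strip (T : R)
    (nu : {measure set (measurableTypeR R * torus R d) -> \bar R}) :=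
  nu (~` strip T) = 0%E /\
  forall K : set (R * torus R d), compact K -> K `<=` strip T ->
    (nu K < +oo)%E.

Definition test_function (T : R) (phi : R * torus R d -> R) :=
  continuous phi /\
  exists2 K : set (R * torus R d), compact K /\ K `<=` strip T &
    forall p, ~ K p -> phi p = 0.

Definition weak_star_limit (T : R) (u : nat -> R -> torus R d -> R[i])
    (nu : {measure set (measurableTypeR R * torus R d) -> \bar R}) :=
  exists2 sigma : nat -> nat, {homo sigma : m n / (m < n)%N} &
    forall phi, test_function T phi ->
      (\int[dtdx T]_p (phi p * Normc.normc (u (sigma k) p.1 p.2) ^+ 2))%R
        @[k --> \oo] --> (\int[nu]_p phi p)%R.

Definition property_AC (T : R) (u : nat -> R -> torus R d -> R[i]) :=
  forall nu, radon_on_strip T nu -> weak_star_limit T u nu -> nu `<< dtdx T.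

Definition spacetime_L2norm (T : R) (u : R -> torus R d -> R[i]) : \bar R :=
  L2norm (dtdx T) (fun p => u p.1 p.2).

End torus_analysis.

(* Main.v *)
(* Expand u_n in the waves E_k(t, x) = exp(2 i pi k.x - 4 i pi^2 |k|^2 t).  It
   suffices to show that, for continuous weights phi_j decreasing to the indicator
   function of a closed null subset of the strip,
     int phi_j |sum_k a_k E_k|^2 <= kappa_j sum_k |a_k|^2   with kappa_j -> 0,
   uniformly in the finite sum: Duhamel's formula, a weighted Cauchy-Schwarz
   inequality in time and Parseval's identity transfer this bound to u_n, and the
   mass that a weak limit gives to the null set is at most lim_j kappa_j.
   To bound kappa_j, approximate phi_j uniformly by a trigonometric polynomial p.
   A frequency (n, m) of p with m <> 0 couples E_k and E_l only if k - l = m and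
   2 k.m - |m|^2 is prescribed, hence only for k and l in finitely many affine
   hyperplanes.  Off these hyperplanes the E_k are orthogonal for the weight p;
   on each of them the differences of frequencies span a space of smaller
   dimension, and one concludes by induction on the dimension. *)
Require Import Defs.
From HB Require Import structures.
From mathcomp Require Import all_boot all_order all_algebra.
From mathcomp Require Import all_classical all_reals all_analysis.
From mathcomp Require Import measurable_realfun complex zify ring lra.
From mathcomp Require finmap.

Set Implicit Arguments.
Unset Strict Implicit.
Unset Printing Implicit Defensive.

Import Order.TTheory GRing.Theory Num.Theory.
Import numFieldNormedType.Exports.

Local Open Scope classical_set_scope.
Local Open Scope ring_scope.

Local Notation normc := Normc.normc.
Local Notation Re := complex.Re.
Local Notation Im := complex.Im.

(** * Stone-Weierstrass theorem *)

(** The hyperplanes depend on the polynomial p, hence on the precision e, and each of them contains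
    infinitely many frequencies. The induction therefore carries smallness for every e at once,
    uniformly over all finite sums with frequencies in a given set: finitely many splittings, each
    losing a factor 2, then cost nothing. As the weights decrease in j, a bound obtained at one
    index persists, and the thresholds of the various pieces are combined by a maximum.
    Orthogonality in time needs a common period. Since 4 pi^2 |k|^2 N / (2 pi) = 2 pi N |k|^2, every
    P = N / (2 pi) is a period of all the waves; N is taken so large that (0, T) lies in (0, P), the
    weights being 0 outside (0, T). The source is only integrable in time, so the Duhamel integral
    is squared against the weight w(s) = ||f(s)|| + 1. Its total mass over (0, T) is bounded, and
    the time s contributes at most kappa ||f(s)||^2 / w(s) <= kappa ||f(s)||, which is
    integrable. *)

Lemma continuous_mulf {R : realType} (X : topologicalType) (f g : X -> R) :
  continuous f -> continuous g -> continuous (fun x => f x * g x).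
Proof. by move=> cf cg x; exact: (@continuousM R X f g x (cf x) (cg x)). Qed.

Lemma continuous_addf {R : realType} (X : topologicalType) (f g : X -> R) :
  continuous f -> continuous g -> continuous (fun x => f x + g x).
Proof. by move=> cf cg x; exact: (@continuousD R R^o X f g x (cf x) (cg x)). Qed.

Lemma continuous_subf {R : realType} (X : topologicalType) (f g : X -> R) :
  continuous f -> continuous g -> continuous (fun x => f x - g x).
Proof. by move=> cf cg x; exact: (@continuousB R R^o X f g x (cf x) (cg x)). Qed.

(** The point [x0] turns [X] into a pointed space with the same topology, in which the two notions
    of compactness agree. *)
Lemma compact_cover_compact (X : topologicalType) (K : set X) (x0 : X) :
  compact K -> cover_compact K.
Proof.
pose pX := HB.pack_for ptopologicalType (Topological.sort X) (Topological.class X)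
  (isPointed.Build (Topological.sort X) x0).
have E := @compact_cover pX.
move=> cK; have : @compact pX K by exact: cK.
by rewrite E; exact.
Qed.

Section stone_weierstrass.
Context {R : realType} {X : topologicalType}.
Variables (K : set X) (A : set (X -> R)).
Hypothesis compactK : compact K.
Hypothesis A_continuous : forall g, A g -> continuous g.
Hypothesis A_cst : forall c : R, A (fun=> c).
Hypothesis A_add : forall g h, A g -> A h -> A (fun x => g x + h x).
Hypothesis A_mul : forall g h, A g -> A h -> A (fun x => g x * h x).

Let A_scale c g : A g -> A (fun x => c * g x).
Proof. by move=> Ag; exact: A_mul. Qed.

Let approximable (g : X -> R) := continuous g /\
  forall e, 0 < e -> exists2 h, A h & forall x, K x -> `|g x - h x| <= e.

Let sqrt_iter (y : R) : nat -> R :=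
  fix it n := if n is n'.+1 then it n' + 2^-1 * (y ^+ 2 - it n' ^+ 2) else 0.

(* The Newton-like iteration converging to |y| from below, uniformly on
   [-1, 1]. *)
Let sqrt_iterP (y : R) n : `|y| <= 1 ->
  0 <= `|y| - sqrt_iter y n <= `|y| * (1 - `|y| / 2) ^+ n /\ 0 <= sqrt_iter y n.
Proof.
move=> y1; elim: n => [|n [/andP[h1 h2] h3]] /=.
  by rewrite subr0 expr0 mulr1 normr_ge0 !lexx.
set s := sqrt_iter y n in h1 h2 h3 *.
rewrite -[y ^+ 2]real_normK ?num_real//.
have y0 := normr_ge0 y.
set z := `|y| in y0 y1 h1 h2 h3 *.
(* The error is multiplied by 1 - (z + s) / 2, which lies between 0 and 1 - z / 2 because 0 <= s <=
   z <= 1. *)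
have e : z - (s + 2^-1 * (z ^+ 2 - s ^+ 2)) = (z - s) * (1 - (z + s) / 2).
  by field.
have zs : 0 <= 1 - (z + s) / 2 by lra.
split; last by rewrite addr_ge0// mulr_ge0// subr_sqr mulr_ge0// addr_ge0.
rewrite e mulr_ge0//=.
rewrite exprS mulrCA [leRHS]mulrC ler_pM//.
by lra.
Qed.

(** z (1 - z / 2)^n is uniformly small on [0, 1]: near 0 because of the factor z, away from 0
    because of the power. The inequality [H], of Bernoulli type, covers both regimes. *)
Let sqrt_iter_bound (y : R) n : `|y| <= 1 -> `| `|y| - sqrt_iter y n| <= 2 / n.+1%:R.
Proof.
move=> y1; have [/andP[h1 h2] _] := sqrt_iterP n y1.
rewrite ger0_norm//; apply: (le_trans h2).
have y0 := normr_ge0 y; set z := `|y| in y0 y1 *.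
have H : forall m, (1 - z / 2) ^+ m * (1 + m%:R * (z / 2)) <= 1.
  elim=> [|m IH]; first by rewrite expr0 mul0r addr0 mulr1.
  apply: le_trans IH; rewrite exprSr -mulrA ler_wpM2l ?exprn_ge0//; first by lra.
  rewrite -natr1; have m0 : 0 <= m%:R :> R by [].
  rewrite -subr_ge0.
  rewrite (_ : _ - _ = (m%:R + 1) * (z / 2) ^+ 2); last by field.
  by rewrite mulr_ge0 ?exprn_even_ge0 ?addr_ge0.
rewrite ler_pdivlMr// -natr1.
have := H n; set t := (1 - z / 2) ^+ n => tn.
have t0 : 0 <= t by rewrite exprn_ge0//; lra.
have t1 : t <= 1 by rewrite exprn_ile1//; lra.
have : z * t <= 1 by rewrite mulr_ile1.
by nra.
Qed.

Let A_sqrt_iter g n : A g -> A (fun x => sqrt_iter (g x) n).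
Proof.
move=> Ag; elim: n => [|n IH] /=; first exact: A_cst.
apply: A_add => //; apply: A_scale; apply: A_add.
  by apply: A_mul.
rewrite (_ : (fun x => _) = (fun x => -1 * (sqrt_iter (g x) n * sqrt_iter (g x) n))).
  by apply: A_scale; exact: A_mul.
by apply/funext => x; rewrite mulN1r -expr2.
Qed.

Let bound (g : X -> R) : continuous g -> exists2 M : R, 0 < M & forall x, K x -> `|g x| <= M.
Proof.
move=> cg.
have : compact (g @` K).
  by apply: continuous_compact => //; apply: continuous_subspaceT.
move=> /(@compact_bounded R R^o)[M [_ HM]].
exists (Num.max 1 (M + 1)); first by rewrite lt_max ltr01.
move=> x Kx; apply: (HM (Num.max 1 (M + 1))); last by exists x.
by rewrite lt_max [M < M + 1]ltrDl ltr01 orbT.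
Qed.

Let approximable_norm g : A g -> approximable (fun x => `|g x|).
Proof.
move=> Ag; split.
  by move=> x; apply: continuous_comp; [exact: A_continuous|exact: norm_continuous].
move=> e e0.
have [M M0 gM] := bound (A_continuous Ag).
have [n ne] := @ltr_add_invr R 0 (e / (2 * M)) (divr_gt0 e0 (mulr_gt0 (ltr0Sn _ 1) M0)).
pose h x := M * sqrt_iter (M^-1 * g x) n.
exists h; first by apply: A_scale; apply: A_sqrt_iter; exact: A_scale.
move=> x Kx; rewrite /h.
have -> : `|g x| = M * `|M^-1 * g x|.
  by rewrite normrM gtr0_norm ?invr_gt0// mulrA divff ?mul1r// gt_eqF.
rewrite -mulrBr normrM gtr0_norm//.
rewrite mulrC -ler_pdivlMr//.
apply: le_trans (sqrt_iter_bound _ _) _.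
  rewrite normrM gtr0_norm ?invr_gt0// mulrC ler_pdivrMr// mul1r; exact: gM.
rewrite add0r in ne.
have := ltW ne; rewrite ler_pdivlMr ?mulr_gt0// => h1.
by rewrite ler_pdivlMr// (le_trans _ h1)// [leRHS]mulrCA [leRHS]mulrA.
Qed.

(** max(a, b) = (a + b + |a - b|) / 2. The absolute value is approximated at [h1 - h2], which
    belongs to [A], and not at [g1 - g2], because [approximable_norm] speaks of elements of [A]. *)
Let approximable_max g1 g2 : approximable g1 -> approximable g2 ->
  approximable (fun x => Num.max (g1 x) (g2 x)).
Proof.
move=> [c1 a1] [c2 a2]; split.
  by move=> x; apply: continuous_max; [exact: c1|exact: c2].
move=> e e0.
have [h1 A1 H1] := a1 (e / 4) ltac:(lra).
have [h2 A2 H2] := a2 (e / 4) ltac:(lra).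
have A12 : A (fun x => h1 x + (- 1) * h2 x) by apply: A_add => //; exact: A_scale.
have [_ /(_ (e / 2) ltac:(lra))[h3 A3 H3]] := approximable_norm A12.
exists (fun x => 2^-1 * (h1 x + h2 x + h3 x)).
  by apply: A_scale; apply: A_add => //; exact: A_add.
move=> x Kx; have := H1 x Kx; have := H2 x Kx; have := H3 x Kx.
rewrite mulN1r.
rewrite maxEle; case: ifPn; rewrite ?(ler_norml, lerBlDl, lerBlDr) -?ltNge => g12;
  case: (lerP 0 (h1 x - h2 x)) => h12; rewrite ?(ger0_norm h12) ?(ltr0_norm h12);
  move=> /andP[? ?] /andP[? ?] /andP[? ?]; apply/andP; split; lra.
Qed.

Let approximable_opp g : approximable g -> approximable (fun x => - g x).
Proof.
move=> [c a]; split; first by move=> x; apply: continuousN; exact: c.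
move=> e e0; have [h Ah H] := a e e0.
exists (fun x => -1 * h x); first exact: A_scale.
by move=> x Kx; rewrite mulN1r -opprD normrN; exact: H.
Qed.

Let A_approximable g : A g -> approximable g.
Proof.
move=> Ag; split; first exact: A_continuous.
by move=> e e0; exists g => // x _; rewrite subrr normr0 ltW.
Qed.

(** Each [G y] exceeds f - e near y; finitely many of these neighbourhoods cover K, and h is the
    maximum of the corresponding [G y]. The last conclusion transfers to h any pointwise value or
    bound shared by all the [G y]. *)
Let cover_max (f : X -> R) (G : X -> X -> R) e : continuous f -> 0 < e -> K !=set0 ->
  (forall y, K y -> approximable (G y) /\ G y y = f y) ->
  exists h, [/\ approximable h, forall z, K z -> f z - e < h z &
    forall z, exists2 y, K y & h z = G y z].
Proof.
move=> cf e0 [x0 Kx0] HG; pose W y := [set z | f z - e < G y z].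
have := compact_cover_compact x0 compactK => /(_ X K W); case.
- move=> y Ky; have [[cG _] _] := HG y Ky.
  rewrite (_ : W y = (fun z => G y z - f z + e) @^-1` [set r | 0 < r]); last first.
    by apply/seteqP; split => z; rewrite /W/=; lra.
  apply: open_comp; last exact: open_gt.
  move=> z _; apply: continuous_addf => //; last exact: cst_continuous.
  exact: continuous_subf.
- move=> y Ky; exists y => //; rewrite /W/=; have [_ ->] := HG y Ky.
  by rewrite ltrBlDr ltrDl.
move=> D DK Dcov.
suff [h [ah hG Hh]] : exists h, [/\ approximable h, forall z, exists2 y, K y & h z = G y z &
    forall y, y \in finmap.enum_fset D -> forall z, G y z <= h z].
  exists h; split => // z Kz; have [y yD] := Dcov z Kz.
  by rewrite /W/= => /lt_le_trans; apply; apply: Hh.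
have : {subset finmap.enum_fset D <= K} by move=> y yD; apply: DK.
elim: (finmap.enum_fset D) => [_|y s IH sK].
  by exists (G x0); split => //; [have [] := HG x0 Kx0|move=> z; exists x0].
have [h [ah hG Hh]] := IH (fun z zs => sK z (mem_behead (s := y :: s) zs)).
have Ky : K y by apply/set_mem/sK; rewrite mem_head.
exists (fun z => Num.max (G y z) (h z)); split.
- by apply: approximable_max => //; have [] := HG y Ky.
- by move=> z; rewrite maxEle; case: ifP => _; [exact: hG|exists y].
- by move=> w; rewrite inE => /orP[/eqP ->|ws] z; rewrite le_max ?lexx// Hh// orbT.
Qed.

(** [cover_max] is used twice. For fixed x it gives [H x] above f - e / 2 and equal to f at x;
    applied to - f and to the functions [- H x], it acts as a minimum over x and yields the bound
    from above. *)
Lemma stone_weierstrass (f : X -> R) : continuous f ->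
  (forall x y, K x -> K y -> exists g, [/\ A g, g x = f x & g y = f y]) ->
  forall e, 0 < e -> exists2 g, A g & forall x, K x -> `|f x - g x| <= e.
Proof.
move=> cf interp e e0; have e2 : 0 < e / 2 by rewrite divr_gt0.
have [K0|K0] := pselect (K !=set0); last first.
  by exists (fun=> 0) => // x Kx; exfalso; apply: K0; exists x.
have upper x : exists h, K x -> [/\ approximable h, h x = f x &
    forall z, K z -> f z - e / 2 < h z].
  have [Kx|nKx] := pselect (K x); last by exists (fun=> 0).
  have [G HG] : {G : X -> X -> R & forall y, K y -> [/\ A (G y), G y x = f x & G y y = f y]}.
    apply: (@choice _ _ (fun y g => K y -> [/\ A g, g x = f x & g y = f y])) => y.
    have [Ky|nKy] := pselect (K y); last by exists (fun=> 0).
    by have [g Hg] := interp _ _ Kx Ky; exists g.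
  have [|h [ah fh hG]] := @cover_max f G _ cf e2 K0.
    by move=> y /HG[AG _ Gy]; split => //; exact: A_approximable.
  by exists h => _; split => //; have [y /HG[_ <- _] ->] := hG x.
have [H HH] := choice upper.
have cNf : continuous (fun z => - f z) by move=> z; apply: continuousN; exact: cf.
have [|h [ah fh hH]] := @cover_max (fun z => - f z) (fun x z => - H x z) _ cNf e2 K0.
  by move=> x /HH[aH Hx _]; split; [exact: approximable_opp|rewrite Hx].
have [_ /(_ _ e2)[g Ag Hg]] := approximable_opp ah.
exists g => // z Kz; have := fh z Kz; have := Hg z Kz.
have [y /HH[_ _ /(_ z Kz) h1] ->] := hH z; rewrite opprK !ler_norml => /andP[? ?] ?.
by apply/andP; split; lra.
Qed.

End stone_weierstrass.

(** * Characters of the torus *)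

Section torus_phase.
Context {R : realType} {d : nat}.
Implicit Types (a b : R) (x y : 'rV[R]_d) (k l m : 'rV[int]_d) (p q : torus R d).

Lemma cosDint a (z : int) : cos (a + pi *+ 2 * z%:~R) = cos a.
Proof.
have cosDnat (b : R) (n : nat) : cos (b + pi *+ 2 * n%:R) = cos b.
  by rewrite mulr_natr periodicn//; exact: cosD2pi.
case: z => n; first exact: cosDnat.
by rewrite NegzE mulrNz mulrN -(cosDnat _ n.+1) subrK.
Qed.

(** The fractional part y satisfies sin (pi y) = 0 by the half-angle formula, while the sine is
    positive on (0, pi). *)
Lemma cos_2pi_eq1 a : cos (pi *+ 2 * a) = 1 -> a \is a Num.int.
Proof.
move=> ca.
set y := a - (Num.floor a)%:~R.
have y0 : 0 <= y by rewrite subr_ge0 floor_le_tmp.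
have y1 : y < 1 by rewrite ltrBlDl -[X in _ < _ + X]/(1%:~R) -intrD floorD1_gt.
have cy : cos (pi *+ 2 * y) = 1.
  by rewrite -ca -(cosDint _ (Num.floor a)); congr cos; rewrite /y; ring.
have : sin (pi * y) = 0.
  move: cy; rewrite mulrnAl cos_mulr2n cos2sin2 => /eqP.
  rewrite -subr_eq0 => /eqP h.
  have : sin (pi * y) ^+ 2 = 0 by lra.
  by move/eqP; rewrite sqrf_eq0 => /eqP.
have [y00 _|yn0] := eqVneq y 0.
  by move/eqP: y00; rewrite subr_eq0 => /eqP ->; exact: intr_int.
move=> s0; have : 0 < sin (pi * y); last by rewrite s0 ltxx.
apply: sin_gt0_pi; rewrite mulr_gt0 ?pi_gt0 ?lt0r ?yn0//=.
by rewrite gtr_pMr// pi_gt0.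
Qed.

Definition phase m x : R := \sum_i pi *+ 2 * (m 0 i)%:~R * x 0 i.

Lemma phaseD k l x : phase (k + l) x = phase k x + phase l x.
Proof.
rewrite /phase -big_split/=; apply: eq_bigr => i _.
by rewrite mxE intrD; ring.
Qed.

Lemma phaseN k x : phase (- k) x = - phase k x.
Proof.
rewrite /phase -sumrN; apply: eq_bigr => i _.
by rewrite mxE intrN; ring.
Qed.

Lemma phase0 x : phase 0 x = 0.
Proof. by rewrite /phase big1// => i _; rewrite mxE mulr0 mul0r. Qed.

Lemma phase_delta j x : phase (delta_mx 0 j) x = pi *+ 2 * x 0 j.
Proof.
rewrite /phase (bigD1 j)//= !mxE !eqxx/= mulr1 big1 ?addr0// => i ij.
by rewrite !mxE eqxx (negbTE ij)/= mulr0 mul0r.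
Qed.

Lemma cos_phase_congr a m x y : congr_int x y ->
  cos (a + phase m x) = cos (a + phase m y).
Proof.
move=> /forallP xy.
have [z xyz] : exists z : int, phase m (x - y) = pi *+ 2 * z%:~R.
  have zi i : {z : int | x 0 i - y 0 i = z%:~R}.
    by apply: cid; have /intrP[z ->] := xy i; exists z.
  exists (\sum_i m 0 i * sval (zi i)).
  rewrite /phase rmorph_sum/= mulr_sumr; apply: eq_bigr => i _.
  rewrite !mxE; case: (zi i) => z /= ->.
  by rewrite intrM mulrA.
have -> : phase m x = phase m y + phase m (x - y).
  by rewrite /phase -big_split/=; apply: eq_bigr => i _; rewrite !mxE; ring.
by rewrite xyz addrA cosDint.
Qed.

Lemma congr_repr x : congr_int (repr (tproj x)) x.
Proof. by apply/eqmodP; rewrite reprK. Qed.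

Lemma cos_phase_repr a m x :
  cos (a + phase m (repr (tproj x))) = cos (a + phase m x).
Proof. by apply: cos_phase_congr; exact: congr_repr. Qed.

Lemma continuous_phase m : continuous (phase m).
Proof.
rewrite /phase; apply: (@continuous_big R _ +%R 0 xpredT) => [|i _ x].
  by move=> z; apply: cvgD; [exact: cvg_fst|exact: cvg_snd].
apply: (@continuous_comp _ _ _ (fun y : 'rV[R]_d => y 0 i) ( *%R (pi *+ 2 * (m 0 i)%:~R))).
  exact: coord_continuous.
exact: mulrl_continuous.
Qed.

Lemma continuous_cos_phase a m :
  continuous (fun p => cos (a + phase m (repr p)) : R).
Proof.
apply: (@repr_comp_continuous _ _ _ (fun x => cos (a + phase m x) : R)).
  move=> x; apply: continuous_comp; last exact: continuous_cos.
  by apply: continuousD; [exact: cst_continuous|exact: continuous_phase].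
move=> x y /eqP /eqmodP xy; apply/eqP; exact: cos_phase_congr.
Qed.

(** The cosine and the sine of each coordinate suffice. That this family is finite lets
    [distance_to_compact] sum it into a distance. *)
Lemma torus_separated_coord p q :
  (forall i, cos (0 + phase (delta_mx 0 i) (repr p)) =
             cos (0 + phase (delta_mx 0 i) (repr q))) ->
  (forall i, cos (- (pi / 2) + phase (delta_mx 0 i) (repr p)) =
             cos (- (pi / 2) + phase (delta_mx 0 i) (repr q))) -> p = q.
Proof.
move=> pq pq'; rewrite -(reprK p) -(reprK q); apply/eqmodP/forallP => i.
apply: cos_2pi_eq1.
have := pq i; have := pq' i.
rewrite !phase_delta !add0r !(addrC (- _)) !cosBpihalf => s c.
by rewrite mulrBr cosB -c -s -!expr2 cos2Dsin2.
Qed.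

Lemma torus_separated p q :
  (forall a m, cos (a + phase m (repr p)) = cos (a + phase m (repr q))) -> p = q.
Proof. by move=> pq; apply: torus_separated_coord. Qed.

Lemma torus_compact : compact [set: torus R d].
Proof.
have cK : compact [set x : 'rV[R]_d | forall i, `[0%R, 1%R]%classic (x ord0 i)].
  apply: (@rV_compact R d (fun=> `[0%R, 1%R]%classic)) => _.
  exact: segment_compact.
have : compact (@tproj R d @` [set x : 'rV[R]_d | forall i, `[0%R, 1%R]%classic (x ord0 i)]).
  apply: continuous_compact => //; apply: continuous_subspaceT.
  exact: pi_continuous.
congr (compact _); apply/seteqP; split => // p _.
pose x : 'rV[R]_d := \row_i (repr p 0 i - (Num.floor (repr p 0 i))%:~R).
exists x; last first.
  rewrite -[RHS]reprK; apply/eqmodP/forallP => i.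
  by rewrite mxE addrAC subrr add0r rpredN intr_int.
move=> i; rewrite /= in_itv/= !mxE subr_ge0 floor_le_tmp/=.
by rewrite lerBlDl -[X in _ <= _ + X]/(1%:~R) -intrD ltW// floorD1_gt.
Qed.

Lemma measurable_continuous_torus (f : torus R d -> R) :
  continuous f -> measurable_fun setT f.
Proof.
move=> cf; apply: (measurability _ (RGenOpens.measurableE R)).
move=> _ [_ [a [b ->] <-]]; rewrite setTI.
apply: sub_sigma_algebra; move/continuousP: cf; apply.
exact: interval_open.
Qed.

Lemma measurable_cos_phase a m :
  measurable_fun setT (fun p => cos (a + phase m (repr p)) : R).
Proof. by apply: measurable_continuous_torus; exact: continuous_cos_phase. Qed.

End torus_phase.

(** * Bounded measurable functions and their integrals *)

Section bounded_measurable.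
Context {disp : measure_display} {T : measurableType disp} {R : realType}.
Implicit Types f g : T -> R.

(** On a finite measure space these functions form an algebra of integrable functions, so that
    integrals of sums and products can be expanded freely. *)
Definition bmeas f := measurable_fun setT f /\ exists M, forall x, `|f x| <= M.

Lemma bmeas_cst c : bmeas (fun=> c).
Proof. by split; [exact: measurable_cst|exists `|c|]. Qed.

Lemma bmeasD f g : bmeas f -> bmeas g -> bmeas (fun x => f x + g x).
Proof.
move=> [mf [M fM]] [mg [N gN]]; split; first exact: measurable_funD.
by exists (M + N) => x; rewrite (le_trans (ler_normD _ _))// lerD.
Qed.

Lemma bmeasM f g : bmeas f -> bmeas g -> bmeas (fun x => f x * g x).
Proof.
move=> [mf [M fM]] [mg [N gN]]; split; first exact: measurable_funM.
by exists (M * N) => x; rewrite normrM ler_pM.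
Qed.

Lemma bmeasZ c f : bmeas f -> bmeas (fun x => c * f x).
Proof. by apply: bmeasM; exact: bmeas_cst. Qed.

Lemma bmeasN f : bmeas f -> bmeas (fun x => - f x).
Proof.
move=> /(bmeasZ (-1)); congr bmeas; apply/funext => x; exact: mulN1r.
Qed.

Lemma bmeasB f g : bmeas f -> bmeas g -> bmeas (fun x => f x - g x).
Proof. by move=> bf /bmeasN; exact: bmeasD. Qed.

Lemma bmeas_sum (I : Type) (r : seq I) (F : I -> T -> R) :
  (forall i, bmeas (F i)) -> bmeas (fun x => \sum_(i <- r) F i x).
Proof.
move=> bF; elim: r => [|i r IH].
  by rewrite (_ : (fun x => _) = (fun=> 0)); [exact: bmeas_cst|
    apply/funext => x; rewrite big_nil].
rewrite (_ : (fun x => _) = (fun x => F i x + \sum_(j <- r) F j x)).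
  exact: bmeasD.
by apply/funext => x; rewrite big_cons.
Qed.

Variable mu : {measure set T -> \bar R}.
Hypothesis mu_fin : (mu setT < +oo)%E.

Lemma bmeas_integrable f : bmeas f -> mu.-integrable setT (EFin \o f).
Proof.
move=> [mf [M fM]]; apply: measurable_bounded_integrable => //.
by exists M; split; [exact: num_real|move=> y My x _ /=; exact: le_trans (fM x) (ltW My)].
Qed.

Lemma RintegralD_bmeas f g : bmeas f -> bmeas g ->
  (\int[mu]_x (f x + g x) = \int[mu]_x f x + \int[mu]_x g x)%R.
Proof. by move=> bf bg; rewrite RintegralD//; exact: bmeas_integrable. Qed.

Lemma RintegralZ_bmeas c f : bmeas f ->
  (\int[mu]_x (c * f x) = c * \int[mu]_x f x)%R.
Proof. by move=> bf; rewrite RintegralZl//; exact: bmeas_integrable. Qed.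

Lemma le_Rintegral_bmeas f g : bmeas f -> bmeas g -> (forall x, f x <= g x) ->
  (\int[mu]_x f x <= \int[mu]_x g x)%R.
Proof. by move=> bf bg fg; apply: le_Rintegral => //; exact: bmeas_integrable. Qed.

Lemma Rintegral_sum_bmeas (I : Type) (r : seq I) (F : I -> T -> R) :
  (forall i, bmeas (F i)) ->
  (\int[mu]_x (\sum_(i <- r) F i x) = \sum_(i <- r) \int[mu]_x F i x)%R.
Proof.
move=> bF; elim: r => [|i r IH].
  rewrite big_nil.
  under eq_Rintegral do rewrite big_nil.
  by rewrite Rintegral_cst// mul0r.
rewrite big_cons -IH -RintegralD_bmeas//; last exact: bmeas_sum.
by apply: eq_Rintegral => x _; rewrite big_cons.
Qed.

End bounded_measurable.

Section restricted_integral.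
Context {disp : measure_display} {T : measurableType disp} {R : realType}.
Variables (mu : {measure set T -> \bar R}) (D : set T) (mD : measurable D).

Lemma integral_mrestr (f : T -> \bar R) : measurable_fun setT f ->
  (\int[mrestr mu mD]_x f x = \int[mu]_(x in D) f x)%E.
Proof.
move=> mf.
rewrite -(@eq_measure_integral _ _ _ D mu (mrestr mu mD)); last first.
  by move=> A mA AD; rewrite /mrestr; congr (mu _); apply/setIidPl.
rewrite [RHS]integral_mkcond; apply: ae_eq_integral => //.
  by apply/(measurable_restrictT _ _).1 => //; exact: measurable_funTS.
exists (~` D); split; first exact: measurableC.
  by change (mu (~` D `&` D) = 0%E); rewrite setICl measure0.
move=> x /= /not_implyP[_]; apply: contra_not => Dx.
by rewrite patchE mem_set.
Qed.

End restricted_integral.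

Section cosine_integrals.
Context {R : realType}.
Local Notation leb := (@lebesgue_measure R).

(** The last hypothesis says that the primitive w^-1 sin (b + w x) takes the same value at 0 and at
    a; the sine is written as a shifted cosine so that [cosDint] provides it. *)
Lemma Rintegral_cos_period (a w b : R) : 0 < a -> w != 0 -> cos (b - pi / 2 + w * a) = cos (b - pi / 2) ->
  (\int[leb]_(x in `[0, a]) cos (b + w * x) = 0)%R.
Proof.
move=> a0 w0 per.
pose F x := w^-1 * sin (b + w * x).
have dF (x : R) : is_derive x 1 F (cos (b + w * x)).
  apply: is_derive_eq.
  by rewrite /GRing.scale/= add0r mul1r mulr1 mulrCA mulVf// mulr1.
rewrite /Rintegral (@continuous_FTC2 _ (fun x => cos (b + w * x)) F 0 a)//.
- by rewrite /F mulr0 addr0 -!cosBpihalf addrAC per -EFinB subrr.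
- apply: continuous_subspaceT => x.
  apply: continuous_comp; last exact: continuous_cos.
  by apply: continuousD; [exact: cst_continuous|exact: mulrl_continuous].
- split; first by move=> x _; have [] := dF x.
  + apply: cvg_at_right_filter; apply: differentiable_continuous.
    by apply/derivable1_diffP; have [] := dF 0.
  + apply: cvg_at_left_filter; apply: differentiable_continuous.
    by apply/derivable1_diffP; have [] := dF a.
- by move=> x _; rewrite derive1E; apply: derive_val.
Qed.

End cosine_integrals.

Lemma probability_lty d (T : measurableType d) (R : realType) (P : probability T R) :
  (P setT < +oo)%E.
Proof. by rewrite probability_setT ltry. Qed.

Lemma product_measure_lty d1 d2 (T1 : measurableType d1) (T2 : measurableType d2)
    (R : realType) (m1 : {measure set T1 -> \bar R})
    (m2 : {sigma_finite_measure set T2 -> \bar R}) :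
  (m1 setT < +oo -> m2 setT < +oo -> (m1 \x m2) setT < +oo)%E.
Proof.
move=> m1T m2T; rewrite -setXTT product_measure1E//.
by rewrite lte_mul_pinfty// ge0_fin_numE.
Qed.

(** * Integrals of characters against the Haar measure *)

Section orthogonality.
Context {R : realType}.
Local Open Scope ereal_scope.

Lemma measurable_cos_affine (a b : R) :
  measurable_fun setT (fun x : measurableTypeR R => cos (a + b * x)%R).
Proof.
apply: continuous_measurable_fun => x.
apply: continuous_comp; last exact: continuous_cos.
by apply: continuousD; [exact: cst_continuous|exact: mulrl_continuous].
Qed.

Lemma integral_unit_cos (b : R) (z : int) :
  \int[@unit_lebesgue R]_x (cos (b + pi *+ 2 * z%:~R * x))%:E =
  (if z == 0%R then cos b else 0%R)%:E.
Proof.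
rewrite integral_mrestr; last first.
  by apply/measurable_EFinP; exact: measurable_cos_affine.
rewrite integral_itv_bndo_bndc; last first.
  by apply/measurable_EFinP/measurable_funTS; exact: measurable_cos_affine.
case: eqVneq => [->|z0].
  under eq_integral do rewrite mulr0 mul0r addr0.
  by rewrite integral_cst//= lebesgue_measure_itv/= lte_fin ltr01 oppr0 adde0 mule1.
have w0 : (pi *+ 2 * z%:~R != 0 :> R)%R.
  by rewrite mulf_neq0 ?intr_eq0// mulrn_eq0/= gt_eqF// pi_gt0.
have := @Rintegral_cos_period R 1 (pi *+ 2 * z%:~R) b ltr01 w0.
rewrite mulr1 cosDint => /(_ erefl) int0.
rewrite -[LHS]fineK; first by congr (_%:E).
apply: integrable_fin_num => //.
apply: (@continuous_compact_integrable _ (fun x => cos (b + pi *+ 2 * z%:~R * x)%R)).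
  exact: segment_compact.
apply: continuous_subspaceT => x.
apply: continuous_comp; last exact: continuous_cos.
by apply: continuousD; [exact: cst_continuous|exact: mulrl_continuous].
Qed.

Lemma measurable_cos_phase_tuple d (a : R) (m : 'rV[int]_d) :
  measurable_fun setT
    (fun s : d.-tuple (measurableTypeR R) => cos (a + phase m (\row_i tnth s i))%R).
Proof.
rewrite (_ : (fun s => _) = (fun p => cos (a + phase m (repr p)) : R) \o @tuple_torus R d).
  by apply: measurableT_comp; [exact: measurable_cos_phase|exact: measurable_tuple_torus].
by apply/funext => s /=; rewrite cos_phase_repr.
Qed.

Lemma phase_tcons d (m : 'rV[int]_d.+1) x (s : d.-tuple (measurableTypeR R)) :
  (phase m (\row_i tnth (tcons (x, s)) i) =
  pi *+ 2 * (m 0 0)%:~R * x + phase (\row_i m 0 (lift ord0 i)) (\row_i tnth s i))%R.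
Proof.
rewrite /phase big_ord_recl !mxE; congr (_ + _)%R.
by apply: eq_bigr => i _; rewrite !mxE tnthS.
Qed.

Lemma integral_cube_cos d (a : R) (m : 'rV[int]_d) :
  \int[cube_lebesgue R d]_s (cos (a + phase m (\row_i tnth s i)))%:E =
  (if m == 0%R then cos a else 0%R)%:E.
Proof.
elim: d a m => [|d IH] a m.
  rewrite /= integral_dirac//; last first.
    by apply/measurable_EFinP; exact: measurable_cos_phase_tuple.
  by rewrite diracT mul1e thinmx0 phase0 addr0; case: eqP.
rewrite /= integral_distribution; last 2 first.
- by apply/measurable_EFinP; exact: measurable_cos_phase_tuple.
- apply: bmeas_integrable; first by rewrite -ge0_fin_numE//; exact: fin_num_measure.
  split; last by exists 1%R => x; exact: cos_max.
  apply: (@measurableT_comp _ _ _ _ _ _ (fun s => cos (a + phase m (\row_i tnth s i)) : R)).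
    exact: measurable_cos_phase_tuple.
  exact: measurable_tcons.
pose f (p : measurableTypeR R * d.-tuple (measurableTypeR R)) :=
  cos (a + phase m (\row_i tnth (tcons p) i))%R.
have mf : measurable_fun setT f.
  apply: (@measurableT_comp _ _ _ _ _ _ (fun s => cos (a + phase m (\row_i tnth s i)) : R)).
    exact: measurable_cos_phase_tuple.
  exact: measurable_tcons.
rewrite -(@integral12_prod_meas1 _ _ _ _ _ _ _ (EFin \o f)); last first.
  apply: bmeas_integrable; first by apply: product_measure_lty; exact: probability_lty.
  by split => //; exists 1%R => x; exact: cos_max.
rewrite /fubini_F/=.
transitivity (\int[@unit_lebesgue R]_x
   (if (\row_i m 0%R (lift ord0 i)) == 0%R :> 'rV[int]_d
    then cos (a + pi *+ 2 * (m 0 0)%:~R * x) else 0%R)%:E).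
  apply: eq_integral => x _ /=.
  rewrite -IH; apply: eq_integral => s _.
  by rewrite /f phase_tcons addrA.
have m0E : (m == 0%R) = (m 0%R 0%R == 0%R) && (\row_i m 0%R (lift ord0 i) == 0%R :> 'rV[int]_d).
  apply/idP/idP => [/eqP ->|/andP[/eqP m0 /eqP/rowP m1]].
    by rewrite mxE eqxx/=; apply/eqP/rowP => i; rewrite !mxE.
  apply/eqP/rowP => i; rewrite mxE; case: (unliftP ord0 i) => [j ->|-> //].
  by have := m1 j; rewrite !mxE.
rewrite m0E; case: (_ =P 0%R :> 'rV[int]_d) => _; rewrite ?andbT ?andbF ?integral0//.
exact: integral_unit_cos.
Qed.

Lemma integral_haar_cos d (a : R) (m : 'rV[int]_d) :
  (\int[haar R d]_p cos (a + phase m (repr p)) = if m == 0 then cos a else 0)%R.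
Proof.
rewrite /Rintegral integral_distribution; last 2 first.
- by apply/measurable_EFinP; exact: measurable_cos_phase.
- apply: (@bmeas_integrable _ _ _ _ _ (fun s => cos (a + phase m (repr (tuple_torus s)))%R)).
    exact: probability_lty.
  split; last by exists 1%R => x; exact: cos_max.
  have := @measurable_cos_phase_tuple d a m; congr (measurable_fun _ _).
  by apply/funext => s; rewrite /tuple_torus cos_phase_repr.
rewrite -[RHS]/(fine (_)%:E) -integral_cube_cos; congr fine.
by apply: eq_integral => s _ /=; rewrite cos_phase_repr.
Qed.

End orthogonality.

(** * Space-time measure and trigonometric polynomials *)

Section space_time_measure.
Context {R : realType} {d : nat}.
Local Notation leb := (@lebesgue_measure R).
Local Notation RB := (measurableTypeR R).
Implicit Types (T a b : R) (m k l : 'rV[int]_d).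

(** The time factor of [dtdx], under a name to which the structure of finite measure is attached. *)
Definition time_lebesgue T : set RB -> \bar R :=
  mrestr leb (measurable_itv (`]0, T[)%R).

HB.instance Definition _ T := Measure.on (time_lebesgue T).

Lemma time_lebesgue_fin T : fin_num_fun (time_lebesgue T).
Proof.
apply: lty_fin_num_fun; change (leb ([set: RB] `&` `]0%R, T[) < +oo)%E.
rewrite setTI lebesgue_measure_itv/=.
by case: ifPn => _; rewrite ltry.
Qed.

HB.instance Definition _ T :=
  Measure_isFinite.Build _ _ _ (time_lebesgue T) (@time_lebesgue_fin T).

Lemma dtdx_lty T : (dtdx d T setT < +oo)%E.
Proof.
apply: (@product_measure_lty _ _ _ _ _ (time_lebesgue T) (haar R d)).
  by rewrite -ge0_fin_numE//; exact: time_lebesgue_fin.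
exact: probability_lty.
Qed.

Lemma integral_dtdx T (F : RB * torus R d -> \bar R) :
  measurable_fun setT F -> (forall p, 0 <= F p)%E ->
  (\int[dtdx d T]_p F p = \int[leb]_(t in `]0%R, T[) \int[haar R d]_x F (t, x))%E.
Proof.
move=> mF F0.
rewrite [LHS](@fubini_tonelli1 _ _ _ _ _ (time_lebesgue T) (haar R d))//.
rewrite integral_mrestr//.
exact: (@measurable_fun_fubini_tonelli_F _ _ _ _ _ (haar R d)).
Qed.

Lemma Rintegral_dtdx T (F : RB * torus R d -> R) : bmeas F ->
  (\int[dtdx d T]_p F p = \int[leb]_(t in `]0, T[) \int[haar R d]_x F (t, x))%R.
Proof.
move=> bF.
have iF : (time_lebesgue T \x haar R d)%E.-integrable setT (EFin \o F).
  by apply: bmeas_integrable => //; exact: dtdx_lty.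
rewrite /Rintegral -[in LHS](@integral12_prod_meas1 _ _ _ _ _ (time_lebesgue T) (haar R d))//.
congr fine.
have -> : fubini_F (haar R d) (EFin \o F) = (fun t => (\int[haar R d]_x F (t, x))%R%:E).
  apply/funext => t; rewrite /fubini_F/= /Rintegral fineK//.
  apply: integrable_fin_num => //; apply: bmeas_integrable; first exact: probability_lty.
  case: bF => mF [M FM]; split; last by exists M.
  by apply: measurableT_comp => //; exact: pair1_measurable.
rewrite integral_mrestr//.
have := @measurable_fubini_F _ _ _ _ _ (time_lebesgue T) (haar R d) _ iF.
congr measurable_fun.
apply/funext => t; rewrite /fubini_F/= /Rintegral fineK//.
apply: integrable_fin_num => //; apply: bmeas_integrable; first exact: probability_lty.
case: bF => mF [M FM]; split; last by exists M.
by apply: measurableT_comp => //; exact: pair1_measurable.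
Qed.

Lemma measurable_strip T : measurable (strip T : set (RB * torus R d)).
Proof. by apply: measurableX. Qed.

Lemma dtdx_stripC T : dtdx d T (~` strip T) = 0%E.
Proof.
rewrite (_ : ~` strip T = (~` `]0, T[%classic : set RB) `*` setT).
  rewrite [LHS](@product_measure1E _ _ _ _ _ (time_lebesgue T) (haar R d))//; last exact: measurableC.
  transitivity (0 * haar R d setT)%E; last by rewrite mul0e.
  congr (_ * _)%E; change (leb ((~` `]0, T[%classic : set RB) `&` `]0, T[%classic) = 0%E).
  by rewrite setICl measure0.
apply/seteqP; split => p /=; last by move=> [np _] [].
by move=> np; split => // tp; apply: np; split.
Qed.

Lemma Rintegral_strip T (F : RB * torus R d -> R) : bmeas F ->
  (\int[dtdx d T]_p F p = \int[dtdx d T]_(p in strip T) F p)%R.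
Proof.
move=> bF; rewrite /Rintegral; congr fine.
transitivity (\int[dtdx d T]_(p in setT `\` ~` strip T) (F p)%:E)%E; last first.
  by rewrite setDE setCK setTI.
apply: negligible_integral => //.
- by apply: measurableC; exact: measurable_strip.
- by apply: bmeas_integrable => //; exact: dtdx_lty.
- exact: dtdx_stripC.
Qed.

Lemma le_Rintegral_dtdx T (F G : RB * torus R d -> R) : bmeas F -> bmeas G ->
  (forall p, strip T p -> F p <= G p) ->
  (\int[dtdx d T]_p F p <= \int[dtdx d T]_p G p)%R.
Proof.
move=> bF bG FG; rewrite !Rintegral_strip//.
have mS := measurable_strip T.
by apply: le_Rintegral => //; apply: (@integrableS _ _ _ _ setT) => //;
  apply: bmeas_integrable => //; exact: dtdx_lty.
Qed.

(** The shift [a] gives the cosine for 0 and the sine for - pi / 2, so that real monomials alone are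
    needed, and a product of two of them is a combination of two others. *)
Definition mono a b m (p : R * torus R d) : R :=
  cos (a + b * p.1 + phase m (repr p.2)).

Lemma continuous_mono a b m : continuous (mono a b m).
Proof.
have E p : mono a b m p = cos (a + b * p.1) * cos (0 + phase m (repr p.2)) -
    sin (a + b * p.1) * cos (- (pi / 2) + phase m (repr p.2)).
  by rewrite /mono cosD add0r [- _ + _]addrC cosBpihalf.
have caff : continuous (fun p : R * torus R d => a + b * p.1).
  move=> p; apply: (@continuous_comp _ _ _ fst (fun t : R => a + b * t)); first exact: cvg_fst.
  by apply: continuousD; [exact: cst_continuous|exact: mulrl_continuous].
have cph c : continuous (fun p : R * torus R d => cos (c + phase m (repr p.2)) : R).
  move=> p; apply: (@continuous_comp _ _ _ snd (fun q : torus R d => cos (c + phase m (repr q)) : R)).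
    exact: cvg_snd.
  exact: continuous_cos_phase.
rewrite (_ : mono a b m = fun p => cos (a + b * p.1) * cos (0 + phase m (repr p.2)) -
    sin (a + b * p.1) * cos (- (pi / 2) + phase m (repr p.2))); last exact/funext.
apply: continuous_subf; apply: continuous_mulf => //.
- by move=> p; apply: continuous_comp; [exact: caff|exact: continuous_cos].
- by move=> p; apply: continuous_comp; [exact: caff|exact: continuous_sin].
Qed.

(** Measurability refers to the product sigma-algebra, so it is obtained by splitting the monomial
    into products of functions of one variable rather than from its continuity. *)
Lemma bmeas_mono a b m : bmeas (mono a b m : RB * torus R d -> R).
Proof.
split; last by exists 1 => p; exact: cos_max.
rewrite (_ : mono a b m = fun p => cos (a + b * p.1) * cos (0 + phase m (repr p.2)) +
    cos (a + pi / 2 + b * p.1) * cos (- (pi / 2) + phase m (repr p.2))); last first.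
  apply/funext => p; rewrite /mono cosD add0r [- _ + _]addrC cosBpihalf.
  by rewrite [a + _ + _]addrAC cosDpihalf mulNr.
apply: measurable_funD; apply: measurable_funM.
- by apply: (measurableT_comp (measurable_cos_affine a b)); exact: measurable_fst.
- by apply: (measurableT_comp (measurable_cos_phase 0 m)); exact: measurable_snd.
- by apply: (measurableT_comp (measurable_cos_affine (a + pi / 2) b)); exact: measurable_fst.
- by apply: (measurableT_comp (measurable_cos_phase (- (pi / 2)) m)); exact: measurable_snd.
Qed.

(** Integration in space already gives 0 when m <> 0. For m = 0 the time integral vanishes because
    [T] is a period. *)
Lemma Rintegral_mono T a b m : 0 < T ->
  (exists z : int, b * T = pi *+ 2 * z%:~R) ->
  (\int[dtdx d T]_p mono a b m p =
     if (m == 0) && (b == 0) then T * cos a else 0)%R.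
Proof.
move=> T0 [z bT].
rewrite Rintegral_dtdx; last exact: bmeas_mono.
transitivity (\int[leb]_(t in `]0, T[) (if m == 0 then cos (a + b * t) else 0))%R.
  by apply: eq_Rintegral => t _; exact: (integral_haar_cos (a + b * t) m).
case: eqVneq => [_|m0] /=; last by rewrite Rintegral_cst//= mul0r.
case: eqVneq => [->|b0].
  under eq_Rintegral do rewrite mul0r addr0.
  by rewrite Rintegral_cst//= lebesgue_measure_itv/= lte_fin T0 oppr0 adde0/= mulrC.
transitivity (\int[leb]_(x in `[0, T]) cos (a + b * x))%R; last first.
  by rewrite Rintegral_cos_period// bT cosDint.
rewrite /Rintegral integral_itv_obnd_cbnd; last first.
  by apply/measurable_EFinP/measurable_funTS; exact: measurable_cos_affine.
rewrite integral_itv_bndo_bndc//.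
by apply/measurable_EFinP/measurable_funTS; exact: measurable_cos_affine.
Qed.

Lemma Rintegral_dtdx_cst T c : 0 < T -> (\int[dtdx d T]_p c = c * T)%R.
Proof.
move=> T0; have := @Rintegral_mono T 0 0 0 T0 ltac:(by exists 0; rewrite mul0r mulr0).
rewrite !eqxx/= cos0 mulr1 => E; rewrite -[X in _ = _ * X]E.
rewrite -RintegralZ_bmeas; [|exact: dtdx_lty|exact: bmeas_mono].
by apply: eq_Rintegral => p _; rewrite /mono phase0 mul0r !addr0 cos0 mulr1.
Qed.

End space_time_measure.

(** * Real trigonometric polynomials and their density *)

Section trigonometric_polynomials.
Context {R : realType} {d : nat}.
Local Notation RB := (measurableTypeR R).
Implicit Types (P a b : R) (m k l : 'rV[int]_d).

(** An entry of [s] consists of an amplitude, a phase shift, an integer time frequency in units of 2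
    pi / P, and a space frequency. *)
Definition trig P (s : seq (R * R * int * 'rV[int]_d)) (p : R * torus R d) : R :=
  \sum_(q <- s) q.1.1.1 * mono q.1.1.2 (pi *+ 2 * q.1.2%:~R / P) q.2 p.

Let is_trig P (g : R * torus R d -> R) := exists s, forall p, g p = trig P s p.

Let is_trig_mono P c a (n : int) m :
  is_trig P (fun p => c * mono a (pi *+ 2 * n%:~R / P) m p).
Proof. by exists [:: (c, a, n, m)] => p; rewrite /trig big_seq1. Qed.

Let is_trig_cst P c : is_trig P (fun=> c).
Proof.
have [s Hs] := is_trig_mono P c 0 0 0.
by exists s => p; rewrite -Hs /mono phase0 mulr0 !mul0r !addr0 cos0 mulr1.
Qed.

Let is_trigD P g h : is_trig P g -> is_trig P h -> is_trig P (fun p => g p + h p).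
Proof.
by move=> [s gs] [r hr]; exists (s ++ r) => p; rewrite /trig big_cat gs hr.
Qed.

Lemma monoM a1 b1 m1 a2 b2 m2 (p : R * torus R d) :
  mono a1 b1 m1 p * mono a2 b2 m2 p =
  2^-1 * (mono (a1 + a2) (b1 + b2) (m1 + m2) p + mono (a1 - a2) (b1 - b2) (m1 - m2) p).
Proof.
rewrite /mono phaseD phaseD phaseN.
set A := a1 + b1 * _ + _; set B := a2 + b2 * _ + _.
rewrite (_ : a1 + a2 + _ + _ = A + B); last by rewrite /A /B; ring.
rewrite (_ : a1 - a2 + _ + _ = A - B); last by rewrite /A /B; ring.
by rewrite cosD cosB; field.
Qed.

Let is_trigM P g h : is_trig P g -> is_trig P h -> is_trig P (fun p => g p * h p).
Proof.
have monoM_trig c1 a1 (n1 : int) m1 c2 a2 (n2 : int) m2 :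
    is_trig P (fun p => (c1 * mono a1 (pi *+ 2 * n1%:~R / P) m1 p) *
                        (c2 * mono a2 (pi *+ 2 * n2%:~R / P) m2 p)).
  have [s Hs] := is_trigD
    (is_trig_mono P (c1 * c2 / 2) (a1 + a2) (n1 + n2) (m1 + m2))
    (is_trig_mono P (c1 * c2 / 2) (a1 - a2) (n1 - n2) (m1 - m2)).
  exists s => p; rewrite -Hs mulrACA monoM.
  rewrite (_ : pi *+ 2 * (n1 + n2)%:~R / P = pi *+ 2 * n1%:~R / P + pi *+ 2 * n2%:~R / P); last first.
    by rewrite intrD; ring.
  rewrite (_ : pi *+ 2 * (n1 - n2)%:~R / P = pi *+ 2 * n1%:~R / P - pi *+ 2 * n2%:~R / P); last first.
    by rewrite intrD intrN; ring.
  by ring.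
have trig_trig s : is_trig P (trig P s) by exists s.
move=> [s gs] [r hr].
have [t Ht] : is_trig P (fun p => trig P s p * trig P r p).
  elim: s {gs} => [|q s [t Ht]].
    by have [t Ht] := is_trig_cst P 0; exists t => p; rewrite -Ht /trig big_nil mul0r.
  have [t1 Ht1] : is_trig P (fun p => q.1.1.1 * mono q.1.1.2 (pi *+ 2 * q.1.2%:~R / P) q.2 p * trig P r p).
    elim: r {hr t Ht} => [|q' r [t1 Ht1]].
      by have [t Ht] := is_trig_cst P 0; exists t => p; rewrite -Ht /trig big_nil mulr0.
    have [t2 Ht2] := monoM_trig q.1.1.1 q.1.1.2 q.1.2 q.2 q'.1.1.1 q'.1.1.2 q'.1.2 q'.2.
    have [t3 Ht3] := is_trigD (trig_trig t1) (trig_trig t2).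
    by exists t3 => p; rewrite -Ht3 -Ht1 -Ht2 /trig big_cons mulrDr addrC.
  have [t3 Ht3] := is_trigD (trig_trig t1) (trig_trig t).
  by exists t3 => p; rewrite -Ht3 -Ht1 -Ht /trig big_cons mulrDl.
by exists t => p; rewrite -Ht gs hr.
Qed.

Lemma continuous_trig P s : continuous (trig P s).
Proof.
elim: s => [|q s IH].
  rewrite (_ : trig P [::] = fun=> 0); first exact: cst_continuous.
  by apply/funext => p; rewrite /trig big_nil.
rewrite (_ : trig P (q :: s) = fun p => q.1.1.1 * mono q.1.1.2 (pi *+ 2 * q.1.2%:~R / P) q.2 p + trig P s p).
  apply: continuous_addf => //; apply: continuous_mulf; last exact: continuous_mono.
  exact: cst_continuous.
by apply/funext => p; rewrite /trig big_cons.
Qed.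

Lemma bmeas_trig P s : bmeas (trig P s : RB * torus R d -> R).
Proof. by apply: bmeas_sum => q; apply: bmeasZ; exact: bmeas_mono. Qed.

(** The Stone-Weierstrass theorem is applied on [0, P] x torus, where the polynomials do not
    distinguish the two ends of the time interval; neither does [phi], so these points need not be
    separated. *)
Lemma trig_dense P (phi : R * torus R d -> R) : 0 < P -> continuous phi ->
  (forall x, phi (0, x) = phi (P, x)) -> forall e, 0 < e ->
  exists s, forall p, 0 <= p.1 <= P -> `|phi p - trig P s p| <= e.
Proof.
move=> P0 cphi per e e0.
pose K : set (R * torus R d) := `[0, P]%classic `*` setT.
have cK : compact K.
  by apply: compact_setX; [exact: segment_compact|exact: torus_compact].
have [||||x y Kx Ky|g [s Hs] gs] :=
    @stone_weierstrass R _ K (is_trig P) cK _ _ _ _ phi cphi _ e e0.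
- move=> g [s Hs]; rewrite (_ : g = trig P s); first exact: continuous_trig.
  exact/funext.
- exact: is_trig_cst.
- exact: is_trigD.
- exact: is_trigM.
- have [xy|xy] := pselect (phi x = phi y).
    by exists (fun=> phi x); split => //; exact: is_trig_cst.
  suff [g [tg gxy]] : exists g, is_trig P g /\ g x != g y.
    exists (fun p => (phi x - phi y) / (g x - g y) * g p +
      (phi x - (phi x - phi y) / (g x - g y) * g x)); split.
    + apply: is_trigD; last exact: is_trig_cst.
      by apply: is_trigM => //; exact: is_trig_cst.
    + by ring.
    + by field; rewrite subr_eq0.
  apply: contrapT => /forallNP nog.
  have same a (n : int) m : mono a (pi *+ 2 * n%:~R / P) m x = mono a (pi *+ 2 * n%:~R / P) m y.
    apply/eqP/negPn/negP => ne; apply: (nog (fun p => 1 * mono a (pi *+ 2 * n%:~R / P) m p)).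
    by split; [exact: is_trig_mono|rewrite !mul1r].
  have x2y2 : x.2 = y.2.
    apply: torus_separated => a m.
    by have := same a 0 m; rewrite /mono mulr0 !mul0r !addr0.
  apply: xy.
  have : cos (pi *+ 2 * ((x.1 - y.1) / P)) = 1.
    have := same 0 1 0; have := same (- (pi / 2)) 1 0.
    rewrite /mono !phase0 !addr0 !add0r ![- (_ / 2) + _]addrC !cosBpihalf mulr1 => sxy cxy.
    rewrite (_ : pi *+ 2 * _ = (pi *+ 2 / P * x.1) - (pi *+ 2 / P * y.1)); last by ring.
    by rewrite cosB cxy sxy -!expr2 cos2Dsin2.
  move=> /cos_2pi_eq1/intrP[z zE].
  have {}zE : x.1 - y.1 = z%:~R * P by rewrite -zE divfK// gt_eqF.
  have := Kx; have := Ky; rewrite /K/= !in_itv/= => -[/andP[y0 yP] _] [/andP[x0 xP] _].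
  have zm1 : -1 <= z.
    by rewrite -(ler_int R) -(ler_pM2r P0) -zE rmorphN/=; lra.
  have z1 : z <= 1.
    by rewrite -(ler_int R) -(ler_pM2r P0) -zE; lra.
  rewrite (surjective_pairing x) (surjective_pairing y) x2y2.
  (* Points that no polynomial separates have the same position, and times that are equal or at
     opposite ends of [0, P]; in all three cases [phi] takes the same value at both. *)
  have : z = -1 \/ z = 0 \/ z = 1 by lia.
  move=> [zz|[zz|zz]]; move: zE; rewrite zz.
  + rewrite rmorphN/= => zE.
    have -> : x.1 = 0 by lra.
    have -> : y.1 = P by lra.
    exact: per.
  + by rewrite mul0r => /subr0_eq ->.
  + move=> zE.
    have -> : y.1 = 0 by lra.
    have -> : x.1 = P by lra.
    by rewrite per.
- exists s => p pP; rewrite -Hs; apply: gs; split => //=.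
Qed.

(** Measurability for the product sigma-algebra comes from uniform approximation by trigonometric
    polynomials cut off outside [0, P]. The polynomials apply because [phi] vanishes at both ends of
    the strip. *)
Lemma bmeas_continuous_strip P (phi : R * torus R d -> R) : 0 < P -> continuous phi ->
  (forall p, ~ strip P p -> phi p = 0) -> bmeas (phi : RB * torus R d -> R).
Proof.
move=> P0 cphi phi0.
have dense n : {s | forall p, 0 <= p.1 <= P -> `|phi p - trig P s p| <= n.+1%:R^-1}.
  apply: cid; apply: trig_dense => // x.
  by rewrite !phi0// => -[/=]; rewrite in_itv/= ltxx ?andbF.
pose s n := sval (dense n).
have mI : measurable ([set p | 0 <= p.1 <= P] : set (RB * torus R d)).
  rewrite (_ : [set p | _] = (`[0, P]%classic : set RB) `*` (setT : set (torus R d))).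
    by apply: measurableX.
  by apply/seteqP; split => p /=; rewrite in_itv/= => // -[].
have approx n p : `|phi p - trig P (s n) p * \1_[set p | 0 <= p.1 <= P] p| <= n.+1%:R^-1.
  rewrite indicE; case: (boolP (p \in _)) => [/set_mem|/negP] /= pP.
    by rewrite mulr1; exact: (svalP (dense n)).
  rewrite mulr0 subr0 phi0 ?normr0 ?invr_ge0// => -[/=]; rewrite in_itv/= => /andP[p0 p1] _.
  by apply: pP; apply/mem_set; rewrite /= (ltW p0) (ltW p1).
split.
  apply: (@measurable_fun_cvg _ _ _ _ (fun n p => trig P (s n) p * \1_[set p | 0 <= p.1 <= P] p)).
    move=> n; apply: measurable_funM; first by have [] := bmeas_trig P (s n).
    exact: measurable_indic.
  move=> p _; apply/cvgrPdist_le => e e0.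
  have [N Ne] := @ltr_add_invr R 0 e e0; rewrite add0r in Ne.
  exists N => // n Nn; apply: (le_trans (approx n p)); apply: le_trans (ltW Ne).
  by rewrite lef_pV2 ?posrE// ler_nat.
have [_ [M HM]] := bmeas_trig P (s 0).
exists (M + 1) => p.
have := approx 0%N p; rewrite invr1 => h.
have : `|trig P (s 0) p * \1_[set p | 0 <= p.1 <= P] p| <= M.
  rewrite normrM (le_trans _ (HM p))// ler_piMr//.
  by rewrite indicE; case: (_ \in _); rewrite ?normr1 ?normr0.
have := ler_normD (phi p - trig P (s 0) p * \1_[set p | 0 <= p.1 <= P] p)
  (trig P (s 0) p * \1_[set p | 0 <= p.1 <= P] p).
by rewrite subrK; lra.
Qed.

End trigonometric_polynomials.

(** * Energy of finite sums of waves *)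

Section complex_parts.
Context {R : realType}.
Implicit Types (z w : R[i]).

Lemma ReD z w : Re (z + w) = Re z + Re w.
Proof. by case: z; case: w. Qed.

Lemma ImD z w : Im (z + w) = Im z + Im w.
Proof. by case: z; case: w. Qed.

Lemma Re_sum (I : Type) (r : seq I) (F : I -> R[i]) :
  Re (\sum_(i <- r) F i) = \sum_(i <- r) Re (F i).
Proof. exact: (big_morph _ ReD). Qed.

Lemma Im_sum (I : Type) (r : seq I) (F : I -> R[i]) :
  Im (\sum_(i <- r) F i) = \sum_(i <- r) Im (F i).
Proof. exact: (big_morph _ ImD). Qed.

Lemma normc_sqr z : normc z ^+ 2 = Re z ^+ 2 + Im z ^+ 2.
Proof. by case: z => x y /=; rewrite sqr_sqrtr// addr_ge0// sqr_ge0. Qed.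

End complex_parts.

Section plane_waves.
Context {R : realType} {d : nat}.
Local Notation RB := (measurableTypeR R).
Implicit Types (k l m : 'rV[int]_d) (K : seq 'rV[int]_d) (a : 'rV[int]_d -> R[i]).

Definition dotz k l : int := \sum_i k 0 i * l 0 i.

Lemma dotzDl k1 k2 l : dotz (k1 + k2) l = dotz k1 l + dotz k2 l.
Proof. by rewrite /dotz -big_split/=; apply: eq_bigr => i _; rewrite mxE mulrDl. Qed.

Lemma dotzNl k l : dotz (- k) l = - dotz k l.
Proof. by rewrite /dotz -sumrN; apply: eq_bigr => i _; rewrite mxE mulNr. Qed.

Lemma dotzC k l : dotz k l = dotz l k.
Proof. by apply: eq_bigr => i _; rewrite mulrC. Qed.

Lemma dotzNr k l : dotz k (- l) = - dotz k l.
Proof. by rewrite dotzC dotzNl dotzC. Qed.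

Lemma dotzz_eq0 m : (dotz m m == 0) = (m == 0).
Proof.
apply/eqP/eqP => [|->]; last by rewrite /dotz big1// => i _; rewrite mxE mul0r.
move=> mm0; apply/rowP => i; rewrite mxE.
have : m 0 i * m 0 i == 0.
  rewrite (psumr_eq0P _ mm0)// => j _; exact: sqr_ge0.
by rewrite mulf_eq0 orbb => /eqP.
Qed.

(** The source of the hyperplanes: once k - l is fixed, prescribing |k|^2 - |l|^2 is an affine
    condition on k. *)
Lemma dotzB k l : dotz k k - dotz l l = 2 * dotz k (k - l) - dotz (k - l) (k - l).
Proof.
have [m ->] : exists m, l = k - m by exists (k - l); rewrite subKr.
rewrite subKr !(dotzDl, dotzNl) ![dotz _ (k - m)]dotzC !(dotzDl, dotzNl).
by rewrite (dotzC m k); ring.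
Qed.

Definition lam k : R := (pi *+ 2) ^+ 2 * (dotz k k)%:~R.

(** The wave E_k = exp(i (2 pi k.x - lam k t)), the shift - pi / 2 producing its sine. *)
Definition wave k (p : R * torus R d) : R[i] :=
  (mono 0 (- lam k) k p +i* mono (- (pi / 2)) (- lam k) k p)%C.

Definition wsum K a (p : R * torus R d) : R[i] := \sum_(k <- K) a k * wave k p.

Definition mass K a : R := \sum_(k <- K) normc (a k) ^+ 2.

Lemma mass_ge0 K a : 0 <= mass K a.
Proof. by apply: sumr_ge0 => k _; exact: sqr_ge0. Qed.

(** The term of index (k, l) is the real part of a_k E_k times the conjugate of a_l E_l; the
    imaginary parts cancel in the double sum. *)
Lemma normc_wsum K a p : normc (wsum K a p) ^+ 2 =
  \sum_(k <- K) \sum_(l <- K)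
    ((Re (a k) * Re (a l) + Im (a k) * Im (a l)) *
       mono 0 (- (lam k - lam l)) (k - l) p +
     (Re (a k) * Im (a l) - Im (a k) * Re (a l)) *
       mono (- (pi / 2)) (- (lam k - lam l)) (k - l) p).
Proof.
have -> : wsum K a p =
    ((\sum_(k <- K) Re (a k * wave k p)) +i* (\sum_(k <- K) Im (a k * wave k p)))%C.
  by rewrite -Re_sum -Im_sum -/(wsum K a p); case: (wsum K a p).
rewrite normc_sqr/= !expr2 !mulr_suml -big_split/=; apply: eq_bigr => k _.
rewrite !mulr_sumr -big_split/=; apply: eq_bigr => l _.
rewrite /wave /mono; set t := p.1; set x := repr p.2.
rewrite ![- (pi / 2) + _]addrC !add0r ![_ - (pi / 2) + _]addrAC !cosBpihalf.
rewrite phaseD phaseN.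
rewrite (_ : - (lam k - lam l) * t + (phase k x - phase l x) =
  (- lam k * t + phase k x) - (- lam l * t + phase l x)); last by ring.
rewrite cosB sinB; case: (a k) => u v; case: (a l) => u' v' /=; ring.
Qed.

Lemma bmeas_normc_wsum K a :
  bmeas (fun p : RB * torus R d => normc (wsum K a p) ^+ 2).
Proof.
under [X in bmeas X]eq_fun do rewrite normc_wsum.
apply: bmeas_sum => k; apply: bmeas_sum => l.
by apply: bmeasD; apply: bmeasZ; exact: bmeas_mono.
Qed.

Section energy.
Variables (N : nat) (N0 : (0 < N)%N).
(** lam k * P = 2 pi N |k|^2, so P is a time period of every wave. *)
Let P : R := N%:R / (pi *+ 2).

Let pi2_gt0 : 0 < pi *+ 2 :> R.
Proof. by rewrite mulrn_wgt0// pi_gt0. Qed.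

Let P0 : 0 < P.
Proof. by rewrite divr_gt0// ltr0n. Qed.

(** In units of 2 pi / P, the frequency lam k - lam l is N (|k|^2 - |l|^2). The product of a
    monomial of frequency (n, m) with one of E_k conj(E_l) has a sum and a difference frequency; the
    two alternatives say that the first or the second is zero. *)
Definition resonant (n : int) m k l :=
  (m + (k - l) == 0) && (n == N%:Z * (dotz k k - dotz l l)) ||
  (m - (k - l) == 0) && (n == - (N%:Z * (dotz k k - dotz l l))).

Lemma lamB k l : lam k - lam l = pi *+ 2 * (N%:Z * (dotz k k - dotz l l))%:~R / P.
Proof.
have := lt0r_neq0 pi2_gt0; rewrite /lam /P; move: (pi *+ 2) => c c0.
rewrite !intrM intrB -pmulrn; field.
by rewrite c0 pnatr_eq0 -lt0n.
Qed.

Lemma Rintegral_mono_res (r b c : R) (n : int) m k l : k != l -> ~~ resonant n m k l ->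
  (\int[dtdx d P]_p (c * mono r (pi *+ 2 * n%:~R / P) m p *
     mono b (- (lam k - lam l)) (k - l) p) = 0)%R.
Proof.
move=> kl; rewrite negb_or => /andP[r1 r2].
under eq_Rintegral do rewrite -mulrA monoM.
rewrite RintegralZ_bmeas; last 2 first.
- exact: dtdx_lty.
- by apply: bmeasZ; apply: bmeasD; exact: bmeas_mono.
rewrite RintegralZ_bmeas; last 2 first.
- exact: dtdx_lty.
- by apply: bmeasD; exact: bmeas_mono.
rewrite RintegralD_bmeas; last 3 first.
- exact: dtdx_lty.
- exact: bmeas_mono.
- exact: bmeas_mono.
rewrite !Rintegral_mono//; last 2 first.
- rewrite lamB; exists (n + N%:Z * (dotz k k - dotz l l)); rewrite intrD; field.
  exact: lt0r_neq0.
- rewrite lamB; exists (n - N%:Z * (dotz k k - dotz l l)); rewrite intrB; field.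
  exact: lt0r_neq0.
have cancel (z : int) : (pi *+ 2 * n%:~R / P + pi *+ 2 * z%:~R / P == 0) = (n == - z).
  rewrite -mulrDl -mulrDr !mulf_eq0 invr_eq0 (gt_eqF pi2_gt0) (gt_eqF P0) orbF/=.
  by rewrite -intrD intr_eq0 addr_eq0.
have e1 : (pi *+ 2 * n%:~R / P - (lam k - lam l) == 0) = (n == N%:Z * (dotz k k - dotz l l)).
  by rewrite lamB -mulNr -mulrN -intrN cancel opprK.
have e2 : (pi *+ 2 * n%:~R / P - - (lam k - lam l) == 0) = (n == - (N%:Z * (dotz k k - dotz l l))).
  by rewrite opprK lamB cancel.
by rewrite e1 e2 (negbTE r1) (negbTE r2) addr0 !mulr0.
Qed.

(** All off-diagonal integrals vanish, and on the diagonal |E_k| = 1. *)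
Lemma energy_nonresonant (s : seq (R * R * int * 'rV[int]_d)) K a : uniq K ->
  (forall q k l, q \in s -> k \in K -> l \in K -> k != l -> ~~ resonant q.1.2 q.2 k l) ->
  (\int[dtdx d P]_p (trig P s p * normc (wsum K a p) ^+ 2) =
   \int[dtdx d P]_p trig P s p * mass K a)%R.
Proof.
move=> uK nres.
pose g k l p := (Re (a k) * Re (a l) + Im (a k) * Im (a l)) *
       mono 0 (- (lam k - lam l)) (k - l) p +
     (Re (a k) * Im (a l) - Im (a k) * Re (a l)) *
       mono (- (pi / 2)) (- (lam k - lam l)) (k - l) p.
have bg k l : bmeas (g k l : RB * torus R d -> R).
  by apply: bmeasD; apply: bmeasZ; exact: bmeas_mono.
have bq (q : R * R * int * 'rV[int]_d) :
    bmeas ((fun p => q.1.1.1 * mono q.1.1.2 (pi *+ 2 * q.1.2%:~R / P) q.2 p) : RB * torus R d -> R).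
  by apply: bmeasZ; exact: bmeas_mono.
transitivity (\sum_(q <- s) \sum_(k <- K) \sum_(l <- K)
   \int[dtdx d P]_p (q.1.1.1 * mono q.1.1.2 (pi *+ 2 * q.1.2%:~R / P) q.2 p * g k l p))%R.
  rewrite -[LHS]/(\int[dtdx d P]_p (trig P s p * normc (wsum K a p) ^+ 2))%R.
  under eq_Rintegral do rewrite normc_wsum /trig mulr_suml.
  rewrite Rintegral_sum_bmeas; last 2 first.
  - exact: dtdx_lty.
  - by move=> q; apply: bmeasM => //; apply: bmeas_sum => k; apply: bmeas_sum => l; exact: bg.
  apply: eq_bigr => q _.
  under eq_Rintegral do rewrite mulr_sumr.
  rewrite Rintegral_sum_bmeas; last 2 first.
  - exact: dtdx_lty.
  - by move=> k; apply: bmeasM => //; apply: bmeas_sum => l; exact: bg.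
  apply: eq_bigr => k _.
  under eq_Rintegral do rewrite mulr_sumr.
  rewrite Rintegral_sum_bmeas//; first exact: dtdx_lty.
  by move=> l; apply: bmeasM => //; exact: bg.
rewrite Rintegral_sum_bmeas//; last exact: dtdx_lty.
rewrite mulr_suml big_seq [RHS]big_seq; apply: eq_bigr => q qs.
rewrite /mass mulr_sumr big_seq [RHS]big_seq; apply: eq_bigr => k kK.
rewrite (bigD1_seq k)//= big_seq_cond big1 ?addr0; last first.
  move=> l /andP[lK kl]; rewrite eq_sym in kl.
  rewrite /g; under eq_Rintegral do rewrite mulrDr [X in X + _]mulrCA [X in _ + X]mulrCA.
  have bb b : bmeas ((fun p => q.1.1.1 * mono q.1.1.2 (pi *+ 2 * q.1.2%:~R / P) q.2 p *
      mono b (- (lam k - lam l)) (k - l) p) : RB * torus R d -> R).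
    by apply: bmeasM => //; exact: bmeas_mono.
  rewrite RintegralD_bmeas; last 3 first.
  - exact: dtdx_lty.
  - exact: bmeasZ.
  - exact: bmeasZ.
  rewrite !RintegralZ_bmeas//; try exact: dtdx_lty.
  by rewrite !Rintegral_mono_res ?mulr0 ?addr0//; exact: nres.
rewrite [RHS]mulrC -RintegralZ_bmeas//; last exact: dtdx_lty.
apply: eq_Rintegral => p _.
rewrite /g !subrr oppr0 /mono !phase0 mul0r !addr0 cos0 normc_sqr.
by rewrite [Im (a k) * Re (a k)]mulrC subrr mul0r addr0; ring.
Qed.

End energy.
End plane_waves.

(** * Uniform smallness of the energy, by induction on the dimension *)

Section uniform_smallness.
Context {R : realType} {d : nat}.
Local Notation RB := (measurableTypeR R).
Implicit Types (k l m : 'rV[int]_d) (K : seq 'rV[int]_d) (a : 'rV[int]_d -> R[i]).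
Implicit Types (S : 'rV[int]_d -> Prop).
Variables (N : nat) (N0 : (0 < N)%N).
Let P : R := N%:R / (pi *+ 2).

Let P0 : 0 < P.
Proof. by rewrite divr_gt0 ?ltr0n// mulrn_wgt0// pi_gt0. Qed.

Variable phi : nat -> R * torus R d -> R.
Hypothesis phi_continuous : forall j, continuous (phi j).
Hypothesis phi_strip : forall j p, ~ strip P p -> phi j p = 0.
Hypothesis phi_ge0 : forall j p, 0 <= phi j p.
Hypothesis phi_decr : forall i j p, (i <= j)%N -> phi j p <= phi i p.
Hypothesis phi_int : forall e, 0 < e ->
  exists j, (\int[dtdx d P]_p phi j p <= e)%R.

Let bphi j : bmeas (phi j : RB * torus R d -> R).
Proof. exact: (bmeas_continuous_strip P0 (@phi_continuous j) (@phi_strip j)). Qed.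

Definition energy (f : R * torus R d -> R) K a : R :=
  (\int[dtdx d P]_p (f p * normc (wsum K a p) ^+ 2))%R.

(** The threshold [J] depends on neither the finite set [K] nor the coefficients; this uniformity is
    what survives the passage to infinite sums and to the sequence of solutions. *)
Let small_at S (e : R) := exists J, forall j K a, (J <= j)%N -> uniq K ->
  (forall k, k \in K -> S k) -> energy (phi j) K a <= e * mass K a.

Let small S := forall e, 0 < e -> small_at S e.

Let energy_split j K a (Q : pred 'rV[int]_d) :
  energy (phi j) K a <= 2 * energy (phi j) [seq k <- K | Q k] a +
    2 * energy (phi j) [seq k <- K | ~~ Q k] a.
Proof.
rewrite /energy -!RintegralZ_bmeas; try exact: dtdx_lty; last 2 first.
- by apply: bmeasM => //; exact: bmeas_normc_wsum.
- by apply: bmeasM => //; exact: bmeas_normc_wsum.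
rewrite -RintegralD_bmeas; try exact: dtdx_lty; last 2 first.
- by apply: bmeasZ; apply: bmeasM => //; exact: bmeas_normc_wsum.
- by apply: bmeasZ; apply: bmeasM => //; exact: bmeas_normc_wsum.
apply: le_Rintegral_bmeas; first exact: dtdx_lty.
- by apply: bmeasM => //; exact: bmeas_normc_wsum.
- by apply: bmeasD; apply: bmeasZ; apply: bmeasM => //; exact: bmeas_normc_wsum.
move=> p; rewrite !(mulrCA 2 (phi j p)) -mulrDr ler_wpM2l//.
have -> : wsum K a p = wsum [seq k <- K | Q k] a p + wsum [seq k <- K | ~~ Q k] a p.
  by rewrite /wsum !big_filter [LHS](bigID Q).
move: (wsum _ _ _) (wsum _ _ _) => [x y] [z w].
rewrite !normc_sqr/= -subr_ge0 (_ : _ - _ = (x - z) ^+ 2 + (y - w) ^+ 2).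
  by rewrite addr_ge0// sqr_ge0.
by ring.
Qed.

Let mass_split K a (Q : pred 'rV[int]_d) :
  mass K a = mass [seq k <- K | Q k] a + mass [seq k <- K | ~~ Q k] a.
Proof. by rewrite /mass !big_filter [LHS](bigID Q). Qed.

(** The factor 2 of [energy_split], from |x + y|^2 <= 2 |x|^2 + 2 |y|^2, is the only loss, because
    the masses of the two parts add up to the whole. *)
Let small_at_split S (Q : pred 'rV[int]_d) e :
  small_at (fun k => S k /\ Q k) e -> small_at (fun k => S k /\ ~~ Q k) e ->
  small_at S (2 * e).
Proof.
move=> [J1 H1] [J2 H2]; exists (maxn J1 J2) => j K a.
rewrite geq_max => /andP[j1 j2] uK KS.
apply: (le_trans (energy_split j K a Q)).
rewrite (mass_split K a Q) mulrDr -!mulrA lerD// ler_wpM2l//.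
  apply: H1 => //; first exact: filter_uniq.
  by move=> k; rewrite mem_filter => /andP[Qk kK]; split => //; exact: KS.
apply: H2 => //; first exact: filter_uniq.
by move=> k; rewrite mem_filter => /andP[Qk kK]; split => //; exact: KS.
Qed.

Let small_sub S S' : (forall k, S k -> S' k) -> small S' -> small S.
Proof.
move=> SS' H e e0; have [J HJ] := H e e0; exists J => j K a Jj uK KS.
by apply: HJ => // k kK; apply: SS'; exact: KS.
Qed.

Let small_split S (Q : pred 'rV[int]_d) :
  small (fun k => S k /\ Q k) -> small (fun k => S k /\ ~~ Q k) -> small S.
Proof.
move=> H1 H2 e e0; rewrite (_ : e = 2 * (e / 2)); last by field.
by apply: (@small_at_split _ Q); [apply: H1|apply: H2]; rewrite divr_gt0.
Qed.

Let small_void S : (forall k, ~ S k) -> small S.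
Proof.
move=> S0 e e0; exists 0%N => j [|k K] a _ _ KS; last first.
  by exfalso; apply: (S0 k); apply: KS; rewrite mem_head.
rewrite /energy /mass big_nil mulr0.
under eq_Rintegral do rewrite /wsum big_nil Normc.normc0 expr0n mulr0.
by rewrite Rintegral_cst ?mul0r// dtdx_lty.
Qed.

Let small_has S (I : Type) (r : seq I) (Q : I -> pred 'rV[int]_d) :
  (forall i, small (fun k => S k /\ Q i k)) ->
  small (fun k => S k /\ has (fun i => Q i k) r).
Proof.
move=> HQ; elim: r => [|i r IH]; first by apply: small_void => k [].
apply: (@small_split _ (Q i)).
  by apply: small_sub (HQ i) => k [[Sk _] Qk].
by apply: small_sub IH => k [[Sk /= /orP[->//|]]].
Qed.

(* Off the finitely many resonant hyperplanes of a trigonometric polynomial p,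
   the waves are orthogonal for the weight p. *)
Let small_hyperplanes S :
  (forall m c, m != 0 -> (exists k l, [/\ S k, S l & m = k - l]) ->
     small (fun k => S k /\ dotz k m == c)) ->
  small S.
Proof.
move=> Hhyp e e0.
(* The nonresonant part must stay below [e / 2]. The integral of [phi j0] costs [e / 8]; the
   approximation error [e / (16 * P)], worth [e / 16] once integrated over the strip, is paid twice,
   first in replacing the weight by the polynomial and then in comparing their integrals. *)
have [j0 Hj0] := phi_int (e := e / 8) ltac:(lra).
have d0 : 0 < e / (16 * P) by rewrite divr_gt0// mulr_gt0.
have [|s Hs] := trig_dense P0 (@phi_continuous j0) _ d0.
  by move=> x; rewrite !phi_strip// => -[/=]; rewrite in_itv/= ltxx ?andbF.
have Hs' p : strip P p -> `|phi j0 p - trig P s p| <= e / (16 * P).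
  by move=> [/=]; rewrite in_itv/= => /andP[p0 pP] _; apply: Hs; rewrite !ltW.
(* The frequencies k that [q] may couple to another element of [S]: one equation for each
   alternative of [resonant], with k - l replaced by - q.2 or q.2. That q.2 is a difference of
   elements of [S] is automatic at a resonance, and is recorded because the assumption on
   hyperplanes requires it. *)
pose hyp (q : R * R * int * 'rV[int]_d) (k : 'rV[int]_d) :=
  `[< q.2 != 0 /\ exists k' l', [/\ S k', S l' & q.2 = k' - l'] >] &&
  ((q.1.2 == N%:Z * (- (2 * dotz k q.2) - dotz q.2 q.2)) ||
   (q.1.2 == N%:Z * (- (2 * dotz k q.2) + dotz q.2 q.2))).
rewrite (_ : e = 2 * (e / 2)); last by field.
apply: (@small_at_split _ (fun k => has (fun q => hyp q k) s)).
  apply: small_has; last by rewrite divr_gt0.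
  move=> q; rewrite /hyp.
  case: asboolP => [[m0 mS]|_]; last by apply: small_void => k [].
  have N2 : (2 * N%:Z != 0 :> int) by rewrite mulf_neq0// eqz_nat -lt0n.
  apply: (@small_split _ (fun k => q.1.2 == N%:Z * (- (2 * dotz k q.2) - dotz q.2 q.2))).
    (* If this set of frequencies has a point k0, the equation fixes the product with q.2, so the
       set lies in the hyperplane through k0 orthogonal to q.2. *)
    have [[k0 /eqP qk0]|no] := pselect (exists k, q.1.2 == N%:Z * (- (2 * dotz k q.2) - dotz q.2 q.2)).
      apply: small_sub (Hhyp q.2 (dotz k0 q.2) m0 mS) => k [[Sk _] /eqP qk]; split => //.
      apply/eqP; apply: (mulfI N2); move: qk; rewrite qk0; lia.
    by apply: small_void => k [_ kq]; apply: no; exists k.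
  have [[k0 /eqP qk0]|no] := pselect (exists k, q.1.2 == N%:Z * (- (2 * dotz k q.2) + dotz q.2 q.2)).
    apply: small_sub (Hhyp q.2 (dotz k0 q.2) m0 mS) => k [[Sk /= /orP[->//|/eqP qk]] _]; split => //.
    apply/eqP; apply: (mulfI N2); move: qk; rewrite qk0; lia.
  by apply: small_void => k [[_ /= /orP[->//|qk]]] _; apply: no; exists k.
exists j0 => j K a jj uK KS.
set W := fun p => normc (wsum K a p) ^+ 2.
have bW : bmeas (W : RB * torus R d -> R) by exact: bmeas_normc_wsum.
have W0 p : 0 <= W p by exact: sqr_ge0.
set D := e / (16 * P) in d0 Hs Hs'.
have DP : D * P = e / 16 by rewrite /D; field; exact: lt0r_neq0.
have le1 : energy (phi j) K a <= (\int[dtdx d P]_p (trig P s p * W p + D * W p))%R.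
  apply: le_Rintegral_dtdx.
  - exact: bmeasM.
  - by apply: bmeasD; [apply: bmeasM => //; exact: bmeas_trig|exact: bmeasZ].
  move=> p /Hs'; rewrite ler_norml => /andP[_ h].
  rewrite -mulrDl; apply: ler_wpM2r; first exact: sqr_ge0.
  by have := @phi_decr _ _ p jj; lra.
apply: (le_trans le1); rewrite RintegralD_bmeas; last 3 first.
- exact: dtdx_lty.
- by apply: bmeasM => //; exact: bmeas_trig.
- exact: bmeasZ.
rewrite (energy_nonresonant N0)//; last first.
  move=> q k l qs kK lK kl; apply/negP => res.
  have [Sk /negP] := KS k kK; apply; apply/hasP; exists q => //.
  move: res => /orP[] /andP[/eqP qkl /eqP qn]; apply/andP; split.
  + have qE : q.2 = l - k by apply/eqP; rewrite -subr_eq0 opprB qkl.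
    apply/asboolP; split; first by rewrite qE subr_eq0 eq_sym.
    by exists l, k; split => //; [have [] := KS l lK].
  + apply/orP; left; rewrite qn dotzB.
    have -> : k - l = - q.2 by apply/eqP; rewrite -addr_eq0 addrC qkl.
    by rewrite !dotzNr !dotzNl; apply/eqP; ring.
  + have qE : q.2 = k - l by apply/eqP; rewrite -subr_eq0 qkl.
    apply/asboolP; split; first by rewrite qE subr_eq0.
    by exists k, l; split => //; [have [] := KS l lK].
  + apply/orP; right; rewrite qn dotzB.
    have -> : k - l = q.2 by apply/esym/eqP; rewrite -subr_eq0 qkl.
    by apply/eqP; ring.
rewrite RintegralZ_bmeas//; last exact: dtdx_lty.
have -> : (\int[dtdx d P]_p W p)%R = P * mass K a.
  (* The constant 1 is a polynomial whose only frequency is zero, which never resonates with k <> l;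
     this gives Parseval's identity over one period. *)
  have := @energy_nonresonant R d N N0 [:: (1, 0, 0, 0)] K a uK.
  have trig1 p : trig P [:: (1, 0, 0, 0)] p = 1 :> R.
    by rewrite /trig big_seq1/= /mono phase0 mulr0 !mul0r !addr0 cos0 mulr1.
  under eq_Rintegral do rewrite trig1 mul1r.
  move=> ->; last first.
    move=> q k l; rewrite inE => /eqP -> _ _ kl.
    by rewrite /resonant/= add0r sub0r oppr_eq0 subr_eq0 (negbTE kl).
  by congr (_ * _); under eq_Rintegral do rewrite trig1; rewrite Rintegral_dtdx_cst// mul1r.
rewrite mulrA DP -mulrDl ler_wpM2r ?mass_ge0//.
have : (\int[dtdx d P]_p trig P s p <= \int[dtdx d P]_p (phi j0 p + D))%R.
  apply: le_Rintegral_dtdx.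
  - exact: bmeas_trig.
  - by apply: bmeasD => //; exact: bmeas_cst.
  by move=> p /Hs'; rewrite ler_norml => /andP[h _]; lra.
rewrite RintegralD_bmeas; last 3 first.
- exact: dtdx_lty.
- exact: bphi.
- exact: bmeas_cst.
by rewrite Rintegral_dtdx_cst// DP; lra.
Qed.

(** Over the rationals the span of the differences of frequencies has a rank, on which the induction
    runs, and m.m <> 0 still holds for nonzero integer m. *)
Let ratv m : 'rV[rat]_d := map_mx intr m.

Let ratv_dotz k m : ratv k *m (ratv m)^T = ((dotz k m)%:~R)%:M.
Proof.
apply/matrixP => i j; rewrite !mxE !ord1 eqxx mulr1n /dotz rmorph_sum/=.
by apply: eq_bigr => l _; rewrite !mxE intrM.
Qed.

(** In a hyperplane orthogonal to m, the differences lie in the intersection of W with the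
    orthogonal of m. Its rank is smaller than that of W: m, being a difference of elements of [S],
    lies in W, but m is not orthogonal to itself. In rank 0 there is no nonzero difference, hence no
    hyperplane to treat. *)
Let small_rank n S (W : 'M[rat]_d) : (\rank W <= n)%N ->
  (forall k l, S k -> S l -> (ratv (k - l) <= W)%MS) -> small S.
Proof.
elim: n S W => [|n IH] S W rW HW; apply: small_hyperplanes => m c m0 [k0 [l0 [Sk0 Sl0 mE]]];
  have mW : (ratv m <= W)%MS by rewrite mE HW.
  move: rW mW; rewrite leqn0 mxrank_eq0 => /eqP ->; rewrite submx0 => /eqP/rowP m00.
  case/eqP: m0; apply/rowP => i; have := m00 i; rewrite !mxE.
  by move/eqP; rewrite intr_eq0 => /eqP.
have mm : ratv m *m (ratv m)^T != 0.
  rewrite ratv_dotz; apply/eqP => /matrixP /(_ 0 0); rewrite !mxE mulr1n.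
  by move/eqP; rewrite intr_eq0 dotzz_eq0 (negbTE m0).
apply: (IH _ (W :&: kermx (ratv m)^T)%MS).
  rewrite -ltnS; apply: leq_trans rW; apply: rank_ltmx.
  rewrite ltmxE capmxSl/=; apply/negP => Wle.
  by move: (submx_trans mW (submx_trans Wle (capmxSr _ _))) => /sub_kermxP /eqP; apply/negP.
move=> k l [Sk /eqP km] [Sl /eqP lm]; rewrite sub_capmx HW//=.
apply/sub_kermxP; rewrite ratv_dotz dotzDl dotzNl km lm subrr.
by rewrite raddf0.
Qed.

Theorem energy_uniformly_small e : 0 < e ->
  exists J, forall j K a, (J <= j)%N -> uniq K -> energy (phi j) K a <= e * mass K a.
Proof.
move=> e0.
have [J HJ] := @small_rank d (fun=> True) 1%:M (rank_leq_row _) (fun _ _ _ _ => submx1 _) e e0.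
by exists J => j K a Jj uK; apply: HJ.
Qed.

End uniform_smallness.

(** * Regularity of finite Borel measures *)

Section inner_regularity.
Context {disp : measure_display} {T : measurableType disp} {R : realType}.
Variables (mu : {measure set T -> \bar R}) (mu_fin : (mu setT < +oo)%E).
(** [F] stands for the closed sets. It is kept abstract in order to serve for the torus and for
    space-time, where measurability is part of the requirement. *)
Variable F : set (set T).
Hypothesis F_measurable : forall A, F A -> measurable A.
Hypothesis F0 : F set0.
Hypothesis FT : F setT.
Hypothesis FU : forall A B, F A -> F B -> F (A `|` B).
Hypothesis F_bigcap : forall A : (set T)^nat, (forall n, F (A n)) -> F (\bigcap_n A n).

Let inner A := forall e : R, 0 < e ->
  exists B, [/\ F B, B `<=` A & (mu (A `\` B) <= e%:E)%E].

Let inner_F A : F A -> inner A.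
Proof.
move=> FA e e0; exists A; split => //.
by rewrite setDv measure0 lee_fin ltW.
Qed.

Let inner_bigcap (A : (set T)^nat) : (forall n, measurable (A n)) ->
  (forall n, inner (A n)) -> inner (\bigcap_n A n).
Proof.
move=> mA iA e e0.
have en n : 0 < e / (2 ^ n.+1)%:R by rewrite divr_gt0// ltr0n expn_gt0.
have [B HB] := choice (fun n => iA n _ (en n)).
exists (\bigcap_n B n); split.
- by apply: F_bigcap => n; have [] := HB n.
- by apply: subset_bigcap => n _; have [] := HB n.
have mB n : measurable (B n) by apply: F_measurable; have [] := HB n.
apply: le_trans (epsilon_trick0 xpredT (ltW e0)).
apply: (@le_trans _ _ (\sum_(n <oo) mu (A n `\` B n))%E).
  apply: measure_sigma_subadditive.
  - by move=> n; apply: measurableD.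
  - apply: measurableD; apply: bigcapT_measurable => n //.
  - move=> x [Ax /existsNP[n /not_implyP[_ nB]]]; exists n => //; split => //.
    exact: Ax.
by apply: lee_nneseries => [n _ _|n _]; [exact: measure_ge0|have [] := HB n].
Qed.

Let inner_setU A B : measurable A -> measurable B -> inner A -> inner B ->
  inner (A `|` B).
Proof.
move=> mA mB iA iB e e0.
have e2 : 0 < e / 2 by rewrite divr_gt0.
have [A' [FA AA' hA]] := iA _ e2.
have [B' [FB BB' hB]] := iB _ e2.
exists (A' `|` B'); split; [exact: FU|exact: setUSS|].
have mA' := F_measurable FA; have mB' := F_measurable FB.
apply: (@le_trans _ _ (mu ((A `\` A') `|` (B `\` B')))).
  apply: le_measure.
  - by apply/mem_set/measurableD; exact: measurableU.
  - by apply/mem_set/measurableU; exact: measurableD.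
  by move=> x [[Ax|Bx] /not_orP[nA nB]]; [left|right].
apply: (le_trans (measureU2 _ _ _)); [exact: measurableD|exact: measurableD|].
by rewrite (splitr e) EFinD leeD.
Qed.

(** [F] is not stable under countable unions, so a finite union is approximated from inside; what is
    left of the whole union has small measure by continuity from above, which uses that the measure
    is finite. *)
Let inner_bigcup (A : (set T)^nat) : (forall n, measurable (A n)) ->
  (forall n, inner (A n)) -> inner (\bigcup_n A n).
Proof.
move=> mA iA e e0.
have e2 : 0 < e / 2 by rewrite divr_gt0.
pose C n := \bigcup_(i < n) A i.
have mC n : measurable (C n) by apply: bigcup_measurable => i _.
pose D n := \bigcup_n A n `\` C n.
have mU : measurable (\bigcup_n A n) by apply: bigcupT_measurable.
have mD n : measurable (D n) by exact: measurableD.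
have [n hn] : exists n, (mu (D n) <= (e / 2)%:E)%E.
  have : mu \o D @ \oo --> mu (\bigcap_n D n).
    apply: nonincreasing_cvg_mu => //.
    - by apply: le_lt_trans mu_fin; apply: le_measure; [exact/mem_set|exact/mem_set|].
    - exact: bigcapT_measurable.
    - move=> i j ij; apply/subsetPset; apply: setDS.
      by apply: bigcup_sub => k /= ki; apply: bigcup_sup => //=; exact: leq_trans ki ij.
  rewrite (_ : \bigcap_n D n = set0) ?measure0; last first.
    apply/seteqP; split => // x Dx.
    have [[i _ Ai] _] := Dx 0%N I.
    by have [_ []] := Dx i.+1 I; exists i => /=.
  move=> /fine_cvgP[fD cD].
  case: fD => N1 _ H1.
  have [N2 _ H2] : \forall n \near \oo, fine (mu (D n)) <= e / 2.
    by move/cvgrPdist_le : cD => /(_ _ e2); apply: filterS => n;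
      rewrite sub0r normrN => /(le_trans (ler_norm _)).
  exists (maxn N1 N2).
  have f1 := H1 (maxn N1 N2) (leq_maxl _ _).
  have := H2 (maxn N1 N2) (leq_maxr _ _) => /= h.
  by rewrite -[leLHS](fineK f1) lee_fin.
have iC : inner (C n).
  rewrite /C bigcup_mkord; elim: n {hn} => [|k IH].
    by rewrite big_ord0; exact: inner_F.
  rewrite big_ord_recr; apply: inner_setU => //.
  by apply: bigsetU_measurable.
have [B [FB BC hB]] := iC _ e2.
have mB := F_measurable FB.
have CU : C n `<=` \bigcup_n A n by apply: bigcup_sub => i _; exact: bigcup_sup.
exists B; split => //; first exact: subset_trans BC CU.
apply: (@le_trans _ _ (mu (D n `|` (C n `\` B)))).
  apply: le_measure.
  - by apply/mem_set; exact: measurableD.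
  - by apply/mem_set/measurableU => //; exact: measurableD.
  move=> x [Ux nB]; have [Cx|nC] := pselect (C n x); first by right.
  by left.
apply: (le_trans (measureU2 _ _ _)) => //; first exact: measurableD.
by rewrite (splitr e) EFinD leeD.
Qed.

(** Approximating the complement as well makes the class stable under complementation, hence a
    sigma-algebra. *)
Definition regular A := [/\ measurable A, inner A & inner (~` A)].

Lemma regularC A : regular A -> regular (~` A).
Proof. by move=> [mA iA iC]; split; [exact: measurableC|by []|rewrite setCK]. Qed.

Lemma regular_bigcup (A : (set T)^nat) : (forall n, regular (A n)) -> regular (\bigcup_n A n).
Proof.
move=> rA; have mA n : measurable (A n) by have [] := rA n.
split; first exact: bigcupT_measurable.
  by apply: inner_bigcup => // n; have [] := rA n.
rewrite setC_bigcup; apply: inner_bigcap => n; first exact: measurableC.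
by have [] := rA n.
Qed.

(** The set {c < g} is the countable union of the sets {c + 1 / (n + 1) <= g} of [F], and its
    complement is in [F]. *)
Lemma regular_superlevel (g : T -> R) :
  (forall c, F [set x | c <= g x]) -> (forall c, F [set x | g x <= c]) ->
  forall c, regular [set x | c < g x].
Proof.
move=> Fge Fle c.
have E : [set x | c < g x] = \bigcup_n [set x | c + n.+1%:R^-1 <= g x].
  apply/seteqP; split => x /=.
    move=> cg; have [n hn] := @ltr_add_invr R 0 (g x - c) ltac:(by rewrite subr_gt0).
    by exists n => //=; rewrite add0r in hn; rewrite -lerBrDl ltW.
  move=> [n _ /=]; apply: lt_le_trans; rewrite ltrDl invr_gt0 ltr0n//.
have mE : measurable [set x | c < g x].
  by rewrite E; apply: bigcupT_measurable => n; apply: F_measurable.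
split => //.
  by rewrite E; apply: inner_bigcup => n; [exact: F_measurable|exact: inner_F].
rewrite (_ : ~` _ = [set x | g x <= c]); first exact: inner_F.
by apply/seteqP; split => x /=; rewrite leNgt => /negP.
Qed.

Lemma regular_sigma_algebra : sigma_algebra setT regular.
Proof.
have r0 : regular set0.
  split => //; first exact: inner_F.
  by rewrite setC0; exact: inner_F.
split => //.
- by move=> A rA; rewrite setTD; exact: regularC.
- exact: regular_bigcup.
Qed.

End inner_regularity.

(** * Distance functions and regularity on the torus and the strip *)

Section distance_to_compact.
Context {R : realType} {X : topologicalType} {I : finType}.
Variable psi : I -> X -> R.
Hypothesis psi_continuous : forall i, continuous (psi i).
Hypothesis psi_separating : forall p q, (forall i, psi i p = psi i q) -> p = q.

(** The sum of the |psi i p - psi i q| is a distance because the [psi i] separate points. By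
    compactness each p has a nearest point [c p] of K, and g is the distance to it, which is
    1-Lipschitz. *)
Lemma distance_to_compact (K : set X) : compact K -> K !=set0 ->
  exists g : X -> R, [/\ continuous g, forall p, 0 <= g p & forall p, g p = 0 <-> K p].
Proof.
move=> cK K0; pose h p q := \sum_i `|psi i p - psi i q|.
have h0 p q : 0 <= h p q by apply: sumr_ge0.
have hpp p : h p p = 0 by rewrite /h big1// => i _; rewrite subrr normr0.
have hC p q : h p q = h q p by apply: eq_bigr => i _; rewrite distrC.
have hD p q r : h p r <= h p q + h q r.
  rewrite /h -big_split/=; apply: ler_sum => i _.
  by rewrite (le_trans _ (ler_normD _ _))// addrA subrK.
have ch p : continuous (h p).
  apply: (@continuous_big R _ +%R 0 xpredT) => [|i _ x].
    by move=> z; apply: cvgD; [exact: cvg_fst|exact: cvg_snd].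
  apply: (@continuous_comp _ _ _ (fun x => psi i p - psi i x) (fun y : R => `|y|)).
    apply: (@continuousB R R^o); [exact: cst_continuous|exact: psi_continuous].
  exact: (@norm_continuous R R^o).
have minh p : exists c, K c /\ forall t, K t -> h p c <= h p t.
  have [c /set_mem Kc Hc] := compact_EVT_min K0 cK (continuous_subspaceT (ch p)).
  by exists c; split => // t Kt; apply: Hc; exact/mem_set.
have [c Hc] := choice minh.
have gle p q : h p (c p) <= h p q + h q (c q).
  by apply: le_trans (hD p q (c q)); apply: (Hc p).2; exact: (Hc q).1.
exists (fun p => h p (c p)); split => //.
  move=> p; apply/cvgrPdist_le => e e0.
  have /cvgrPdist_le/(_ e e0) := ch p p; apply: filterS => q.
  rewrite hpp sub0r normrN ger0_norm// => hpq.
  have h1 := gle p q.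
  have h2 : h q (c q) <= h p q + h p (c p) by rewrite (hC p q); exact: gle.
  by rewrite ler_norml; apply/andP; split; lra.
move=> p; split => [g0|Kp]; last first.
  by apply/eqP; rewrite eq_le h0 andbT -(hpp p); exact: (Hc p).2.
suff -> : p = c p by exact: (Hc p).1.
apply: psi_separating => i; apply/eqP; rewrite -subr_eq0 -normr_eq0; apply/eqP.
by apply: (psumr_eq0P _ g0).
Qed.

End distance_to_compact.

Section torus_regularity.
Context {R : realType} {d : nat}.
Local Notation RB := (measurableTypeR R).

Let torus_coord (i : 'I_d * bool) (p : torus R d) : R :=
  cos ((if i.2 then 0 else - (pi / 2)) + phase (delta_mx 0 i.1) (repr p)).

Lemma distance_torus (K : set (torus R d)) : compact K -> K !=set0 ->
  exists g : torus R d -> R,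
    [/\ continuous g, forall p, 0 <= g p & forall p, g p = 0 <-> K p].
Proof.
apply: (@distance_to_compact _ _ _ torus_coord).
  by move=> i; exact: continuous_cos_phase.
move=> p q pq; apply: torus_separated_coord => i.
  exact: (pq (i, true)).
exact: (pq (i, false)).
Qed.

Lemma distance_strip (K : set (R * torus R d)) : compact K -> K !=set0 ->
  exists g : R * torus R d -> R,
    [/\ continuous g, forall p, 0 <= g p & forall p, g p = 0 <-> K p].
Proof.
apply: (@distance_to_compact _ _ _
  (fun (i : option ('I_d * bool)) p => if i is Some j then torus_coord j p.2 else p.1)).
  move=> [j|] p; last exact: cvg_fst.
  apply: (@continuous_comp _ _ _ snd (torus_coord j)); first exact: cvg_snd.
  exact: continuous_cos_phase.
move=> [s p] [t q] pq; have := pq None => /= ->; congr (_, _).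
apply: torus_separated_coord => i.
  exact: (pq (Some (i, true))).
exact: (pq (Some (i, false))).
Qed.

Lemma closed_superlevel (X : topologicalType) (g : X -> R) (c : R) :
  continuous g -> closed [set x | c <= g x].
Proof. by move=> cg; apply: (closed_comp _ (@closed_ge R c)) => x _; exact: cg. Qed.

Lemma closed_sublevel (X : topologicalType) (g : X -> R) (c : R) :
  continuous g -> closed [set x | g x <= c].
Proof. by move=> cg; apply: (closed_comp _ (@closed_le R c)) => x _; exact: cg. Qed.

Lemma open_torus_superlevel (A : set (torus R d)) : open A -> ~` A !=set0 ->
  exists2 g : torus R d -> R, continuous g & A = [set p | 0 < g p].
Proof.
move=> oA A0.
have cA : compact (~` A).
  apply: (subclosed_compact _ torus_compact) => //; exact: open_closedC.
have [g [cg g0 gA]] := distance_torus cA A0.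
exists g => //; apply/seteqP; split => p /=; rewrite lt0r g0 andbT.
  by move=> Ap; apply/eqP => /gA.
by move=> /eqP gp; apply: contrapT => /gA.
Qed.

Section regular_preimage.
Context {disp : measure_display} {T : measurableType disp}.
Variables (mu : {measure set T -> \bar R}) (F : set (set T)).
Hypothesis regular_sigma : sigma_algebra setT (regular mu F).

Lemma sigma_algebra_regular_preimage (Y : Type) (f : T -> Y) :
  sigma_algebra setT [set B | regular mu F (f @^-1` B)].
Proof.
have [r0 rC rU] := regular_sigma; split => /=.
- by rewrite preimage_set0.
- by move=> A /rC; rewrite !setTD preimage_setC.
- by move=> A rA; rewrite preimage_bigcup; exact: rU.
Qed.

End regular_preimage.

Lemma haar_regular (A : set (torus R d)) : measurable A ->
  regular (haar R d) (fun B => closed B) A.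
Proof.
have mF (B : set (torus R d)) : closed B -> measurable B.
  by move=> cB; rewrite -(setCK B); apply: measurableC; apply: sub_sigma_algebra; exact: closed_openC.
have FI (B : (set (torus R d))^nat) : (forall n, closed (B n)) -> closed (\bigcap_n B n).
  by move=> cB; exact: closed_bigI.
have F0 := @closed0 (torus R d); have FT := @closedT (torus R d).
have FU := @closedU (torus R d).
have rs : sigma_algebra setT (regular (haar R d) (fun B : set (torus R d) => closed B)).
  by apply: regular_sigma_algebra => //; exact: probability_lty.
apply: (smallest_sub rs) => U oU.
have [U0|/set0P/negP/negPn/eqP UT] := pselect (~` U !=set0); last first.
  have [r0 rC _] := rs; have := rC _ r0.
  by rewrite -UT setTD setCK.
have [g cg ->] := open_torus_superlevel oU U0.
apply: regular_superlevel => //; first exact: probability_lty.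
- by move=> c; exact: closed_superlevel.
- by move=> c; exact: closed_sublevel.
Qed.

(** The product sigma-algebra is generated by rectangles. It suffices to treat preimages of
    half-lines by [fst] and of open sets of the torus by [snd], both of which are superlevel sets of
    continuous functions. *)
Lemma strip_regular (mu : {measure set (RB * torus R d) -> \bar R})
    (A : set (RB * torus R d)) : (mu setT < +oo)%E -> measurable A ->
  regular mu (fun B : set (RB * torus R d) => closed (B : set (R * torus R d)) /\ measurable B) A.
Proof.
move=> mu_fin.
set F := (fun B : set (RB * torus R d) => closed (B : set (R * torus R d)) /\ measurable B).
have FI (B : (set (RB * torus R d))^nat) : (forall n, F (B n)) -> F (\bigcap_n B n).
  move=> cB; split; first by apply: closed_bigI => n _; exact: (cB n).1.
  by apply: bigcapT_measurable => n; exact: (cB n).2.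
have F0 : F set0 by split; [exact: closed0|].
have FT : F setT by split; [exact: closedT|].
have FU A' B : F A' -> F B -> F (A' `|` B).
  by move=> [? ?] [? ?]; split; [exact: closedU|exact: measurableU].
have mF B : F B -> measurable B by case.
have rs : sigma_algebra setT (regular mu F) by apply: regular_sigma_algebra.
have [r0 rC rU] := rs.
have rpos (g : RB * torus R d -> R) c : measurable_fun setT g ->
    continuous (g : R * torus R d -> R) -> regular mu F [set p | c < g p].
  move=> mg cg; apply: regular_superlevel => //.
  - move=> c'; split; first exact: closed_superlevel.
    by rewrite -[X in measurable X]setTI; apply: measurable_fun_le.
  - move=> c'; split; first exact: closed_sublevel.
    by rewrite -[X in measurable X]setTI; apply: measurable_fun_le.
have rfst B : measurable B -> regular mu F (fst @^-1` B).
  rewrite [measurable](RGenOInfty.measurableE R) => mB.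
  apply: (smallest_sub (sigma_algebra_regular_preimage rs fst)) mB => _ [c ->] /=.
  rewrite (_ : _ @^-1` _ = [set p | c < p.1]); last first.
    by apply/seteqP; split => p /=; rewrite in_itv/= andbT.
  by apply: rpos; [exact: measurable_fst|move=> p; exact: cvg_fst].
have rsnd B : measurable B -> regular mu F (snd @^-1` B).
  apply: (smallest_sub (sigma_algebra_regular_preimage rs snd)) => U oU /=.
  have [U0|/set0P/negP/negPn/eqP UT] := pselect (~` U !=set0); last first.
    have := rC _ r0; rewrite setTD setC0.
    by rewrite (_ : U = setT) ?preimage_setT// -(setCK U) UT setC0.
  have [g cg ->] := open_torus_superlevel oU U0.
  apply: (rpos (g \o snd)).
    by apply: measurableT_comp => //; exact: measurable_continuous_torus.
  move=> p; apply: continuous_comp; [exact: cvg_snd|exact: cg].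
rewrite [measurable]measurable_prod_measurableType.
apply: (smallest_sub rs) => _ [B mB [C mC <-]].
(* The intersection of the two cylinders is written with complements and one countable union, the
   operations under which a sigma-algebra is assumed stable. *)
rewrite (_ : B `*` C = ~` (\bigcup_n (if n == 0%N then ~` (fst @^-1` B) else ~` (snd @^-1` C)))).
  have := rC _ (rU (fun n => if n == 0%N then ~` (fst @^-1` B) else ~` (snd @^-1` C)) _).
  rewrite setTD; apply => n; case: ifP => _.
    by have := rC _ (rfst _ mB); rewrite setTD.
  by have := rC _ (rsnd _ mC); rewrite setTD.
apply/seteqP; split => p /=.
  by move=> [Bp Cp] [n _]; case: ifP => _ /=; apply.
move=> np; split; apply: contrapT => h; apply: np; first by exists 0%N.
by exists 1%N.
Qed.

End torus_regularity.

(** * Continuous functions decreasing to the indicator of a closed set *)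

Section plateau_functions.
Context {R : realType} {X : topologicalType} (g : X -> R) (B : set X).
Hypotheses (g0 : forall x, 0 <= g x) (gB : forall x, g x = 0 <-> B x).

Definition plateau (n : nat) x := Num.max 0 (1 - n.+1%:R * g x).

Lemma plateau01 n x : 0 <= plateau n x <= 1.
Proof. by rewrite le_max lexx/= ge_max ler01/= lerBlDr lerDl mulr_ge0. Qed.

Lemma plateau_eq1 n x : B x -> plateau n x = 1.
Proof. by move=> /gB gx; rewrite /plateau gx mulr0 subr0 maxEle ler01. Qed.

Lemma plateau_eq0 n x : 1 <= n.+1%:R * g x -> plateau n x = 0.
Proof. by move=> h; apply/max_idPl; rewrite subr_le0. Qed.

Lemma plateau_decr i j x : (i <= j)%N -> plateau j x <= plateau i x.
Proof.
move=> ij; rewrite /plateau ge_max le_max lexx/= le_max; apply/orP; right.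
by rewrite lerD2l lerN2 ler_wpM2r// ler_nat ltnS.
Qed.

Lemma continuous_plateau n : continuous g -> continuous (plateau n).
Proof.
move=> cg x; apply: (@continuous_max _ _ (fun=> 0) (fun x => 1 - n.+1%:R * g x)).
  exact: cst_continuous.
apply: continuous_subf => [|{}x]; first exact: cst_continuous.
by apply: continuous_mulf => //; exact: cst_continuous.
Qed.

Lemma plateau_indic n x : `|plateau n x - \1_B x| <= 1.
Proof.
have /andP[? ?] := plateau01 n x; rewrite indicE ler_norml.
by case: (_ \in _); rewrite ?mulr1n ?mulr0n; apply/andP; split; lra.
Qed.

Lemma cvg_plateau x : plateau n x - \1_B x @[n --> \oo] --> (0 : R).
Proof.
apply/cvgrPdist_le => q q0; have [Bx|nBx] := pselect (B x).
  by exists 0%N => // n _; rewrite plateau_eq1// indicE mem_set// subrr subr0 normr0 ltW.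
have gx : 0 < g x by rewrite lt0r g0 andbT; apply/eqP => /gB.
have [n ng] := @ltr_add_invr R 0 _ gx; rewrite add0r in ng.
exists n => // m /= nm; rewrite indicE memNset// plateau_eq0 ?subrr ?subr0 ?normr0 ?(ltW q0)//.
have : 1 <= n.+1%:R * g x by rewrite -ler_pdivrMl ?ltr0n// mulr1 ltW.
by move=> /le_trans; apply; rewrite ler_wpM2r// ler_nat ltnS.
Qed.

End plateau_functions.

(** * Square integrable complex functions *)

Section complex_integral.
Context {disp : measure_display} {T : measurableType disp} {R : realType}.
Variable mu : {measure set T -> \bar R}.
Implicit Types (f g h F G : T -> R[i]) (c : R[i]).

Definition Cint F := mu.-integrable setT (EFin \o (fun x => Re (F x))) /\
  mu.-integrable setT (EFin \o (fun x => Im (F x))).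

Let integrable_lin (a b : R) (u v : T -> R) :
  mu.-integrable setT (EFin \o u) -> mu.-integrable setT (EFin \o v) ->
  mu.-integrable setT (EFin \o (fun x => a * u x + b * v x)).
Proof.
move=> iu iv.
have := integrableD measurableT
  (integrableZl measurableT a iu) (integrableZl measurableT b iv).
by congr (_.-integrable _ _); apply/funext => x /=.
Qed.

Let Rintegral_lin (a b : R) (u v : T -> R) :
  mu.-integrable setT (EFin \o u) -> mu.-integrable setT (EFin \o v) ->
  (\int[mu]_x (a * u x + b * v x) = a * \int[mu]_x u x + b * \int[mu]_x v x)%R.
Proof.
move=> iu iv.
have iau : mu.-integrable setT (EFin \o (fun x => a * u x)).
  by have := integrableZl measurableT a iu; congr (_.-integrable _ _).
have ibv : mu.-integrable setT (EFin \o (fun x => b * v x)).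
  by have := integrableZl measurableT b iv; congr (_.-integrable _ _).
by rewrite RintegralD// !RintegralZl.
Qed.

Lemma conjcD (z w : R[i]) : (z + w)^*%C = z^*%C + w^*%C.
Proof. exact: rmorphD. Qed.

Lemma conjcM (z w : R[i]) : (z * w)^*%C = z^*%C * w^*%C.
Proof. exact: rmorphM. Qed.

Lemma conjc_sum (I : Type) (r : seq I) (F : I -> R[i]) :
  (\sum_(i <- r) F i)^*%C = \sum_(i <- r) (F i)^*%C.
Proof. exact: rmorph_sum. Qed.

Lemma Cint0 : Cint (fun=> 0).
Proof. by split; exact: integrable0. Qed.

Lemma CintD F G : Cint F -> Cint G -> Cint (fun x => F x + G x).
Proof.
move=> [F1 F2] [G1 G2]; split.
  by have := integrable_lin 1 1 F1 G1; congr (_.-integrable _ _); apply/funext => x /=;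
    rewrite !mul1r ReD.
by have := integrable_lin 1 1 F2 G2; congr (_.-integrable _ _); apply/funext => x /=;
  rewrite !mul1r ImD.
Qed.

Lemma CintegralD F G : Cint F -> Cint G ->
  Cintegral mu (fun x => F x + G x) = Cintegral mu F + Cintegral mu G.
Proof.
move=> [F1 F2] [G1 G2]; rewrite /Cintegral/=; apply/eqP; rewrite eq_complex/=.
apply/andP; split; apply/eqP; rewrite -RintegralD//; apply: eq_Rintegral => x _.
  exact: ReD.
exact: ImD.
Qed.

Lemma CintZ c F : Cint F -> Cint (fun x => c * F x).
Proof.
case: c => a b [F1 F2]; split.
  have := integrable_lin a (- b) F1 F2; congr (_.-integrable _ _); apply/funext => x /=.
  by case: (F x) => u v /=; rewrite mulNr.
have := integrable_lin a b F2 F1; congr (_.-integrable _ _); apply/funext => x /=.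
by case: (F x) => u v /=.
Qed.

Lemma CintegralZ c F : Cint F -> Cintegral mu (fun x => c * F x) = c * Cintegral mu F.
Proof.
case: c => a b [F1 F2]; rewrite /Cintegral/=; apply/eqP; rewrite eq_complex/=.
apply/andP; split; apply/eqP.
  rewrite -[in RHS]mulNr -Rintegral_lin//; apply: eq_Rintegral => x _.
  by case: (F x) => u v /=; rewrite mulNr.
rewrite -Rintegral_lin//; apply: eq_Rintegral => x _.
by case: (F x) => u v /=.
Qed.

Lemma Cint_sum (I : Type) (r : seq I) (F : I -> T -> R[i]) :
  (forall i, Cint (F i)) -> Cint (fun x => \sum_(i <- r) F i x).
Proof.
move=> iF; elim: r => [|i r IH].
  by rewrite (_ : (fun x => _) = (fun=> 0)); [exact: Cint0|apply/funext => x; rewrite big_nil].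
rewrite (_ : (fun x => _) = (fun x => F i x + \sum_(j <- r) F j x)); first exact: CintD.
by apply/funext => x; rewrite big_cons.
Qed.

Lemma Cintegral_sum (I : Type) (r : seq I) (F : I -> T -> R[i]) :
  (forall i, Cint (F i)) ->
  Cintegral mu (fun x => \sum_(i <- r) F i x) = \sum_(i <- r) Cintegral mu (F i).
Proof.
move=> iF; elim: r => [|i r IH].
  rewrite big_nil /Cintegral.
  under eq_Rintegral do rewrite big_nil.
  under [X in (_ +i* X)%C]eq_Rintegral do rewrite big_nil.
  by rewrite /Rintegral integral0.
rewrite big_cons -IH -CintegralD//; last exact: Cint_sum.
by congr Cintegral; apply/funext => x; rewrite big_cons.
Qed.

Lemma Cintegral_conj F : Cint F ->
  Cintegral mu (fun x => (F x)^*%C) = (Cintegral mu F)^*%C.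
Proof.
move=> [F1 F2]; rewrite /Cintegral/=; apply/eqP; rewrite eq_complex/=.
apply/andP; split; apply/eqP.
  by apply: eq_Rintegral => x _; case: (F x).
rewrite -mulN1r -RintegralZl//.
by apply: eq_Rintegral => x _; rewrite mulN1r; case: (F x).
Qed.

Lemma cmeasurable_normc2 f : cmeasurable f ->
  measurable_fun setT (fun x => normc (f x) ^+ 2).
Proof.
move=> [m1 m2]; under eq_fun do rewrite normc_sqr.
by apply: measurable_funD; exact: measurable_funX.
Qed.

Definition sqnorm f : R := (\int[mu]_x (normc (f x) ^+ 2))%R.

Lemma sqnorm_ge0 f : 0 <= sqnorm f.
Proof. by apply: Rintegral_ge0 => x _; exact: sqr_ge0. Qed.

Lemma L2norm_integral f :
  L2norm mu f = ((\int[mu]_x (normc (f x) ^+ 2)%:E) `^ 2^-1)%E.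
Proof.
rewrite /L2norm unlock; congr (_ `^ _)%E; apply: eq_integral => x _.
by rewrite /= powR_mulrn// real_normK// num_real.
Qed.

Let integral_normc2_ge0 f : (0 <= \int[mu]_x (normc (f x) ^+ 2)%:E)%E.
Proof. by apply: integral_ge0 => x _; rewrite lee_fin sqr_ge0. Qed.

Lemma in_L2P f : in_L2 mu f <->
  cmeasurable f /\ mu.-integrable setT (EFin \o (fun x => normc (f x) ^+ 2)).
Proof.
have E : (\int[mu]_x `|(EFin \o (fun x => (normc (f x) ^+ 2)%R)) x| =
    \int[mu]_x (normc (f x) ^+ 2)%:E)%E.
  by apply: eq_integral => x _ /=; rewrite ger0_norm// sqr_ge0.
split=> -[mf h]; split => //.
  apply/integrableP; split; first by apply/measurable_EFinP; exact: cmeasurable_normc2.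
  by rewrite E; apply: (@lty_poweRy _ _ 2^-1) => //; rewrite -L2norm_integral.
rewrite L2norm_integral -E; apply: poweR_lty.
by have /integrableP[] := h.
Qed.

Lemma sqnormE f : in_L2 mu f -> (\int[mu]_x (normc (f x) ^+ 2)%:E)%E = (sqnorm f)%:E.
Proof.
move=> /in_L2P[mf h]; rewrite /sqnorm /Rintegral fineK//.
exact: integrable_fin_num h.
Qed.

Lemma L2normE f : in_L2 mu f -> L2norm mu f = (Num.sqrt (sqnorm f))%:E.
Proof.
move=> L2f; rewrite L2norm_integral sqnormE//= powR12_sqrt//; exact: sqnorm_ge0.
Qed.

Lemma cmeasurableD f g : cmeasurable f -> cmeasurable g -> cmeasurable (fun x => f x + g x).
Proof.
move=> [f1 f2] [g1 g2]; split.
  by under eq_fun do rewrite ReD; exact: measurable_funD.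
by under eq_fun do rewrite ImD; exact: measurable_funD.
Qed.

Lemma cmeasurableM f g : cmeasurable f -> cmeasurable g -> cmeasurable (fun x => f x * g x).
Proof.
move=> [f1 f2] [g1 g2]; split.
  rewrite (_ : (fun x => _) = (fun x => Re (f x) * Re (g x) -
      Im (f x) * Im (g x))).
    by apply: measurable_funB; exact: measurable_funM.
  by apply/funext => x; case: (f x) => ? ?; case: (g x).
rewrite (_ : (fun x => _) = (fun x => Re (f x) * Im (g x) +
    Im (f x) * Re (g x))).
  by apply: measurable_funD; exact: measurable_funM.
by apply/funext => x; case: (f x) => ? ?; case: (g x).
Qed.

Lemma cmeasurable_cst c : cmeasurable (fun _ : T => c).
Proof. by split; exact: measurable_cst. Qed.

Lemma cmeasurable_conj f : cmeasurable f -> cmeasurable (fun x => (f x)^*%C).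
Proof.
move=> [f1 f2]; split.
  by rewrite (_ : (fun x => _) = (fun x => Re (f x)))//; apply/funext => x; case: (f x).
rewrite (_ : (fun x => _) = (fun x => - Im (f x))); first exact: measurable_funN.
by apply/funext => x; case: (f x).
Qed.

Let integrable_dom (u v : T -> R) : measurable_fun setT u ->
  (forall x, `|u x| <= v x) -> mu.-integrable setT (EFin \o v) ->
  mu.-integrable setT (EFin \o u).
Proof.
move=> mu_ uv iv; apply: (le_integrable measurableT _ _ iv).
  exact/measurable_EFinP.
by move=> x _ /=; rewrite lee_fin (le_trans (uv x))// ler_norm.
Qed.

Lemma Cint_dom F (v : T -> R) : cmeasurable F -> (forall x, normc (F x) <= v x) ->
  mu.-integrable setT (EFin \o v) -> Cint F.
Proof.
move=> [m1 m2] Fv iv; split; apply: integrable_dom iv => // x; apply: le_trans (Fv x).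
  case: (F x) => a b /=; rewrite -sqrtr_sqr ler_wsqrtr// lerDl sqr_ge0//.
case: (F x) => a b /=; rewrite -sqrtr_sqr ler_wsqrtr// lerDr sqr_ge0//.
Qed.

Lemma normcM (z w : R[i]) : normc (z * w) = normc z * normc w.
Proof. exact: Normc.normcM. Qed.

Lemma normc_conj (z : R[i]) : normc z^*%C = normc z.
Proof. by case: z => a b /=; rewrite sqrrN. Qed.

Lemma normc_ge0 (z : R[i]) : 0 <= normc z.
Proof. by case: z => a b /=; exact: sqrtr_ge0. Qed.

Lemma Cint_mul f g : in_L2 mu f -> in_L2 mu g -> Cint (fun x => f x * (g x)^*%C).
Proof.
move=> /in_L2P[mf fi] /in_L2P[mg gi].
apply: (@Cint_dom _ (fun x => 2^-1 * normc (f x) ^+ 2 + 2^-1 * normc (g x) ^+ 2)).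
- by apply: cmeasurableM => //; exact: cmeasurable_conj.
- move=> x; rewrite normcM normc_conj.
  have := sqr_ge0 (normc (f x) - normc (g x)).
  by rewrite sqrrB; lra.
- exact: integrable_lin.
Qed.

Lemma in_L2D f g : in_L2 mu f -> in_L2 mu g -> in_L2 mu (fun x => f x + g x).
Proof.
move=> /in_L2P[mf fi] /in_L2P[mg gi]; apply/in_L2P; split; first exact: cmeasurableD.
apply: (@integrable_dom _ (fun x => 2 * normc (f x) ^+ 2 + 2 * normc (g x) ^+ 2)).
- by apply: cmeasurable_normc2; exact: cmeasurableD.
- move=> x; rewrite ger0_norm ?sqr_ge0// !normc_sqr.
  case: (f x) => a b; case: (g x) => a' b' /=.
  have := sqr_ge0 (a - a'); have := sqr_ge0 (b - b').
  by rewrite !sqrrB !sqrrD; lra.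
- exact: integrable_lin.
Qed.

Lemma in_L2Z c f : in_L2 mu f -> in_L2 mu (fun x => c * f x).
Proof.
move=> /in_L2P[mf fi]; apply/in_L2P; split.
  by apply: cmeasurableM => //; exact: cmeasurable_cst.
under eq_fun do rewrite /= normcM exprMn.
have := integrableZl measurableT (normc c ^+ 2) fi.
by congr (_.-integrable _ _).
Qed.

Lemma in_L2_0 : in_L2 mu (fun _ : T => 0 : R[i]).
Proof.
apply/in_L2P; split; first exact: cmeasurable_cst.
rewrite (_ : EFin \o _ = cst 0%E); first exact: integrable0.
by apply/funext => x; rewrite /comp normc_sqr/= expr0n addr0.
Qed.

Lemma in_L2_sum (I : Type) (r : seq I) (F : I -> T -> R[i]) :
  (forall i, in_L2 mu (F i)) -> in_L2 mu (fun x => \sum_(i <- r) F i x).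
Proof.
move=> iF; elim: r => [|i r IH].
  by under eq_fun do rewrite big_nil; exact: in_L2_0.
by under eq_fun do rewrite big_cons; exact: in_L2D.
Qed.

Lemma innerDl f g h : in_L2 mu f -> in_L2 mu g -> in_L2 mu h ->
  inner mu (fun x => f x + g x) h = inner mu f h + inner mu g h.
Proof.
move=> lf lg lh; rewrite /inner -CintegralD; try exact: Cint_mul.
by congr Cintegral; apply/funext => x; rewrite mulrDl.
Qed.

Lemma innerZl c f h : in_L2 mu f -> in_L2 mu h ->
  inner mu (fun x => c * f x) h = c * inner mu f h.
Proof.
move=> lf lh; rewrite /inner -CintegralZ; try exact: Cint_mul.
by congr Cintegral; apply/funext => x; rewrite mulrA.
Qed.

Lemma inner_conj f g : in_L2 mu f -> in_L2 mu g -> inner mu g f = (inner mu f g)^*%C.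
Proof.
move=> lf lg; rewrite /inner -Cintegral_conj; last exact: Cint_mul.
congr Cintegral; apply/funext => x.
by rewrite conjcM conjcK mulrC.
Qed.

Lemma innerDr f g h : in_L2 mu f -> in_L2 mu g -> in_L2 mu h ->
  inner mu h (fun x => f x + g x) = inner mu h f + inner mu h g.
Proof.
move=> lf lg lh; rewrite inner_conj//; last exact: in_L2D.
by rewrite innerDl// (inner_conj lh lf) (inner_conj lh lg) conjcD !conjcK.
Qed.

Lemma innerZr c f h : in_L2 mu f -> in_L2 mu h ->
  inner mu h (fun x => c * f x) = c^*%C * inner mu h f.
Proof.
move=> lf lh; rewrite inner_conj//; last exact: in_L2Z.
by rewrite innerZl// (inner_conj lh lf) conjcM conjcK.
Qed.

Lemma inner_suml (I : Type) (r : seq I) (F : I -> T -> R[i]) h :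
  (forall i, in_L2 mu (F i)) -> in_L2 mu h ->
  inner mu (fun x => \sum_(i <- r) F i x) h = \sum_(i <- r) inner mu (F i) h.
Proof.
move=> lF lh; rewrite /inner -Cintegral_sum; last by move=> i; exact: Cint_mul.
by congr Cintegral; apply/funext => x; rewrite mulr_suml.
Qed.

Lemma inner_sumr (I : Type) (r : seq I) (F : I -> T -> R[i]) h :
  (forall i, in_L2 mu (F i)) -> in_L2 mu h ->
  inner mu h (fun x => \sum_(i <- r) F i x) = \sum_(i <- r) inner mu h (F i).
Proof.
move=> lF lh; rewrite inner_conj//; last exact: in_L2_sum.
rewrite inner_suml// conjc_sum.
by apply: eq_bigr => i _; rewrite -inner_conj.
Qed.

Lemma inner_self f : inner mu f f = (sqnorm f)%:C%C.
Proof.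
rewrite /inner /Cintegral /sqnorm/=; apply/eqP; rewrite eq_complex/=; apply/andP; split; apply/eqP.
  by apply: eq_Rintegral => x _; rewrite normc_sqr; case: (f x) => a b /=; rewrite mulrN opprK !expr2.
rewrite (@eq_Rintegral _ _ _ _ _ (fun=> 0)); first by rewrite /Rintegral integral0.
by move=> x _; case: (f x) => a b /=; ring.
Qed.

Lemma sqnormD f g : in_L2 mu f -> in_L2 mu g ->
  sqnorm (fun x => f x + g x) = sqnorm f + 2 * Re (inner mu f g) + sqnorm g.
Proof.
move=> lf lg.
have : inner mu (fun x => f x + g x) (fun x => f x + g x) =
    inner mu f f + (inner mu f g + (inner mu f g)^*%C) + inner mu g g.
  rewrite innerDl ?innerDr//; try exact: in_L2D.
  by rewrite (inner_conj lf lg); ring.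
rewrite !inner_self; case: (inner mu f g) => a b /= [] -> _.
by rewrite mulr_natl mulr2n.
Qed.

Lemma sqnormZ c f : in_L2 mu f -> sqnorm (fun x => c * f x) = normc c ^+ 2 * sqnorm f.
Proof.
move=> lf; have /in_L2P[_ fi] := lf; rewrite /sqnorm -RintegralZl//.
by apply: eq_Rintegral => x _; rewrite normcM exprMn.
Qed.

Lemma sqnorm_ae f g : in_L2 mu f -> in_L2 mu g -> {ae mu, forall x, f x = g x} ->
  sqnorm f = sqnorm g.
Proof.
move=> /in_L2P[mf fi] /in_L2P[mg gi] fg; rewrite /sqnorm /Rintegral; congr fine.
apply: ae_eq_integral => //.
- by apply/measurable_EFinP; exact: cmeasurable_normc2.
- by apply/measurable_EFinP; exact: cmeasurable_normc2.
by apply: filterS fg => x ->.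
Qed.

Lemma inner_ael f g h : in_L2 mu f -> in_L2 mu g -> in_L2 mu h ->
  {ae mu, forall x, f x = g x} -> inner mu f h = inner mu g h.
Proof.
move=> lf lg lh fg; have [i1 i2] := Cint_mul lf lh; have [j1 j2] := Cint_mul lg lh.
rewrite /inner /Cintegral /Rintegral; congr (fine _ +i* fine _)%C; apply: ae_eq_integral => //.
- exact: (measurable_int mu i1).
- exact: (measurable_int mu j1).
- by apply: filterS fg => x ->.
- exact: (measurable_int mu i2).
- exact: (measurable_int mu j2).
- by apply: filterS fg => x ->.
Qed.

(** The squared norm of f + t g is a nonnegative quadratic polynomial in the real variable t,
    evaluated at its minimum. *)
Lemma cauchy_schwarz_re f g : in_L2 mu f -> in_L2 mu g ->
  Re (inner mu f g) <= Num.sqrt (sqnorm f) * Num.sqrt (sqnorm g).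
Proof.
move=> lf lg; set r := Re _.
have quad (t : R) : 0 <= sqnorm f + 2 * t * r + t ^+ 2 * sqnorm g.
  have := sqnorm_ge0 (fun x => f x + t%:C%C * g x).
  rewrite sqnormD//; last exact: in_L2Z.
  rewrite innerZr// sqnormZ//; congr (0 <= _); congr (_ + _ + _).
    by rewrite /r; case: (inner mu f g) => a b /=; ring.
  by rewrite normc_sqr/= expr0n addr0.
have f0 := sqnorm_ge0 f; have g0 := sqnorm_ge0 g.
rewrite -sqrtrM//.
have [r0|r0] := ltP r 0; first by rewrite (le_trans (ltW r0))// sqrtr_ge0.
rewrite -(ger0_norm r0) -sqrtr_sqr ler_wsqrtr//.
have [g00|gn0] := eqVneq (sqnorm g) 0.
  rewrite g00 mulr0 in quad *.
  have [->|rn0] := eqVneq r 0; first by rewrite expr0n.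
  (* When g has norm 0 the polynomial is affine; at this t its value would be -1 if r were not 0. *)
  have := quad (- (sqnorm f + 1) / (2 * r)); rewrite mulr0 addr0.
  by rewrite (_ : 2 * _ * r = - (sqnorm f + 1)); [lra|field].
have gp : 0 < sqnorm g by rewrite lt0r gn0.
have := quad (- r / sqnorm g).
rewrite (_ : _ + _ = (sqnorm f * sqnorm g - r ^+ 2) / sqnorm g); last by field.
by rewrite pmulr_lge0 ?invr_gt0// subr_ge0.
Qed.

Lemma sqrt_sqnormD f g : in_L2 mu f -> in_L2 mu g ->
  Num.sqrt (sqnorm (fun x => f x + g x)) <= Num.sqrt (sqnorm f) + Num.sqrt (sqnorm g).
Proof.
move=> lf lg; rewrite -[leRHS]ger0_norm ?addr_ge0 ?sqrtr_ge0// -sqrtr_sqr ler_wsqrtr//.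
rewrite sqnormD// sqrrD !sqr_sqrtr ?sqnorm_ge0// lerD2r lerD2l mulr_natl.
by rewrite ler_pMn2r// cauchy_schwarz_re.
Qed.

(** Multiplying f by the conjugate of z makes the inner product equal to |z|^2, so that the bound on
    real parts applies. *)
Lemma normc_inner f g : in_L2 mu f -> in_L2 mu g ->
  normc (inner mu f g) <= Num.sqrt (sqnorm f) * Num.sqrt (sqnorm g).
Proof.
move=> lf lg; set z := inner mu f g.
have [z0|z0] := eqVneq (normc z) 0; first by rewrite z0 mulr_ge0// sqrtr_ge0.
have nz : 0 < normc z by rewrite lt0r z0 normc_ge0.
have := cauchy_schwarz_re (in_L2Z (z^*%C) lf) lg.
rewrite innerZl// sqnormZ// -/z sqrtrM ?sqr_ge0// sqrtr_sqr ger0_norm ?normc_ge0//.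
rewrite normc_conj -mulrA (_ : Re (_ * z) = normc z * normc z).
  by rewrite ler_pM2l.
by rewrite -expr2 normc_sqr; case: (z) => a b /=; ring.
Qed.

End complex_integral.

(** * Action of the Schrödinger group on the characters *)

Section fourier_modes.
Context {R : realType} {d : nat}.
Local Notation mu := (haar R d).
Implicit Types (k l m : 'rV[int]_d).

Definition ek k (x : torus R d) : R[i] :=
  (cos (0 + phase k (repr x)) +i* cos (- (pi / 2) + phase k (repr x)))%C.

(** exp(- i lam k t), the factor by which e^{it Laplacian} acts on [ek k]. *)
Definition osc k (t : R) : R[i] := (cos (lam k * t) -i* sin (lam k * t))%C.

Lemma waveE k t x : wave k (t, x) = osc k t * ek k x.
Proof.
rewrite /wave /osc /ek /mono /=; apply/eqP; rewrite eq_complex/=.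
rewrite -!addrA ![- (pi / 2) + _]addrC !cosBpihalf !add0r mulNr.
rewrite [- (_ * _) + _]addrC cosB sinB.
by apply/andP; split; apply/eqP; ring.
Qed.

Lemma normc_osc k t : normc (osc k t) = 1.
Proof. by rewrite /= sqrrN cos2Dsin2 sqrtr1. Qed.

Lemma oscD k s t : osc k (s + t) = osc k s * osc k t.
Proof.
rewrite /osc mulrDr cosD sinD; apply/eqP; rewrite eq_complex/=.
by apply/andP; split; apply/eqP; ring.
Qed.

Lemma osc0 k : osc k 0 = 1.
Proof. by rewrite /osc mulr0 cos0 sin0 oppr0. Qed.

Lemma conj_osc k t : (osc k t)^*%C = osc k (- t).
Proof. by rewrite /osc mulrN cosN sinN /=. Qed.

Lemma cmeasurable_ek k : cmeasurable (ek k).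
Proof. by split; exact: measurable_cos_phase. Qed.

Lemma normc_ek k x : normc (ek k x) = 1.
Proof. by rewrite /= add0r [- _ + _]addrC cosBpihalf cos2Dsin2 sqrtr1. Qed.

Lemma in_L2_ek k : in_L2 mu (ek k).
Proof.
apply/in_L2P; split; first exact: cmeasurable_ek.
apply: bmeas_integrable; first exact: probability_lty.
rewrite (_ : (fun x => _) = fun=> 1); first exact: bmeas_cst.
by apply/funext => x; rewrite normc_ek expr1n.
Qed.

Lemma inner_ek k l : inner mu (ek k) (ek l) = (k == l)%:R.
Proof.
rewrite /inner /Cintegral.
have E x : ek k x * (ek l x)^*%C =
    (cos (0 + phase (k - l) (repr x)) +i* cos (- (pi / 2) + phase (k - l) (repr x)))%C.
  rewrite /ek ![- (pi / 2) + _]addrC !cosBpihalf !add0r phaseD phaseN cosB sinB.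
  by apply/eqP; rewrite eq_complex/=; apply/andP; split; apply/eqP; ring.
rewrite (@eq_Rintegral _ _ _ _ _ (fun x : torus R d => cos (0 + phase (k - l) (repr x)))); last first.
  by move=> x _; rewrite E.
rewrite [X in (_ +i* X)%C](@eq_Rintegral _ _ _ _ _ (fun x : torus R d => cos (- (pi / 2) + phase (k - l) (repr x)))); last first.
  by move=> x _; rewrite E.
rewrite !integral_haar_cos subr_eq0 cosN cos_pihalf cos0.
by case: eqP.
Qed.

(** A derivative multiplies by a constant and shifts the phase by pi / 2, so that functions of this
    form are stable under all partial derivatives. *)
Lemma derivative_cos_phase (c a : R) k (x : 'rV[R]_d) j :
  derivable (fun y => c * cos (a + phase k y)) x (delta_mx 0 j) /\
  'D_(delta_mx 0 j) (fun y => c * cos (a + phase k y)) x =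
    (c * (pi *+ 2 * (k 0 j)%:~R)) * cos (a + pi / 2 + phase k x).
Proof.
set w := pi *+ 2 * (k 0 j)%:~R.
pose G (h : R) := c * cos (a + phase k x + h * w).
have phase_shift (h : R) : phase k (h *: delta_mx 0 j + x) = h * w + phase k x.
  rewrite /phase (bigD1 j)//= [in RHS](bigD1 j)//= !mxE !eqxx/= mulr1 addrA.
  congr (_ + _); first by rewrite /w; ring.
  by apply: eq_bigr => i ij; rewrite !mxE eqxx (negbTE ij)/= mulr0 add0r.
have dG : is_derive (0 : R) (1 : R) G (c * (- sin (a + phase k x + 0 * w) * w)).
  apply: is_derive_eq.
  by rewrite /GRing.scale/= mulr0 !add0r mul1r mulr1.
have E : (fun h : R => h^-1 *: (((fun y => c * cos (a + phase k y)) \o shift x) (h *: delta_mx 0 j) -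
      c * cos (a + phase k x))) =
    (fun h : R => h^-1 *: ((G \o shift 0) (h *: 1) - G 0)).
  apply/funext => h; congr (_ *: (_ - _)).
    by rewrite /= /G phase_shift /GRing.scale/= mulr1 addr0; congr (_ * cos _); ring.
  by rewrite /G mul0r addr0.
have [dG1 dG2] := dG.
split; first by rewrite /derivable E.
rewrite /derive E; move: dG2; rewrite /derive => ->.
by rewrite mul0r addr0 addrAC cosDpihalf; ring.
Qed.

Lemma partials_cos_phase (s : seq 'I_d) (a : R) k :
  exists c' a' : R, partials s (fun y : 'rV[R]_d => cos (a + phase k y)) =
    (fun y => c' * cos (a' + phase k y)).
Proof.
elim: s => [|j s [c' [a' IH]]] /=.
  by exists 1, a; apply/funext => y; rewrite mul1r.
rewrite IH; exists (c' * (pi *+ 2 * (k 0 j)%:~R)), (a' + pi / 2).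
by apply/funext => y; have [_ ->] := derivative_cos_phase c' a' k y j.
Qed.

Lemma smooth_cos_phase (a : R) k : smooth_real (fun y : 'rV[R]_d => cos (a + phase k y)).
Proof.
move=> s x; have [c' [a' ->]] := partials_cos_phase s a k; split.
  apply: continuous_mulf; first exact: cst_continuous.
  move=> y; apply: continuous_comp; last exact: continuous_cos.
  by apply: continuousD; [exact: cst_continuous|exact: continuous_phase].
by move=> j; have [] := derivative_cos_phase c' a' k x j.
Qed.

Lemma laplacian_cos_phase (a : R) k (x : 'rV[R]_d) :
  laplacian_real (fun y => cos (a + phase k y)) x = - lam k * cos (a + phase k x).
Proof.
rewrite /laplacian_real /lam /dotz rmorph_sum/= mulr_sumr -sumrN mulr_suml.
apply: eq_bigr => j _.
have -> : (fun y : 'rV[R]_d => 'D_(delta_mx 0 j) (fun y => cos (a + phase k y)) y) =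
    (fun y => (1 * (pi *+ 2 * (k 0 j)%:~R)) * cos (a + pi / 2 + phase k y)).
  apply/funext => y; have [_ <-] := derivative_cos_phase 1 a k y j.
  by under [in RHS]eq_fun do rewrite mul1r.
have [_ ->] := derivative_cos_phase (1 * (pi *+ 2 * (k 0 j)%:~R)) (a + pi / 2) k x j.
rewrite (_ : a + pi / 2 + pi / 2 + phase k x = a + phase k x + pi); last by field.
by rewrite cosDpi intrM; ring.
Qed.

Lemma lift_Re_ek k : lift_Re (ek k) = (fun x => cos (0 + phase k x)).
Proof. by apply/funext => x; rewrite /lift_Re/= cos_phase_repr. Qed.

Lemma lift_Im_ek k : lift_Im (ek k) = (fun x => cos (- (pi / 2) + phase k x)).
Proof. by apply/funext => x; rewrite /lift_Im/= cos_phase_repr. Qed.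

Lemma smooth_ek k : smooth (ek k).
Proof. by split; rewrite ?lift_Re_ek ?lift_Im_ek; exact: smooth_cos_phase. Qed.

Lemma laplacian_ek k x : laplacian (ek k) x = (- lam k)%:C%C * ek k x.
Proof.
rewrite /laplacian lift_Re_ek lift_Im_ek !laplacian_cos_phase /ek.
by apply/eqP; rewrite eq_complex/=; apply/andP; split; apply/eqP; ring.
Qed.

End fourier_modes.

Section schrodinger_group.
Context {R : realType} {d : nat}.
Local Notation mu := (haar R d).
Variable U : R -> (torus R d -> R[i]) -> torus R d -> R[i].
Hypothesis hU : is_schrodinger_group U.
Implicit Types (k : 'rV[int]_d) (f g : torus R d -> R[i]).

Let nrm f := Num.sqrt (sqnorm mu f).

Let nrm_U t f : in_L2 mu f -> nrm (U t f) = nrm f.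
Proof.
move=> lf; have := group_isometry hU t lf.
by rewrite !L2normE//; [case|exact: group_L2].
Qed.

Let sqnorm_U t f : in_L2 mu f -> sqnorm mu (U t f) = sqnorm mu f.
Proof.
move=> lf; have := nrm_U t lf; rewrite /nrm => E.
by rewrite -[LHS]sqr_sqrtr ?sqnorm_ge0// E sqr_sqrtr ?sqnorm_ge0.
Qed.

(** Polarization: the group preserves the norm of a f + g, and a = 1, a = i give the real and
    imaginary parts. *)
Lemma group_inner t f g : in_L2 mu f -> in_L2 mu g ->
  inner mu (U t f) (U t g) = inner mu f g.
Proof.
move=> lf lg.
have lUf := group_L2 hU t lf; have lUg := group_L2 hU t lg.
have polar (a : R[i]) : Re (a * inner mu (U t f) (U t g)) = Re (a * inner mu f g).
  have laf := in_L2Z a lf; have laUf := in_L2Z a lUf.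
  have lsum : in_L2 mu (fun y => a * f y + g y) by exact: in_L2D.
  have := sqnorm_ae (group_L2 hU t lsum) (in_L2D laUf lUg) (group_linear hU t a lf lg).
  rewrite sqnorm_U// !sqnormD// !sqnormZ// !innerZl// !sqnorm_U//.
  by move=> ?; lra.
have p1 := polar 1; have pi := polar 'i%C; move: p1 pi.
rewrite !mul1r; move: (inner _ _ _) (inner _ _ _) => [x y] [x' y'] /= -> h.
by congr (_ +i* _)%C; lra.
Qed.

Lemma group_adjoint t f g : in_L2 mu f -> in_L2 mu g ->
  inner mu (U t f) g = inner mu f (U (- t) g).
Proof.
move=> lf lg; have lUg := group_L2 hU (- t) lg.
rewrite -(group_inner t lf lUg).
have lUf := group_L2 hU t lf; have lUUg := group_L2 hU t lUg.
rewrite (inner_conj lg lUf) (inner_conj lUUg lUf); congr (_^*%C).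
apply: inner_ael => //.
have h1 := group_add hU t (- t) lg; have h2 := group_zero hU lg.
by apply: filterS2 h1 h2 => x; rewrite subrr => <- ->.
Qed.

(** The defect is shown to vanish by elementary means: it is subadditive in t ([defectD]) and o(t)
    at 0 ([defect_small]), so defect k t <= n * defect k (t / n) tends to 0. *)
Let defect k t := nrm (fun x => U t (ek k) x + (- osc k t) * ek k x).

Let in_L2_defect k t : in_L2 mu (fun x => U t (ek k) x + (- osc k t) * ek k x).
Proof.
by apply: in_L2D; [apply: (group_L2 hU); exact: in_L2_ek|apply: in_L2Z; exact: in_L2_ek].
Qed.

Let defectD k s t : defect k (s + t) <= defect k s + defect k t.
Proof.
(* U_{s+t} e - osc(s+t) e = osc(t) (U_s e - osc(s) e) + U_s (U_t e - osc(t) e), where U_s is an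
   isometry and |osc(t)| = 1. *)
have le := @in_L2_ek R d k; have lUt := group_L2 hU t le; have lUs := group_L2 hU s le.
pose g y := - osc k t * ek k y + U t (ek k) y.
have lg : in_L2 mu g by apply: in_L2D => //; exact: in_L2Z.
have E : defect k (s + t) = nrm (fun x => osc k t * (U s (ek k) x + (- osc k s) * ek k x) + U s g x).
  rewrite /defect /nrm; congr Num.sqrt; apply: sqnorm_ae.
  - exact: in_L2_defect.
  - by apply: in_L2D; [apply: in_L2Z; exact: in_L2_defect|exact: group_L2].
  have h1 := group_add hU s t le; have h2 := group_linear hU s (- osc k t) le lUt.
  apply: filterS2 h1 h2 => x -> ->; rewrite oscD; ring.
rewrite E; apply: le_trans (sqrt_sqnormD (in_L2Z (osc k t) (in_L2_defect k s)) (group_L2 hU s lg)) _.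
apply: lerD.
  by rewrite sqnormZ; [rewrite normc_osc expr1n mul1r|exact: in_L2_defect].
rewrite [leLHS](nrm_U s lg) /nrm /defect.
by rewrite le_eqVlt; apply/orP; left; apply/eqP; congr (Num.sqrt (sqnorm _ _));
  apply/funext => x; rewrite /g addrC.
Qed.

Let quotient_cvg (f : R -> R) (df : R) : is_derive (0 : R) (1 : R) f df ->
  forall e, 0 < e -> \forall h \near (0 : R)^', `|df - h^-1 * (f h - f 0)| <= e.
Proof.
move=> [d1 d2] e e0.
have : (fun h : R => h^-1 *: ((f \o shift 0) (h *: (1 : R)) - f 0)) @ (0 : R)^' --> df.
  by rewrite -d2; exact: d1.
move/cvgrPdist_le => /(_ e e0); apply: filterS => h.
by rewrite /= addr0 /GRing.scale/= mulr1.
Qed.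

Let osc_quotient k e : 0 < e -> \forall h \near (0 : R)^',
  normc ((h^-1)%:C%C * (1 - osc k h) - 'i%C * (lam k)%:C%C) <= e.
Proof.
move=> e0; have e2 : 0 < e / 2 by rewrite divr_gt0.
have ds : is_derive (0 : R) (1 : R) (fun h => sin (lam k * h)) (lam k).
  apply: is_derive_eq.
  by rewrite /GRing.scale/= mulr0 cos0; ring.
have dc : is_derive (0 : R) (1 : R) (fun h => cos (lam k * h)) 0.
  apply: is_derive_eq.
  by rewrite /GRing.scale/= mulr0 sin0; ring.
have := quotient_cvg ds e2; have := quotient_cvg dc e2; apply: filterS2 => h.
rewrite mulr0 cos0 sin0 subr0 sub0r normrN => hc hs.
have -> : (h^-1)%:C%C * (1 - osc k h) - 'i%C * (lam k)%:C%C =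
    ((- (h^-1 * (cos (lam k * h) - 1))) +i* (- (lam k - h^-1 * sin (lam k * h))))%C.
  by apply/eqP; rewrite eq_complex/=; apply/andP; split; apply/eqP; ring.
have normc_le (a b : R) : normc (a +i* b)%C <= `|a| + `|b|.
  rewrite /= -[leRHS]ger0_norm ?addr_ge0// -sqrtr_sqr ler_wsqrtr// sqrrD !real_normK ?num_real//.
  by rewrite -addrA lerD2l lerDr mulrn_wge0// mulr_ge0.
apply: (le_trans (normc_le _ _)); rewrite !normrN; lra.
Qed.

(** The generator and the derivative of [osc] at 0 agree on [ek k]: divided by h, the difference U_h
    e - osc(h) e is the sum of the two errors [g h] and [r * ek k], both of which tend to 0. *)
Let defect_small k e : 0 < e -> \forall h \near (0 : R)^', defect k h <= e * `|h|.
Proof.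
move=> e0; have e2 : 0 < e / 2 by rewrite divr_gt0.
have le := @in_L2_ek R d k.
have nek : nrm (ek k) = 1.
  by have := inner_self mu (ek k); rewrite inner_ek eqxx /nrm => -[] <-; rewrite sqrtr1.
pose g (h : R) x := (h^-1)%:C%C * (U h (ek k) x - ek k x) - 'i%C * laplacian (ek k) x.
have gE h : g h = fun x => (h^-1)%:C%C * (U h (ek k) x + (-1) * ek k x) + ('i%C * (lam k)%:C%C) * ek k x.
  by apply/funext => x; rewrite /g laplacian_ek rmorphN/=; ring.
have lg h : in_L2 mu (g h).
  rewrite gE; apply: in_L2D; apply: in_L2Z => //; apply: in_L2D; last exact: in_L2Z.
  exact: group_L2.
have := group_generator hU (smooth_ek k).
rewrite -/g => /fine_cvgP[_ /cvgrPdist_le/(_ _ e2)] Hg.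
have Hr := osc_quotient k e2.
have Hn : \forall h \near (0 : R)^', h != 0 by exact: nbhs_dnbhs_neq.
apply: filterS3 Hg Hr Hn => h /=.
rewrite -/(g h) L2normE//= sub0r normrN ger0_norm ?sqrtr_ge0// => Hg Hr h0.
pose r := (h^-1)%:C%C * (1 - osc k h) - 'i%C * (lam k)%:C%C.
rewrite /defect.
have -> : (fun x => U h (ek k) x + - osc k h * ek k x) =
    (fun x => h%:C%C * (g h x + r * ek k x)).
  apply/funext => x; rewrite gE /r.
  have hh : h%:C%C * (h^-1)%:C%C = 1 :> R[i] by rewrite -rmorphM/= divff.
  rewrite !mulrDr !mulrDl !mulrA !mulrDr !mulrA hh; ring.
have lr : in_L2 mu (fun x => r * ek k x) by exact: in_L2Z.
rewrite /nrm sqnormZ; last exact: in_L2D.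
rewrite sqrtrM ?sqr_ge0// sqrtr_sqr ger0_norm ?normc_ge0// mulrC.
rewrite (_ : normc h%:C%C = `|h|); last by rewrite /= expr0n addr0 sqrtr_sqr.
rewrite ler_wpM2r//; apply: (le_trans (sqrt_sqnormD (lg h) lr)).
rewrite (splitr e) lerD// sqnormZ// sqrtrM ?sqr_ge0// sqrtr_sqr ger0_norm ?normc_ge0//.
by rewrite -/(nrm (ek k)) nek mulr1.
Qed.

Let defect0 k t : defect k t = 0.
Proof.
have le := @in_L2_ek R d k.
have d00 : defect k 0 = 0.
  rewrite /defect /nrm (_ : sqnorm mu _ = 0) ?sqrtr0//.
  transitivity (sqnorm mu (fun=> 0)).
    apply: sqnorm_ae; [exact: in_L2_defect|exact: in_L2_0|].
    by have := group_zero hU le; apply: filterS => x ->; rewrite osc0 mulN1r subrr.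
  rewrite /sqnorm; under eq_Rintegral do rewrite normc_sqr/= expr0n addr0.
  by rewrite /Rintegral integral0.
have [->//|t0] := eqVneq t 0.
have defectMn n s : defect k (n%:R * s) <= n%:R * defect k s.
  elim: n => [|n IH]; first by rewrite !mul0r d00.
  rewrite -natr1 !mulrDl !mul1r; apply: (le_trans (defectD _ _ _)).
  by rewrite lerD2r.
apply/eqP; rewrite eq_le sqrtr_ge0 andbT; apply/ler_addgt0Pr => e e0; rewrite add0r.
have e1 : 0 < e / `|t| by rewrite divr_gt0// normr_gt0.
have := defect_small k e1; rewrite /dnbhs /within/= => /nbhs_ballP[r /= r0 Hr].
have t1 : 0 < `|t| by rewrite normr_gt0.
have [n nr] := @ltr_add_invr R 0 (r / `|t|) (divr_gt0 r0 t1).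
rewrite add0r in nr.
have n0 : n.+1%:R != 0 :> R by rewrite pnatr_eq0.
have -> : t = n.+1%:R * (t / n.+1%:R) by rewrite mulrC divfK.
apply: (le_trans (defectMn _ _)).
have : defect k (t / n.+1%:R) <= e / `|t| * `|t / n.+1%:R|.
  apply: Hr; last by rewrite mulf_neq0// invr_eq0.
  rewrite /ball/= sub0r normrN normrM [X in _ * X]ger0_norm ?invr_ge0//.
  by rewrite mulrC -ltr_pdivlMr// normr_gt0.
rewrite normrM (@ger0_norm _ n.+1%:R^-1) ?invr_ge0// mulrA divfK ?normr_eq0//.
by rewrite ler_pdivlMr ?ltr0n// mulrC.
Qed.

(** The adjoint transfers the group to the character, on which its action is known. *)
Lemma group_fourier t f k : in_L2 mu f ->
  inner mu (U t f) (ek k) = osc k t * inner mu f (ek k).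
Proof.
move=> lf; have le := @in_L2_ek R d k; have lU := group_L2 hU (- t) le.
rewrite group_adjoint//.
pose g x := U (- t) (ek k) x + (- osc k (- t)) * ek k x.
have lg : in_L2 mu g by exact: in_L2_defect.
have -> : inner mu f (U (- t) (ek k)) = inner mu f (fun x => g x + osc k (- t) * ek k x).
  by congr inner; apply/funext => x; rewrite /g mulNr subrK.
rewrite innerDr//; last exact: in_L2Z.
rewrite innerZr// conj_osc opprK.
have := normc_inner lf lg; rewrite [Num.sqrt (sqnorm _ g)]defect0 mulr0.
by rewrite le_eqVlt ltNge normc_ge0 orbF => /eqP/Normc.eq0_normc ->; rewrite add0r.
Qed.

End schrodinger_group.

(** * Parseval's identity *)

Lemma dominated_Rintegral0 d (T : measurableType d) (R : realType)
    (mu : {measure set T -> \bar R}) (f_ : nat -> T -> R) (g : T -> R) :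
  (forall n, measurable_fun setT (f_ n)) -> (forall x, f_ n x @[n --> \oo] --> (0 : R)) ->
  mu.-integrable setT (EFin \o g) -> (forall n x, `|f_ n x| <= g x) ->
  forall e, 0 < e -> exists N, forall n, (N <= n)%N -> `|\int[mu]_x f_ n x|%R <= e.
Proof.
move=> mf f0 ig fg e e0.
have : (\int[mu]_x (EFin \o f_ n) x)%E @[n --> \oo] --> (\int[mu]_x (cst 0) x)%E.
  have [] := @dominated_convergence _ _ _ mu setT measurableT (fun n => EFin \o f_ n) (cst 0%E) (EFin \o g) => //.
  - by move=> n; apply/measurable_EFinP.
  - by apply: nearW => x _; apply: cvg_EFin; [exact: nearW|exact: f0].
  - by apply: nearW => x n _ /=; rewrite lee_fin.
rewrite integral0 => /fine_cvgP[_ /cvgrPdist_le/(_ e e0)[N _ HN]].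
by exists N => n /HN /=; rewrite sub0r normrN.
Qed.

Section fourier_series.
Context {R : realType} {d : nat}.
Local Notation mu := (haar R d).
Implicit Types (k l : 'rV[int]_d) (f g : torus R d -> R[i]) (K : seq 'rV[int]_d).

(** An increasing family of finite sets exhausting Z^d, read off from its countable encoding. *)
Definition modes (N : nat) : seq 'rV[int]_d := pmap (@pickle_inv _) (iota 0 N).

Lemma modes_uniq N : uniq (modes N).
Proof. exact: (pmap_uniq (@pickle_invK _) (iota_uniq 0 N)). Qed.

Lemma mem_modes N k : (k \in modes N) = (pickle k < N)%N.
Proof.
rewrite mem_pmap; apply/mapP/idP => [[n]|kN].
  rewrite mem_iota add0n => /andP[_ nN] kn.
  by have := @pickle_invK 'rV[int]_d n; rewrite -kn /= => ->.
by exists (pickle k); rewrite ?mem_iota ?add0n// pickleK_inv.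
Qed.

Definition hat f k : R[i] := inner mu f (ek k).

Definition proj N f (x : torus R d) : R[i] := \sum_(k <- modes N) hat f k * ek k x.

Let nrm f := Num.sqrt (sqnorm mu f).

Let in_L2_comb K (b : 'rV[int]_d -> R[i]) :
  in_L2 mu (fun x => \sum_(k <- K) b k * ek k x).
Proof. by apply: in_L2_sum => k; apply: in_L2Z; exact: in_L2_ek. Qed.

Lemma hat_comb K (b : 'rV[int]_d -> R[i]) l : uniq K ->
  hat (fun x => \sum_(k <- K) b k * ek k x) l = if l \in K then b l else 0.
Proof.
move=> uK; rewrite /hat inner_suml; last 2 first.
- by move=> k; apply: in_L2Z; exact: in_L2_ek.
- exact: in_L2_ek.
under eq_bigr do rewrite (innerZl _ (in_L2_ek _) (in_L2_ek _)) inner_ek.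
case: ifPn => lK.
  rewrite (bigD1_seq l)//= eqxx mulr1 big1 ?addr0// => k kl.
  by rewrite (negbTE kl) mulr0.
rewrite big_seq big1// => k kK; case: eqP => [kl|_]; last by rewrite mulr0.
by rewrite -kl kK in lK.
Qed.

Lemma inner_comb K (b : 'rV[int]_d -> R[i]) f : in_L2 mu f ->
  inner mu f (fun x => \sum_(k <- K) b k * ek k x) = \sum_(k <- K) (b k)^*%C * hat f k.
Proof.
move=> lf; rewrite inner_sumr//; last by move=> k; apply: in_L2Z; exact: in_L2_ek.
by apply: eq_bigr => k _; rewrite innerZr//; exact: in_L2_ek.
Qed.

Lemma conj_mul_normc (z : R[i]) : z^*%C * z = (normc z ^+ 2)%:C%C.
Proof.
by rewrite normc_sqr; case: z => a b; apply/eqP; rewrite eq_complex/=; apply/andP; split;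
  apply/eqP; ring.
Qed.

Lemma sqnorm_comb K (b : 'rV[int]_d -> R[i]) : uniq K ->
  sqnorm mu (fun x => \sum_(k <- K) b k * ek k x) = mass K b.
Proof.
move=> uK; have := inner_self mu (fun x => \sum_(k <- K) b k * ek k x).
rewrite inner_comb//; set s := sqnorm _ _ => E.
have : \sum_(k <- K) (b k)^*%C * hat (fun x => \sum_(k0 <- K) b k0 * ek k0 x) k = (mass K b)%:C%C.
  rewrite /mass rmorph_sum/= big_seq [RHS]big_seq; apply: eq_bigr => k kK.
  by rewrite hat_comb// kK conj_mul_normc.
by rewrite E => -[].
Qed.

Lemma in_L2_proj N f : in_L2 mu (proj N f).
Proof. exact: in_L2_comb. Qed.

Lemma hatD f g k : in_L2 mu f -> in_L2 mu g -> hat (fun x => f x + g x) k = hat f k + hat g k.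
Proof. by move=> lf lg; rewrite /hat innerDl//; exact: in_L2_ek. Qed.

Lemma hatZ c f k : in_L2 mu f -> hat (fun x => c * f x) k = c * hat f k.
Proof. by move=> lf; rewrite /hat innerZl//; exact: in_L2_ek. Qed.

(** The difference is written as a sum with [(- 1) *] so that [in_L2D], [sqnormD] and their
    companions apply. *)
Definition tail N f := Num.sqrt (sqnorm mu (fun x => f x + (- 1) * proj N f x)).

Lemma in_L2_tail N f : in_L2 mu f -> in_L2 mu (fun x => f x + (- 1) * proj N f x).
Proof. by move=> lf; apply: in_L2D => //; apply: in_L2Z; exact: in_L2_proj. Qed.

Lemma tailD N f g : in_L2 mu f -> in_L2 mu g ->
  tail N (fun x => f x + g x) <= tail N f + tail N g.
Proof.
move=> lf lg; rewrite /tail.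
have -> : (fun x => f x + g x + -1 * proj N (fun x => f x + g x) x) =
    (fun x => (f x + (-1) * proj N f x) + (g x + (-1) * proj N g x)).
  apply/funext => x; rewrite addrACA -mulrDr /proj -big_split/=; congr (_ + _ * _).
  by apply: eq_bigr => k _; rewrite hatD// mulrDl.
exact: (sqrt_sqnormD (in_L2_tail N lf) (in_L2_tail N lg)).
Qed.

Lemma tailZ N c f : in_L2 mu f -> tail N (fun x => c * f x) = normc c * tail N f.
Proof.
move=> lf; rewrite /tail.
have -> : (fun x => c * f x + -1 * proj N (fun x => c * f x) x) =
    (fun x => c * (f x + (-1) * proj N f x)).
  apply/funext => x; rewrite mulrDr mulrCA; congr (_ + _ * _).
  by rewrite /proj mulr_sumr; apply: eq_bigr => k _; rewrite hatZ// mulrA.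
rewrite sqnormZ; last exact: in_L2_tail.
by rewrite sqrtrM ?sqr_ge0// sqrtr_sqr ger0_norm ?normc_ge0.
Qed.

Lemma tail_sqr N f : in_L2 mu f -> tail N f ^+ 2 = sqnorm mu f - mass (modes N) (hat f).
Proof.
move=> lf; rewrite /tail sqr_sqrtr ?sqnorm_ge0// sqnormD//; last by apply: in_L2Z; exact: in_L2_proj.
have lp := in_L2_proj N f.
rewrite sqnormZ// innerZr// sqnorm_comb ?modes_uniq// inner_comb//.
have -> : \sum_(k <- modes N) (hat f k)^*%C * hat f k = (mass (modes N) (hat f))%:C%C.
  by rewrite /mass rmorph_sum; apply: eq_bigr => k _; exact: conj_mul_normc.
by rewrite normc_sqr/=; ring.
Qed.

Lemma bessel N f : in_L2 mu f -> mass (modes N) (hat f) <= sqnorm mu f.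
Proof. by move=> lf; rewrite -subr_ge0 -tail_sqr// sqr_ge0. Qed.

Lemma tail_ge0 N f : 0 <= tail N f. Proof. exact: sqrtr_ge0. Qed.

Lemma tail_le N f : in_L2 mu f -> tail N f <= nrm f.
Proof.
move=> lf; rewrite -[leLHS]ger0_norm ?tail_ge0// -sqrtr_sqr ler_wsqrtr// tail_sqr//.
by rewrite lerBlDr lerDl mass_ge0.
Qed.

(** Completeness of the characters. The class of such f is linear and closed in L^2; it is enlarged
    step by step, from characters to continuous functions, indicator functions, and finally all of
    L^2. *)
Definition tail_vanishes f := forall e, 0 < e -> exists N0, forall N, (N0 <= N)%N -> tail N f <= e.

Let vanishesD f g : in_L2 mu f -> in_L2 mu g -> tail_vanishes f -> tail_vanishes g ->
  tail_vanishes (fun x => f x + g x).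
Proof.
move=> lf lg vf vg e e0; have e2 : 0 < e / 2 by rewrite divr_gt0.
have [N1 H1] := vf _ e2; have [N2 H2] := vg _ e2; exists (maxn N1 N2) => N.
rewrite geq_max => /andP[n1 n2]; apply: (le_trans (tailD N lf lg)).
by rewrite (splitr e) lerD// ?H1// H2.
Qed.

Let vanishesZ c f : in_L2 mu f -> tail_vanishes f -> tail_vanishes (fun x => c * f x).
Proof.
move=> lf vf e e0.
have c0 : 0 < normc c + 1 by rewrite ltr_wpDl// normc_ge0.
have [N0 H] := vf (e / (normc c + 1)) (divr_gt0 e0 c0).
exists N0.
move=> N N0N.
have h := H N N0N.
rewrite (ler_pdivlMr _ _ c0) in h.
rewrite (tailZ N c lf).
apply: le_trans h.
rewrite mulrC.
apply: ler_wpM2l.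
exact: tail_ge0.
by rewrite lerDl.
Qed.

(** The tail is subadditive and bounded by the norm, uniformly in N. *)
Let vanishes_approx f : in_L2 mu f ->
  (forall e, 0 < e -> exists g, [/\ in_L2 mu g, tail_vanishes g &
    nrm (fun x => f x + (- 1) * g x) <= e]) -> tail_vanishes f.
Proof.
move=> lf H e e0; have e2 : 0 < e / 2 by rewrite divr_gt0.
have [g [lg vg fg]] := H _ e2; have [N0 HN] := vg _ e2; exists N0 => N /HN tg.
have lfg : in_L2 mu (fun x => f x + (- 1) * g x) by apply: in_L2D => //; exact: in_L2Z.
have := tailD N lfg lg.
rewrite (_ : (fun x => f x + -1 * g x + g x) = f); last first.
  by apply/funext => x; rewrite mulN1r subrK.
move=> /le_trans; apply; rewrite (splitr e); apply: lerD; last exact: tg.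
exact: le_trans (tail_le N lfg) fg.
Qed.

Let vanishes_ek k : tail_vanishes (ek k).
Proof.
move=> e e0; exists (pickle k).+1 => N kN; rewrite /tail.
rewrite (_ : (fun x => _) = (fun=> 0)).
  rewrite /sqnorm; under eq_Rintegral do rewrite normc_sqr/= expr0n addr0.
  by rewrite /Rintegral integral0 sqrtr0 ltW.
apply/funext => x; rewrite mulN1r; apply/eqP; rewrite subr_eq0 eq_sym; apply/eqP.
rewrite /proj (bigD1_seq k) ?modes_uniq ?mem_modes//= big1 ?addr0.
  by rewrite /hat inner_ek eqxx mul1r.
by move=> l lk; rewrite /hat inner_ek eq_sym (negbTE lk) mul0r.
Qed.

Let vanishes_sum (I : Type) (r : seq I) (F : I -> torus R d -> R[i]) :
  (forall i, in_L2 mu (F i)) -> (forall i, tail_vanishes (F i)) ->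
  tail_vanishes (fun x => \sum_(i <- r) F i x).
Proof.
move=> lF vF; elim: r => [|i r IH].
  rewrite (_ : (fun x => _) = (fun x => 0 * ek 0 x)); last first.
    by apply/funext => x; rewrite big_nil mul0r.
  by apply: vanishesZ; [exact: in_L2_ek|exact: vanishes_ek].
rewrite (_ : (fun x => _) = (fun x => F i x + \sum_(j <- r) F j x)); last first.
  by apply/funext => x; rewrite big_cons.
apply: vanishesD; [exact: lF|exact: in_L2_sum|exact: vF|exact: IH].
Qed.

Let bounded_L2 (u : torus R d -> R) : bmeas u -> in_L2 mu (fun x => (u x)%:C%C).
Proof.
move=> bu; apply/in_L2P; split.
  by split; [exact: bu.1|exact: measurable_cst].
apply: bmeas_integrable; first exact: probability_lty.
under eq_fun do rewrite normc_sqr/= expr0n addr0 expr2.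
exact: bmeasM.
Qed.

Let nrm_bound (u : torus R d -> R) (e : R) : bmeas u -> 0 <= e -> (forall x, `|u x| <= e) ->
  nrm (fun x => (u x)%:C%C) <= e.
Proof.
move=> bu e0 ue; rewrite /nrm -[leRHS](ger0_norm e0) -[leRHS]sqrtr_sqr ler_wsqrtr//.
rewrite /sqnorm; under eq_Rintegral do rewrite normc_sqr/= expr0n addr0.
have -> : e ^+ 2 = (\int[mu]_x (e ^+ 2))%R.
  rewrite Rintegral_cst//; transitivity (e ^+ 2 * fine (1%E : \bar R)); first by rewrite mulr1.
  by congr (_ * fine _); apply/esym; exact: probability_setT.
apply: le_Rintegral_bmeas; first exact: probability_lty.
- by under eq_fun do rewrite expr2; exact: bmeasM.
- exact: bmeas_cst.
by move=> x; rewrite -real_normK ?num_real// lerXn2r// ?nnegrE.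
Qed.

Let vanishes_cos a k : tail_vanishes (fun x => (cos (a + phase k (repr x)))%:C%C).
Proof.
pose A : R[i] := (cos a / 2 +i* (sin a / 2))%C.
pose B : R[i] := (cos a / 2 -i* (sin a / 2))%C.
rewrite (_ : (fun x => _) = (fun x => A * ek k x + B * ek (- k) x)).
  by apply: vanishesD; [apply: in_L2Z; exact: in_L2_ek|apply: in_L2Z; exact: in_L2_ek|
    apply: vanishesZ; [exact: in_L2_ek|exact: vanishes_ek]|
    apply: vanishesZ; [exact: in_L2_ek|exact: vanishes_ek]].
apply/funext => x; rewrite /ek phaseN ![- (pi / 2) + _]addrC !cosBpihalf !add0r cosN sinN cosD.
by apply/eqP; rewrite eq_complex/=; apply/andP; split; apply/eqP; field.
Qed.

Let vanishes_continuous (g : torus R d -> R) : continuous g ->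
  tail_vanishes (fun x => (g x)%:C%C).
Proof.
move=> cg.
have [M HM] : exists M, forall x, `|g x| <= M.
  have : compact (g @` setT).
    by apply: continuous_compact; [exact: continuous_subspaceT|exact: torus_compact].
  move=> /(@compact_bounded R R^o)[M [_ HM]]; exists (M + 1) => x.
  by apply: (HM (M + 1)); [rewrite ltrDl|exists x].
have bg : bmeas g by split; [exact: measurable_continuous_torus|exists M].
apply: vanishes_approx; first exact: bounded_L2.
move=> e e0.
(* A function of x alone is approximated on a strip of width 1, and the approximating polynomial is
   then frozen at time 0. *)
have [||s Hs] := @trig_dense R d 1 (fun p => g p.2) ltr01 _ _ _ e0 => //.
  by move=> p; apply: continuous_comp; [exact: cvg_snd|exact: cg].
pose h x := trig 1 s (0, x).
have hE x : h x = \sum_(q <- s) q.1.1.1 * cos (q.1.1.2 + phase q.2 (repr x)).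
  by apply: eq_bigr => q _; rewrite /mono/= mulr0 addr0.
have bcos (q : R * R * int * 'rV[int]_d) :
    bmeas (fun x : torus R d => q.1.1.1 * cos (q.1.1.2 + phase q.2 (repr x))).
  by apply: bmeasZ; split; [exact: measurable_cos_phase|exists 1 => x; exact: cos_max].
have bh : bmeas h.
  have := bmeas_sum s bcos; congr bmeas.
  by apply/funext => x; apply/esym; exact: hE.
exists (fun x => (h x)%:C%C); split; first exact: bounded_L2.
  rewrite (_ : (fun x => _) = (fun x => \sum_(q <- s)
      (q.1.1.1)%:C%C * (cos (q.1.1.2 + phase q.2 (repr x)))%:C%C)); last first.
    by apply/funext => x; rewrite hE rmorph_sum/=; apply: eq_bigr => q _; rewrite rmorphM.
  have lcos (q : R * R * int * 'rV[int]_d) :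
      in_L2 mu (fun x => (cos (q.1.1.2 + phase q.2 (repr x)))%:C%C).
    by apply: bounded_L2; split; [exact: measurable_cos_phase|exists 1 => x; exact: cos_max].
  by apply: vanishes_sum => q; [exact: in_L2Z|apply: vanishesZ].
rewrite (_ : (fun x => _) = (fun x => (g x - h x)%:C%C)); last first.
  by apply/funext => x; rewrite mulN1r rmorphB.
apply: nrm_bound; [exact: bmeasB|exact: ltW|].
by move=> x; apply: (Hs (0, x)); rewrite /= lexx ler01.
Qed.

Let nrm_le f (e : R) : 0 <= e -> sqnorm mu f <= e ^+ 2 -> nrm f <= e.
Proof.
by move=> e0 fe; rewrite /nrm -[leRHS](ger0_norm e0) -sqrtr_sqr ler_wsqrtr.
Qed.

Let sqnorm_real (u : torus R d -> R) :
  sqnorm mu (fun x => (u x)%:C%C) = (\int[mu]_x (u x ^+ 2))%R.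
Proof. by apply: eq_Rintegral => x _; rewrite normc_sqr/= expr0n addr0. Qed.

Let subC (u v : torus R d -> R) :
  (fun x => (u x)%:C%C + -1 * (v x)%:C%C) = (fun x => (u x - v x)%:C%C).
Proof. by apply/funext => x; rewrite mulN1r rmorphB. Qed.

Let bmeas_indic (B : set (torus R d)) : measurable B -> bmeas (\1_B : torus R d -> R).
Proof.
move=> mB; split; first exact: measurable_indic.
by exists 1 => x; rewrite indicE; case: (_ \in _); rewrite ?normr1 ?normr0.
Qed.

Let measurable_closed (F : set (torus R d)) : closed F -> measurable F.
Proof.
move=> cF; rewrite -(setCK F); apply: measurableC; apply: sub_sigma_algebra.
exact: closed_openC.
Qed.

Let vanishes_closed (F : set (torus R d)) : closed F ->
  tail_vanishes (fun x => (\1_F x : R)%:C%C).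
Proof.
move=> cF; have [F0|/set0P/negP/negPn/eqP ->] := pselect (F !=set0); last first.
  rewrite indic0; apply: vanishes_continuous; exact: cst_continuous.
have kF : compact F by apply: (subclosed_compact cF torus_compact).
have [g [cg g0 gF]] := distance_torus kF F0.
pose h := plateau g.
have ch n : continuous (h n) by exact: continuous_plateau.
have bh n : bmeas (h n).
  split; first exact: measurable_continuous_torus.
  by exists 1 => x; have /andP[? ?] := plateau01 g0 n x; rewrite ger0_norm.
apply: vanishes_approx; first by apply/bounded_L2/bmeas_indic; exact: measurable_closed.
move=> e e0.
have e2 : 0 < e ^+ 2 by rewrite exprn_gt0.
have [||||N HN] := @dominated_Rintegral0 _ _ _ mu (fun n x => (\1_F x - h n x) ^+ 2) (fun=> 1) _ _ _ _ _ e2.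
- move=> n; apply: measurable_funX; apply: measurable_funB; last exact: (bh n).1.
  by apply: measurable_indic; exact: measurable_closed.
- move=> x; under eq_cvg do rewrite -sqrrN opprB expr2.
  have c := cvg_plateau g0 gF x.
  by have := cvgM c c; rewrite mulr0; apply.
- by apply: bmeas_integrable; [exact: probability_lty|exact: bmeas_cst].
- move=> n x; rewrite ger0_norm ?sqr_ge0// -real_normK ?num_real// expr_le1//.
  by rewrite distrC; exact: plateau_indic.
exists (fun x => (h N x)%:C%C); split.
- exact: bounded_L2.
- exact: vanishes_continuous.
rewrite subC; apply: nrm_le; first exact: ltW.
rewrite sqnorm_real; apply: le_trans (HN N (leqnn _)); exact: ler_norm.
Qed.

Let vanishes_indic (B : set (torus R d)) : measurable B ->
  tail_vanishes (fun x => (\1_B x : R)%:C%C).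
Proof.
move=> mB; apply: vanishes_approx; first by apply/bounded_L2/bmeas_indic.
move=> e e0; have e2 : 0 < e ^+ 2 by rewrite exprn_gt0.
have [_ iB _] := haar_regular mB; have [F [cF FB hF]] := iB _ e2.
have mF := measurable_closed cF.
exists (fun x => (\1_F x : R)%:C%C); split.
- by apply/bounded_L2/bmeas_indic.
- exact: vanishes_closed.
rewrite subC; apply: nrm_le; first exact: ltW.
(* As F is contained in B, the square of 1_B - 1_F is the indicator function of B \ F. *)
rewrite sqnorm_real (_ : (\int[mu]_x _)%R = fine (mu (B `\` F))).
  rewrite -lee_fin fineK//; apply: fin_num_measure; exact: measurableD.
rewrite /Rintegral; congr fine.
rewrite -(setIT (B `\` F)) -integral_indic//; last exact: measurableD.
apply: eq_integral => x _; congr (_%:E); rewrite !indicE in_setD.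
have [xF|xF] := boolP (x \in F); last by case: (x \in B); rewrite ?subr0 ?expr0n ?expr1n.
by rewrite (mem_set (FB _ (set_mem xF))) subrr expr0n.
Qed.

Import HBNNSimple.

Let in_L2_real (v : torus R d -> R) : measurable_fun setT v ->
  mu.-integrable setT (EFin \o (fun x => v x ^+ 2)) -> in_L2 mu (fun x => (v x)%:C%C).
Proof.
move=> mv iv; apply/in_L2P; split; first by split => //; exact: measurable_cst.
by move: iv; congr (_.-integrable _ _); apply/funext => x; rewrite /comp normc_sqr/= expr0n addr0.
Qed.

Let vanishes_nonneg (u : torus R d -> R) : measurable_fun setT u -> (forall x, 0 <= u x) ->
  mu.-integrable setT (EFin \o (fun x => u x ^+ 2)) -> tail_vanishes (fun x => (u x)%:C%C).
Proof.
move=> mu_ u0 iu.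
apply: vanishes_approx => [|e e0]; first exact: in_L2_real.
have e2 : 0 < e ^+ 2 by rewrite exprn_gt0.
have mEu : measurable_fun setT (EFin \o u) by apply/measurable_EFinP.
pose s := nnsfun_approx measurableT mEu.
have s0 n x : 0 <= s n x by exact: fun_ge0.
have su x : s n x @[n --> \oo] --> u x.
  have := @cvg_nnsfun_approx _ _ _ _ measurableT _ mEu (fun x _ => u0 x) x I.
  by move=> /fine_cvgP[].
have sle n x : s n x <= u x.
  have nd : nondecreasing_seq (fun n => s n x).
    by move=> i j ij; have /lefP := @nd_nnsfun_approx _ _ _ _ measurableT _ mEu i j ij; apply.
  have cv : cvgn (fun n => s n x) by apply/cvg_ex; exists (u x); exact: su.
  have := nondecreasing_cvgn_le nd cv n.
  by rewrite (cvg_lim _ (su x)).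
have [||||N HN] := @dominated_Rintegral0 _ _ _ mu (fun n x => (u x - s n x) ^+ 2) (fun x => u x ^+ 2) _ _ _ _ _ e2.
- by move=> n; apply: measurable_funX; apply: measurable_funB.
- move=> x; rewrite (_ : 0 = (u x - u x) ^+ 2 :> R); last by rewrite subrr expr0n.
  under eq_cvg do rewrite expr2.
  by rewrite expr2; apply: cvgM; apply: cvgB => //; exact: cvg_cst.
- by [].
- move=> n x; rewrite ger0_norm ?sqr_ge0// lerXn2r ?nnegrE ?subr_ge0//.
  by rewrite lerBlDr lerDl.
have bs : bmeas (s N : torus R d -> R).
  split => //; have [M [_ HM]] := simple_bounded (s N).
  by exists (M + 1) => x; apply: (HM (M + 1)); rewrite ?ltrDl.
exists (fun x => (s N x)%:C%C); split.
- exact: bounded_L2.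
- have [n [c [B [mB sE]]]] : exists n (c : nat -> R) (B : nat -> set (torus R d)),
      (forall i, measurable (B i)) /\ forall x, s N x = \sum_(i < n) c i * \1_(B i) x.
    pose S := fset_set (s N @` setT).
    exists (size (finmap.enum_fset S)), (fun i => nth 0 (finmap.enum_fset S) i),
      (fun i => s N @^-1` [set nth 0 (finmap.enum_fset S) i]); split.
      by move=> i; exact: measurable_sfunP.
    by move=> x; exact: fimfunEord.
  rewrite (_ : (fun x => _) = (fun x => \sum_(i < n) (c i)%:C%C * (\1_(B i) x : R)%:C%C)); last first.
    by apply/funext => x; rewrite sE rmorph_sum/=; apply: eq_bigr => i _; rewrite rmorphM.
  apply: vanishes_sum => i.
    by apply: in_L2Z; apply/bounded_L2/bmeas_indic.
  apply: vanishesZ; last exact: vanishes_indic.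
  by apply/bounded_L2/bmeas_indic.
rewrite subC; apply: nrm_le; first exact: ltW.
rewrite sqnorm_real; apply: le_trans (HN N (leqnn _)); exact: ler_norm.
Qed.

Let vanishes_real (u : torus R d -> R) : measurable_fun setT u ->
  mu.-integrable setT (EFin \o (fun x => u x ^+ 2)) -> tail_vanishes (fun x => (u x)%:C%C).
Proof.
move=> mu_ iu.
have part (v : torus R d -> R) : measurable_fun setT v -> (forall x, `|v x| <= `|u x|) ->
    mu.-integrable setT (EFin \o (fun x => v x ^+ 2)).
  move=> mv vu; apply: (le_integrable measurableT _ _ iu).
    by apply/measurable_EFinP; exact: measurable_funX.
  move=> x _ /=; rewrite lee_fin !ger0_norm ?sqr_ge0//.
  by rewrite -[leLHS]real_normK ?num_real// -[leRHS]real_normK ?num_real// lerXn2r ?nnegrE.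
pose p x := Num.max (u x) 0; pose q x := Num.max (- u x) 0.
have mp : measurable_fun setT p by apply: measurable_maxr => //; exact: measurable_cst.
have mq : measurable_fun setT q.
  by apply: measurable_maxr; [exact: measurable_funN|exact: measurable_cst].
have p0 x : 0 <= p x by rewrite le_max lexx orbT.
have q0 x : 0 <= q x by rewrite le_max lexx orbT.
have pu x : `|p x| <= `|u x|.
  by rewrite ger0_norm// ge_max ler_norm normr_ge0.
have qu x : `|q x| <= `|u x|.
  by rewrite ger0_norm// ge_max normr_ge0 -normrN ler_norm.
rewrite (_ : (fun x => _) = (fun x => (p x)%:C%C + (-1) * (q x)%:C%C)).
  have ip := part p mp pu; have iq := part q mq qu.
  apply: vanishesD; [exact: in_L2_real|by apply: in_L2Z; exact: in_L2_real| |].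
    exact: vanishes_nonneg.
  by apply: vanishesZ; [exact: in_L2_real|exact: vanishes_nonneg].
rewrite subC; apply/funext => x; congr (_%:C)%C; rewrite /p /q.
have [u0|] := boolP (0 <= u x).
  by rewrite (max_idPl u0) (max_idPr _) ?subr0// oppr_le0.
by rewrite -ltNge => u0; rewrite (max_idPr (ltW u0)) (max_idPl _) ?sub0r ?opprK// oppr_ge0 ltW.
Qed.

Theorem parseval f : in_L2 mu f -> tail_vanishes f.
Proof.
move=> lf; have /in_L2P[[m1 m2] fi] := lf.
have part (v : torus R d -> R) : measurable_fun setT v ->
    (forall x, v x ^+ 2 <= normc (f x) ^+ 2) ->
    mu.-integrable setT (EFin \o (fun x => v x ^+ 2)).
  move=> mv vf; apply: (le_integrable measurableT _ _ fi).
    by apply/measurable_EFinP; exact: measurable_funX.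
  by move=> x _; rewrite /comp/= lee_fin !ger0_norm ?sqr_ge0//; exact: vf.
have i1 : mu.-integrable setT (EFin \o (fun x => Re (f x) ^+ 2)).
  by apply: part => // x; rewrite normc_sqr lerDl sqr_ge0.
have i2 : mu.-integrable setT (EFin \o (fun x => Im (f x) ^+ 2)).
  by apply: part => // x; rewrite normc_sqr lerDr sqr_ge0.
rewrite (_ : f = (fun x => (Re (f x))%:C%C + 'i%C * (Im (f x))%:C%C)).
  apply: vanishesD; [exact: in_L2_real|by apply: in_L2Z; exact: in_L2_real|exact: vanishes_real|].
  by apply: vanishesZ; [exact: in_L2_real|exact: vanishes_real].
apply/funext => x; case: (f x) => a b; apply/eqP; rewrite eq_complex/=.
by apply/andP; split; apply/eqP; ring.
Qed.

Corollary parseval_sqr f e : in_L2 mu f -> 0 < e ->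
  exists N0, forall N, (N0 <= N)%N -> tail N f ^+ 2 <= e.
Proof.
move=> lf e0; have s0 : 0 < Num.sqrt e by rewrite sqrtr_gt0.
have [N0 H] := parseval lf s0; exists N0 => N /H tN.
by rewrite -[leRHS](sqr_sqrtr (ltW e0)) lerXn2r ?nnegrE ?tail_ge0 ?(ltW s0).
Qed.

End fourier_series.

Section parametric_integrals.
Context {d1 d2 : measure_display} {T1 : measurableType d1} {T2 : measurableType d2}.
Context {R : realType}.
Variable m2 : {sigma_finite_measure set T2 -> \bar R}.

(** Tonelli's theorem is applied to the positive and negative parts separately, so no sign or
    integrability of F enters. *)
Lemma measurable_parametric_integral (F : T1 * T2 -> \bar R) : measurable_fun setT F ->
  measurable_fun setT (fun x => \int[m2]_y F (x, y))%E.
Proof.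
move=> mF; under eq_fun do rewrite integralE.
apply: emeasurable_funB.
  rewrite (_ : (fun x => _) = (fubini_F m2 F^\+%E)).
    by apply: measurable_fun_fubini_tonelli_F => //; exact: measurable_funepos.
  by apply/funext => x; apply: eq_integral => y _; rewrite funepos_comp.
rewrite (_ : (fun x => _) = (fubini_F m2 F^\-%E)).
  by apply: measurable_fun_fubini_tonelli_F => //; exact: measurable_funeneg.
by apply/funext => x; apply: eq_integral => y _; rewrite funeneg_comp.
Qed.

Lemma measurable_parametric_Rintegral (F : T1 * T2 -> R) : measurable_fun setT F ->
  measurable_fun setT (fun x => \int[m2]_y F (x, y))%R.
Proof.
move=> mF; rewrite /Rintegral.
apply: (measurableT_comp (f := fine)) => //.
apply: (@measurable_parametric_integral (EFin \o F)).
exact/measurable_EFinP.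
Qed.

End parametric_integrals.

(** * Cauchy-Schwarz inequality with a weight *)

Section weighted_cauchy_schwarz.
Context {disp : measure_display} {T : measurableType disp} {R : realType}.
Variable mu : {measure set T -> \bar R}.
Variables (w : T -> R).
Hypothesis w_gt0 : forall x, 0 < w x.
Hypothesis mw : measurable_fun setT w.
Hypothesis iw : mu.-integrable setT (EFin \o w).
Hypothesis W_gt0 : 0 < (\int[mu]_x w x)%R.

Let measurable_div (v : T -> R) : measurable_fun setT v ->
  measurable_fun setT (fun x => v x ^+ 2 / w x).
Proof.
move=> mv; apply: measurable_funM; first exact: measurable_funX.
rewrite (_ : (fun x => _) = (fun x => (w x) `^ (-1))).
  by apply: (measurableT_comp (measurable_powR _)).
by apply/funext => x; rewrite powR_inv1// ltW.
Qed.

Let integrable_by_w (v : T -> R) (B : R) : measurable_fun setT v ->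
  (forall x, `|v x| <= B * w x) -> mu.-integrable setT (EFin \o v).
Proof.
move=> mv vB; have iBw := integrableZl measurableT B iw.
apply: (le_integrable measurableT _ _ iBw); first exact/measurable_EFinP.
move=> x _ /=; rewrite lee_fin; apply: le_trans (vB x) _.
by rewrite ler_norm.
Qed.

Let square_bound (v : T -> R) (B : R) x : `|v x| <= B * w x ->
  `|v x ^+ 2 / w x| <= B ^+ 2 * w x.
Proof.
move=> vB; have wx := w_gt0 x.
rewrite ger0_norm; last by rewrite divr_ge0 ?sqr_ge0// ltW.
rewrite ler_pdivrMr// -real_normK ?num_real// (_ : _ * w x * w x = (B * w x) ^+ 2); last by ring.
by rewrite lerXn2r ?nnegrE// (le_trans _ vB).
Qed.

(** The integral of (v - r w)^2 / w is nonnegative; expand it with r the ratio of the integrals of v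
    and w. The bound by B w makes all the terms integrable. *)
Lemma weighted_cs (v : T -> R) (B : R) : measurable_fun setT v ->
  (forall x, `|v x| <= B * w x) ->
  ((\int[mu]_x v x) ^+ 2 <= (\int[mu]_x w x) * \int[mu]_x (v x ^+ 2 / w x))%R.
Proof.
move=> mv vB.
have iv := integrable_by_w mv vB.
have iv2 : mu.-integrable setT (EFin \o (fun x => v x ^+ 2 / w x)).
  by apply: (@integrable_by_w _ (B ^+ 2)); [exact: measurable_div|move=> x; exact: square_bound].
have W0 := W_gt0.
set I := (\int[mu]_x v x)%R; set W := (\int[mu]_x w x)%R in W0 *; set V := (\int[mu]_x _)%R.
pose r := I / W.
have : 0 <= (\int[mu]_x ((1 * (v x ^+ 2 / w x) + (- 2 * r) * v x) + r ^+ 2 * w x))%R.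
  apply: Rintegral_ge0 => x _.
  rewrite (_ : _ + _ = (v x - r * w x) ^+ 2 / w x).
    by rewrite divr_ge0 ?sqr_ge0// ltW.
  by field; exact: (lt0r_neq0 (w_gt0 x)).
have i1 : mu.-integrable setT (EFin \o (fun x => 1 * (v x ^+ 2 / w x))).
  by have := integrableZl measurableT 1 iv2; congr (_.-integrable _ _).
have i2 : mu.-integrable setT (EFin \o (fun x => -2 * r * v x)).
  by have := integrableZl measurableT (-2 * r) iv; congr (_.-integrable _ _).
have i12 : mu.-integrable setT (EFin \o (fun x => 1 * (v x ^+ 2 / w x) + -2 * r * v x)).
  by have := integrableD measurableT i1 i2; congr (_.-integrable _ _).
have i3 : mu.-integrable setT (EFin \o (fun x => r ^+ 2 * w x)).
  by have := integrableZl measurableT (r ^+ 2) iw; congr (_.-integrable _ _).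
rewrite RintegralD// RintegralD// !RintegralZl// -/I -/W -/V.
rewrite (_ : 1 * V + _ + _ = (W * V - I ^+ 2) / W); last first.
  by rewrite /r; field; exact: lt0r_neq0.
by rewrite pmulr_lge0 ?invr_gt0// subr_ge0.
Qed.

Lemma weighted_cs_complex (Z : T -> R[i]) (B : R) : cmeasurable Z ->
  (forall x, normc (Z x) <= B * w x) ->
  normc (Cintegral mu Z) ^+ 2 <=
    (\int[mu]_x w x)%R * (\int[mu]_x (normc (Z x) ^+ 2 / w x))%R.
Proof.
move=> [m1 m2] ZB.
have b1 x : `|Re (Z x)| <= B * w x.
  apply: le_trans (ZB x); case: (Z x) => a b /=.
  by rewrite -sqrtr_sqr ler_wsqrtr// lerDl sqr_ge0.
have b2 x : `|Im (Z x)| <= B * w x.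
  apply: le_trans (ZB x); case: (Z x) => a b /=.
  by rewrite -sqrtr_sqr ler_wsqrtr// lerDr sqr_ge0.
have h1 := weighted_cs m1 b1; have h2 := weighted_cs m2 b2.
have i1 : mu.-integrable setT (EFin \o (fun x => Re (Z x) ^+ 2 / w x)).
  apply: (@integrable_by_w _ (B ^+ 2)); first exact: (measurable_div m1).
  by move=> x; exact: (@square_bound (fun x => Re (Z x)) B x (b1 x)).
have i2 : mu.-integrable setT (EFin \o (fun x => Im (Z x) ^+ 2 / w x)).
  apply: (@integrable_by_w _ (B ^+ 2)); first exact: (measurable_div m2).
  by move=> x; exact: (@square_bound (fun x => Im (Z x)) B x (b2 x)).
rewrite normc_sqr/=; apply: le_trans (lerD h1 h2) _.
rewrite -mulrDr; apply: ler_wpM2l; first exact: ltW.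
rewrite -RintegralD// le_eqVlt; apply/orP; left; apply/eqP; apply: eq_Rintegral => x _.
by rewrite normc_sqr mulrDl.
Qed.

End weighted_cauchy_schwarz.

(** * Solutions of the forced equation *)

Lemma normc_leD (R : realType) (z w : R[i]) :
  normc (z + w) <= normc z + normc w.
Proof. exact: (@le_normcD R z w). Qed.

Lemma normc_invi (R : realType) : normc ('i%C^-1 : R[i]) = 1.
Proof. by rewrite /= expr0n expr1n/= add0r mul0r divr1 expr0n add0r sqrrN expr1n sqrtr1. Qed.

(** Rotating by the conjugate of the integral reduces the claim to real parts. *)
Lemma normc_Cintegral disp (X : measurableType disp) (R : realType)
    (m : {measure set X -> \bar R}) (Z : X -> R[i]) (v : X -> R) :
  cmeasurable Z -> m.-integrable setT (EFin \o v) ->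
  (forall x, normc (Z x) <= v x) ->
  normc (Cintegral m Z) <= (\int[m]_x v x)%R.
Proof.
move=> mZ iv Zv; have iZ := Cint_dom mZ Zv iv.
set I := Cintegral m Z; have [->|I0] := eqVneq (normc I) 0.
  by apply: Rintegral_ge0 => x _; apply: le_trans (Zv x); exact: normc_ge0.
have Ip : 0 < normc I by rewrite lt0r I0 normc_ge0.
rewrite -(ler_pM2l Ip) -expr2.
have -> : normc I ^+ 2 = Re (Cintegral m (fun x => I^*%C * Z x)).
  by rewrite CintegralZ// conj_mul_normc.
rewrite /Cintegral/= -RintegralZl//.
apply: le_Rintegral => //.
- have [h _] := CintZ (I^*%C) iZ; exact: h.
- by have := integrableZl measurableT (normc I) iv; congr (_.-integrable _ _).
move=> x _; rewrite (le_trans (y := normc (I^*%C * Z x)))//.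
  by case: (_ * _) => a b /=; rewrite (le_trans (ler_norm _))// -sqrtr_sqr ler_wsqrtr// lerDl sqr_ge0.
by rewrite normcM normc_conj ler_wpM2l// ltW.
Qed.

Lemma mass_cauchy_schwarz (R : realType) d (K : seq 'rV[int]_d) (a b : 'rV[int]_d -> R[i]) :
  uniq K -> normc (\sum_(k <- K) (b k)^*%C * a k) <=
    Num.sqrt (mass K a) * Num.sqrt (mass K b).
Proof.
move=> uK; have L2c (c : 'rV[int]_d -> R[i]) :
    in_L2 (haar R d) (fun x => \sum_(k <- K) c k * ek k x).
  by apply: in_L2_sum => k; apply: in_L2Z; exact: in_L2_ek.
have := normc_inner (L2c a) (L2c b); rewrite !sqnorm_comb// inner_comb//.
rewrite big_seq; under eq_bigr => k kK do rewrite hat_comb// kK.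
by rewrite -big_seq.
Qed.

Lemma mass_sqr_sum (R : realType) d (K : seq 'rV[int]_d) (c : 'rV[int]_d -> R[i]) :
  \sum_(k <- K) (c k)^*%C * c k = (mass K c)%:C%C.
Proof. by rewrite /mass rmorph_sum/=; apply: eq_bigr => k _; exact: conj_mul_normc. Qed.

Lemma le_mass (R : realType) d (K : seq 'rV[int]_d) (a b : 'rV[int]_d -> R[i]) :
  (forall k, normc (a k) <= normc (b k)) -> mass K a <= mass K b.
Proof. by move=> ab; apply: ler_sum => k _; rewrite lerXn2r// nnegrE normc_ge0. Qed.

Section complex_measurability.
Context {disp disp' : measure_display} {X : measurableType disp} {Y : measurableType disp'}.
Context {R : realType}.

Lemma cmeasurable_sum (I : Type) (r : seq I) (F : I -> X -> R[i]) :
  (forall i, cmeasurable (F i)) -> cmeasurable (fun x => \sum_(i <- r) F i x).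
Proof.
move=> mF; elim: r => [|i r IH].
  by under eq_fun do rewrite big_nil; exact: cmeasurable_cst.
by under eq_fun do rewrite big_cons; exact: cmeasurableD.
Qed.

Lemma cmeasurable_comp (g : Y -> R[i]) (h : X -> Y) :
  measurable_fun setT h -> cmeasurable g -> cmeasurable (fun x => g (h x)).
Proof. by move=> mh [m1 m2]; split; [exact: (measurableT_comp m1 mh)|exact: (measurableT_comp m2 mh)]. Qed.

Lemma normc_sqrD (z w : R[i]) :
  normc (z + w) ^+ 2 <= 2 * normc z ^+ 2 + 2 * normc w ^+ 2.
Proof.
have h := normc_leD z w.
apply: le_trans (_ : (normc z + normc w) ^+ 2 <= _).
  by rewrite lerXn2r// nnegrE ?addr_ge0 ?normc_ge0.
have := sqr_ge0 (normc z - normc w); lra.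
Qed.

Lemma normc_le_sum (I : Type) (r : seq I) (F : I -> R[i]) :
  normc (\sum_(i <- r) F i) <= \sum_(i <- r) normc (F i).
Proof.
elim/big_rec2 : _ => [|i x y _ xy]; first by rewrite Normc.normc0.
by apply: le_trans (normc_leD _ _) _; rewrite lerD2l.
Qed.

End complex_measurability.

Section finite_strip_measure.
Context {R : realType} (d : nat) (T : R).
Local Notation RB := (measurableTypeR R).

(* The measure [dtdx d T], in a form on which the finite measure structure is found. *)
Definition strip_lebesgue : set (RB * torus R d) -> \bar R :=
  (time_lebesgue T \x haar R d)%E.

HB.instance Definition _ := Measure.on strip_lebesgue.

Let strip_lebesgue_fin : fin_num_fun strip_lebesgue.
Proof. by apply: lty_fin_num_fun; exact: dtdx_lty. Qed.

HB.instance Definition _ :=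
  Measure_isFinite.Build _ _ _ strip_lebesgue strip_lebesgue_fin.

End finite_strip_measure.

Section duhamel_solutions.
Context {R : realType} {d : nat}.
Local Notation leb := (@lebesgue_measure R).
Local Notation RB := (measurableTypeR R).
Local Notation mu := (haar R d).
Implicit Types (k : 'rV[int]_d) (t s : R).

(** The dependence on t moves from the measure to a cutoff in the integrand, so that a single
    measure on (0, T) serves for all t. The endpoint 0 is a null set. *)
Lemma time_restrict (T t : R) (v : RB -> R) : t < T -> measurable_fun setT v ->
  (\int[mrestr leb (measurable_itv (`[0%R, t])%R)]_s v s =
   \int[time_lebesgue T]_s ((s <= t)%R%:R * v s))%R.
Proof.
move=> tT mv; rewrite /Rintegral; congr fine.
have mb : measurable_fun setT (fun s : RB => (s <= t)%R%:R * v s : R).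
  apply: measurable_funM => //.
  rewrite (_ : (fun s => _) = \1_(`]-oo, t]%classic : set RB)).
    by apply: measurable_indic.
  apply/funext => s; rewrite indicE; congr (_%:R); congr nat_of_bool.
  by apply/idP/idP => [st|/set_mem]; rewrite ?inE/= in_itv.
rewrite integral_mrestr; last exact/measurable_EFinP.
rewrite [RHS]integral_mrestr; last exact/measurable_EFinP.
rewrite -integral_itv_obnd_cbnd; last by apply/measurable_EFinP/measurable_funTS.
rewrite (_ : `]0%R, t]%classic = `]0%R, T[%classic `&` `]-oo, t]%classic :> set R).
  rewrite integral_mkcondr; apply: eq_integral => s _.
  rewrite patchE; have [st|st] := leP s t.
    by rewrite mem_set ?mul1r//= in_itv.
  by rewrite memNset ?mul0r//= in_itv/= leNgt st.
apply/seteqP; split => s /=; rewrite !in_itv/=.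
  by move=> /andP[-> st]; rewrite st (le_lt_trans st tT).
by move=> [/andP[-> _] ->].
Qed.

Lemma Cintegral_time (T t : R) (G : RB -> R[i]) : t < T -> cmeasurable G ->
  Cintegral (mrestr leb (measurable_itv (`[0%R, t])%R)) G =
  Cintegral (time_lebesgue T) (fun s => (s <= t)%R%:R * G s).
Proof.
move=> tT [m1 m2]; rewrite /Cintegral !(time_restrict tT)//.
congr (_ +i* _)%C; apply: eq_Rintegral => s _;
  by case: (s <= t)%R; rewrite ?mul1r ?mul0r.
Qed.

Lemma measurable_sqnorm (h : R -> torus R d -> R[i]) : jointly_measurable h ->
  measurable_fun setT (fun s : RB => sqnorm mu (h s)).
Proof.
move=> jh; apply: (@measurable_parametric_Rintegral _ _ _ _ _ (haar R d)
  (fun p : RB * torus R d => normc (h p.1 p.2) ^+ 2)).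
exact: cmeasurable_normc2 jh.
Qed.

Lemma cmeasurable_osc k : cmeasurable (fun s : RB => osc k (- s) : R[i]).
Proof.
split => /=.
  rewrite (_ : (fun s => _) = (fun s => cos (0 + (- lam k) * s))); first exact: measurable_cos_affine.
  by apply/funext => s; rewrite add0r mulrN mulNr.
rewrite (_ : (fun s => _) = (fun s => cos (- (pi / 2) + lam k * s))); first exact: measurable_cos_affine.
by apply/funext => s; rewrite mulrN sinN opprK [- _ + _]addrC cosBpihalf.
Qed.

Lemma cmeasurable_hat (h : R -> torus R d -> R[i]) k : jointly_measurable h ->
  cmeasurable (fun s : RB => hat (h s) k).
Proof.
move=> jh; have me : cmeasurable (fun p : RB * torus R d => (ek k p.2)^*%C : R[i]).
  apply: cmeasurable_conj; split.
    by apply: (measurableT_comp (cmeasurable_ek k).1); exact: measurable_snd.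
  by apply: (measurableT_comp (cmeasurable_ek k).2); exact: measurable_snd.
have [m1 m2] := cmeasurableM jh me.
by split; [apply: (@measurable_parametric_Rintegral _ _ _ _ _ (haar R d) _ m1)|
  apply: (@measurable_parametric_Rintegral _ _ _ _ _ (haar R d) _ m2)].
Qed.

Lemma jointly_measurable_proj N (v : R -> torus R d -> R[i]) : jointly_measurable v ->
  jointly_measurable (fun t => proj N (v t)).
Proof.
move=> jv; apply: cmeasurable_sum => k; apply: cmeasurableM.
  exact: (cmeasurable_comp measurable_fst (cmeasurable_hat k jv)).
exact: (cmeasurable_comp measurable_snd (cmeasurable_ek k)).
Qed.

Lemma cmeasurable_upto t (Z : RB -> R[i]) : cmeasurable Z ->
  cmeasurable (fun s : RB => (s <= t)%R%:R * Z s : R[i]).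
Proof.
move=> mZ; apply: cmeasurableM => //.
have E (s : RB) : ((s <= t)%R%:R : R[i]) = (\1_(`]-oo, t]%classic : set RB) s : R)%:C%C.
  rewrite indicE rmorph_nat; congr (_%:R); congr nat_of_bool.
  by apply/idP/idP => [st|/set_mem]; rewrite ?inE/= in_itv.
split.
  rewrite (_ : (fun s => _) = \1_(`]-oo, t]%classic : set RB)); first exact: measurable_indic.
  by apply/funext => s; rewrite E.
rewrite (_ : (fun s => _) = fun=> 0); first exact: measurable_cst.
by apply/funext => s; rewrite E.
Qed.

Lemma normc_upto t s (z : R[i]) : normc ((s <= t)%R%:R * z) <= normc z.
Proof.
by case: (s <= t); rewrite ?mul1r// mul0r Normc.normc0 normc_ge0.
Qed.

Lemma cmeasurable_wave k : cmeasurable (wave k : RB * torus R d -> R[i]).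
Proof. by split; exact: (bmeas_mono _ _ _).1. Qed.

Lemma normc_wave k (p : R * torus R d) : normc (wave k p) = 1.
Proof. by case: p => t x; rewrite waveE normcM normc_osc normc_ek mulr1. Qed.

Lemma integral_dtdx_normc T (v : R -> torus R d -> R[i]) : jointly_measurable v ->
  (forall t, in_L2 mu (v t)) ->
  (\int[dtdx d T]_p (normc (v p.1 p.2) ^+ 2)%:E =
   \int[leb]_(t in `]0%R, T[) (sqnorm mu (v t))%:E)%E.
Proof.
move=> jv lv; rewrite integral_dtdx.
- by apply: eq_integral => t _; rewrite -sqnormE.
- by apply/measurable_EFinP; exact: cmeasurable_normc2.
- by move=> p; rewrite lee_fin sqr_ge0.
Qed.

Variables (T : R) (T0 : 0 < T).
Variable U : R -> (torus R d -> R[i]) -> torus R d -> R[i].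
Hypothesis hU : is_schrodinger_group U.
Variables (u0 : torus R d -> R[i]) (f u : R -> torus R d -> R[i]).
Hypothesis lu0 : in_L2 mu u0.
Hypothesis jf : jointly_measurable f.
Hypothesis lf : forall s, in_L2 mu (f s).
Hypothesis Lf : (L1L2norm 0 T f < +oo)%E.
Hypothesis hdu : duhamel U u0 f u.

Let ju : jointly_measurable u. Proof. by have [] := hdu. Qed.

Let nrm g := Num.sqrt (sqnorm mu g).

Definition source_norm s : R := Num.sqrt (sqnorm mu (f s)).

Lemma measurable_source_norm : measurable_fun setT (source_norm : RB -> R).
Proof.
apply: (measurableT_comp (f := @Num.sqrt R)); last exact: measurable_sqnorm jf.
by apply: continuous_measurable_fun; exact: sqrt_continuous.
Qed.

Lemma source_norm_ge0 s : 0 <= source_norm s.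
Proof. exact: sqrtr_ge0. Qed.

Lemma L1L2norm_source : L1L2norm 0 T f = (\int[time_lebesgue T]_s (source_norm s)%:E)%E.
Proof.
rewrite integral_mrestr; last by apply/measurable_EFinP; exact: measurable_source_norm.
by apply: eq_integral => s _; rewrite L2normE.
Qed.

Lemma integrable_source_norm : (time_lebesgue T).-integrable setT (EFin \o source_norm).
Proof.
apply/integrableP; split; first by apply/measurable_EFinP; exact: measurable_source_norm.
under eq_integral do rewrite gee0_abs ?lee_fin ?source_norm_ge0//.
by rewrite -L1L2norm_source.
Qed.

Definition source_mass : R := (\int[time_lebesgue T]_s source_norm s)%R.

Lemma source_massE : source_mass%:E = L1L2norm 0 T f.
Proof.
rewrite L1L2norm_source /source_mass /Rintegral fineK//.
exact: integrable_fin_num integrable_source_norm.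
Qed.

Lemma source_mass_ge0 : 0 <= source_mass.
Proof. by apply: Rintegral_ge0 => s _; exact: source_norm_ge0. Qed.

Definition source_coef k s : R[i] := osc k (- s) * hat (f s) k.

Lemma cmeasurable_source_coef k : cmeasurable (source_coef k : RB -> R[i]).
Proof.
apply: cmeasurableM; first exact: cmeasurable_osc.
exact: cmeasurable_hat.
Qed.

Lemma normc_source_coef k s : normc (source_coef k s) <= source_norm s.
Proof.
rewrite /source_coef normcM normc_osc mul1r.
apply: le_trans (normc_inner (lf s) (in_L2_ek k)) _.
have -> : sqnorm mu (ek k) = 1.
  by have := inner_self mu (ek k); rewrite inner_ek eqxx => -[].
by rewrite sqrtr1 mulr1.
Qed.

Lemma Cint_source k t : Cint (time_lebesgue T) (fun s => (s <= t)%R%:R * source_coef k s).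
Proof.
refine (@Cint_dom _ RB R (time_lebesgue T) _ source_norm _ _ integrable_source_norm).
  exact: cmeasurable_upto (cmeasurable_source_coef k).
by move=> s; apply: le_trans (normc_upto _ _ _) (normc_source_coef _ _).
Qed.

(** The Fourier coefficients of e^{-it Laplacian} u(t): removing the oscillation leaves the initial
    coefficient and an integral of terms in which t occurs in the cutoff only. *)
Definition coef t k : R[i] := hat u0 k + 'i%C^-1 *
  Cintegral (time_lebesgue T) (fun s => (s <= t)%R%:R * source_coef k s).

Lemma hat_solution t k : 0 <= t < T -> hat (u t) k = osc k t * coef t k.
Proof.
move=> /andP[t0 tT]; have [_ /(_ t)[lut /(_ _ (in_L2_ek k))]] := hdu.
rewrite /hat => ->; rewrite group_fourier// /coef mulrDr; congr (_ + _).
rewrite /integral_from0 t0 mulrCA; congr (_ * _).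
rewrite -(Cintegral_time tT); last exact: cmeasurable_source_coef.
have mc := cmeasurable_source_coef k.
rewrite (_ : (fun s => inner mu (U (t - s) (f s)) (ek k)) = (fun s => osc k t * source_coef k s)).
  rewrite !(Cintegral_time tT)//; last by apply: cmeasurableM => //; exact: cmeasurable_cst.
  rewrite -CintegralZ; last exact: Cint_source.
  by congr Cintegral; apply/funext => s; rewrite mulrCA.
by apply/funext => s; rewrite group_fourier// oscD mulrA.
Qed.

Local Notation F := source_mass.

Lemma mass_source N t s :
  mass (modes N) (fun k => (s <= t)%R%:R * source_coef k s) <= source_norm s ^+ 2.
Proof.
rewrite /source_norm sqr_sqrtr ?sqnorm_ge0//; apply: le_trans (bessel N (lf s)).
by apply: le_mass => k; apply: le_trans (normc_upto _ _ _) _; rewrite normcM normc_osc mul1r.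
Qed.

(** Minkowski's integral inequality in l^2, by duality: the coefficients are paired with themselves,
    the sum is moved inside the time integral, and Cauchy-Schwarz is applied for each s. *)
Lemma mass_coef N t : mass (modes N) (coef t) <= (nrm u0 + F) ^+ 2.
Proof.
set m := mass _ _; set K := modes N in m *.
have uK : uniq K := modes_uniq N.
have F0 : 0 <= F := source_mass_ge0.
have n0 : 0 <= nrm u0 := sqrtr_ge0 _.
have m0 : 0 <= m := mass_ge0 _ _.
suff h : Num.sqrt m <= nrm u0 + F.
  by rewrite -(sqr_sqrtr m0) lerXn2r ?nnegrE ?sqrtr_ge0// addr_ge0.
have [->|m1] := eqVneq (Num.sqrt m) 0; first exact: addr_ge0.
have mp : 0 < Num.sqrt m by rewrite lt0r m1 sqrtr_ge0.
rewrite -(ler_pM2r mp) -expr2 sqr_sqrtr// mulrDl.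
rewrite [X in X <= _](_ : m = normc (\sum_(k <- K) (coef t k)^*%C * coef t k)); last first.
  by rewrite mass_sqr_sum/= expr0n addr0 sqrtr_sqr ger0_norm.
rewrite {2}/coef; under eq_bigr do rewrite mulrDr.
rewrite big_split; apply: le_trans (normc_leD _ _) _; apply: lerD.
  apply: le_trans (mass_cauchy_schwarz _ _ uK) _; rewrite ler_wpM2r ?sqrtr_ge0//.
  by rewrite /nrm ler_wsqrtr// bessel.
have -> : \sum_(k <- K) (coef t k)^*%C *
      ('i%C^-1 * Cintegral (time_lebesgue T) (fun s => (s <= t)%R%:R * source_coef k s)) =
    'i%C^-1 * Cintegral (time_lebesgue T) (fun s => \sum_(k <- K)
      (coef t k)^*%C * ((s <= t)%R%:R * source_coef k s)).
  rewrite Cintegral_sum; last by move=> k; apply: CintZ; exact: Cint_source.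
  by rewrite mulr_sumr; apply: eq_bigr => k _; rewrite CintegralZ 1?mulrCA//; exact: Cint_source.
rewrite normcM normc_invi mul1r.
rewrite mulrC -RintegralZl//; last exact: integrable_source_norm.
apply: normc_Cintegral.
- have [h1 h2] : Cint (time_lebesgue T) (fun s => \sum_(k <- K)
      (coef t k)^*%C * ((s <= t)%R%:R * source_coef k s)).
    by apply: Cint_sum => k; apply: CintZ; exact: Cint_source.
  by split; apply/measurable_EFinP; [have /integrableP[] := h1|have /integrableP[] := h2].
- have := integrableZl measurableT (Num.sqrt m) (integrable_source_norm).
  by congr (_.-integrable _ _).
move=> s; apply: le_trans (mass_cauchy_schwarz _ _ uK) _.
rewrite mulrC ler_wpM2l ?sqrtr_ge0//.
rewrite -[leRHS]ger0_norm ?source_norm_ge0// -sqrtr_sqr ler_wsqrtr//.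
exact: mass_source.
Qed.

Lemma mass_solution N t : 0 <= t < T -> mass (modes N) (hat (u t)) = mass (modes N) (coef t).
Proof.
move=> tT; apply: eq_bigr => k _.
by rewrite (hat_solution _ tT) normcM normc_osc mul1r.
Qed.

Lemma in_L2_solution t : in_L2 mu (u t).
Proof. by have [_ /(_ t)[]] := hdu. Qed.

(** [mass_coef] bounds every partial sum independently of N, and the tail is arbitrarily small by
    Parseval's identity. *)
Lemma sqnorm_solution t : 0 <= t < T -> sqnorm mu (u t) <= (nrm u0 + F) ^+ 2.
Proof.
move=> tT; apply/ler_addgt0Pr => e e0.
have [N /(_ N (leqnn N)) tN] := parseval_sqr (in_L2_solution t) e0.
have := tail_sqr N (in_L2_solution t); rewrite mass_solution// => /esym/eqP.
by rewrite subr_eq addrC => /eqP ->; exact: lerD (mass_coef N t) tN.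
Qed.

(** The term 1 keeps the weight positive where the source vanishes, and makes its integral F + T.
    The quotient of [source_norm s ^+ 2] by the weight is at most [source_norm s]. *)
Definition source_weight s : R := source_norm s + 1.

Lemma source_weight_gt0 s : 0 < source_weight s.
Proof. by rewrite ltr_wpDl// source_norm_ge0. Qed.

Lemma measurable_source_weight : measurable_fun setT (source_weight : RB -> R).
Proof. by apply: measurable_funD => //; exact: measurable_source_norm. Qed.

Let measurable_inv_weight : measurable_fun setT (fun s : RB => (source_weight s)^-1 : R).
Proof.
rewrite (_ : (fun s => _) = (fun s => (source_weight s) `^ (-1))).
  by apply: (measurableT_comp (measurable_powR _)); exact: measurable_source_weight.
by apply/funext => s; rewrite powR_inv1// ltW// source_weight_gt0.
Qed.

Let itime1 : (time_lebesgue T).-integrable setT (EFin \o cst (1 : R)).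
Proof.
apply: bmeas_integrable; last exact: bmeas_cst.
by rewrite -ge0_fin_numE//; exact: time_lebesgue_fin.
Qed.

Lemma integrable_source_weight : (time_lebesgue T).-integrable setT (EFin \o source_weight).
Proof.
by have := integrableD measurableT (integrable_source_norm) itime1; congr (_.-integrable _ _).
Qed.

Lemma time_lebesgueT : time_lebesgue T setT = T%:E.
Proof.
rewrite /time_lebesgue /mrestr setTI lebesgue_measure_itv/= lte_fin T0.
by rewrite oppr0 adde0.
Qed.

Lemma Rintegral_source_weight : (\int[time_lebesgue T]_s source_weight s)%R = F + T.
Proof.
rewrite /source_weight RintegralD//; last exact: integrable_source_norm.
by congr (_ + _); rewrite Rintegral_cst//= mul1r time_lebesgueT.
Qed.

Lemma normc_wsum_source K s p :
  normc (wsum K (source_coef ^~ s) p) <= (size K)%:R * source_weight s.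
Proof.
apply: le_trans (normc_le_sum _ _) _.
rewrite -sum1_size natr_sum mulr_suml; apply: ler_sum => k _.
rewrite normcM normc_wave mulr1 mul1r (le_trans (normc_source_coef k s))//.
by rewrite /source_weight lerDl.
Qed.

Lemma cmeasurable_wsum_source K (p : R * torus R d) :
  cmeasurable (fun s : RB => wsum K (source_coef ^~ s) p : R[i]).
Proof.
apply: cmeasurable_sum => k; apply: cmeasurableM; last exact: cmeasurable_cst.
exact: cmeasurable_source_coef.
Qed.

(** The truncated solution is a superposition of free waves: the one issued from u0, and for each s
    one with coefficients [source_coef ^~ s], switched on at time s. *)
Lemma proj_solution N t x : 0 <= t < T -> proj N (u t) x =
  wsum (modes N) (hat u0) (t, x) + 'i%C^-1 * Cintegral (time_lebesgue T)
    (fun s => (s <= t)%R%:R * wsum (modes N) (source_coef ^~ s) (t, x)).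
Proof.
move=> tT; have iC k := Cint_source k t.
have -> : (fun s => (s <= t)%R%:R * wsum (modes N) (source_coef ^~ s) (t, x)) =
    (fun s => \sum_(k <- modes N) wave k (t, x) * ((s <= t)%R%:R * source_coef k s)).
  apply/funext => s; rewrite mulr_sumr; apply: eq_bigr => k _.
  by rewrite mulrA mulrC.
rewrite Cintegral_sum; last by move=> k; exact: CintZ.
rewrite mulr_sumr -big_split; apply: eq_bigr => k _ /=.
rewrite (hat_solution k tT) CintegralZ// waveE.
rewrite mulrAC /coef mulrDr mulrCA; congr (_ + _); exact: mulrC.
Qed.

Let integrable_weighted (Z : RB -> R[i]) (B : R) : cmeasurable Z ->
  (forall s, normc (Z s) <= B * source_weight s) -> (time_lebesgue T).-integrable setT
    (EFin \o (fun s => normc (Z s) ^+ 2 / source_weight s)).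
Proof.
move=> mZ ZB; have iBw := integrableZl measurableT (B ^+ 2) integrable_source_weight.
apply: (le_integrable measurableT _ _ iBw).
  apply/measurable_EFinP; apply: measurable_funM; first exact: cmeasurable_normc2.
  exact: measurable_inv_weight.
move=> s _ /=; rewrite lee_fin; have w0 := source_weight_gt0 s.
rewrite ger0_norm; last by apply: mulr_ge0; rewrite ?sqr_ge0 ?invr_ge0 ?(ltW w0).
rewrite ger0_norm; last by apply: mulr_ge0; rewrite ?sqr_ge0 ?(ltW w0).
rewrite ler_pdivrMr// (_ : _ * _ * _ = (B * source_weight s) ^+ 2); last by ring.
  by rewrite lerXn2r ?nnegrE ?normc_ge0 ?ZB// (le_trans (normc_ge0 _) (ZB s)).

Qed.

Lemma normc_proj_solution N t x : 0 <= t < T -> normc (proj N (u t) x) ^+ 2 <=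
  2 * normc (wsum (modes N) (hat u0) (t, x)) ^+ 2 + 2 * ((F + T) *
   (\int[time_lebesgue T]_s
     (normc (wsum (modes N) (source_coef ^~ s) (t, x)) ^+ 2 / source_weight s))%R).
Proof.
move=> tT; rewrite proj_solution//; apply: le_trans (normc_sqrD _ _) _.
rewrite lerD2l ler_pM2l// normcM normc_invi mul1r.
have FT : 0 < F + T by rewrite ltr_wpDl// source_mass_ge0.
rewrite -Rintegral_source_weight in FT *.
set K := modes N; have iw := integrable_source_weight.
have mZ := cmeasurable_wsum_source K (t, x).
have ZB s := normc_wsum_source K s (t, x).
have ZB' s : normc ((s <= t)%R%:R * wsum K (source_coef ^~ s) (t, x)) <=
    (size K)%:R * source_weight s.
  exact: le_trans (normc_upto _ _ _) (ZB s).
have mw := measurable_source_weight.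
have h := @weighted_cs_complex _ RB R (time_lebesgue T) _ source_weight_gt0 mw iw FT _ _
  (cmeasurable_upto t mZ) ZB'.
apply: le_trans h _.
rewrite ler_pM2l//; apply: le_Rintegral => //.
- exact: (integrable_weighted (cmeasurable_upto t mZ) ZB').
- exact: (integrable_weighted mZ ZB).
move=> s _; rewrite ler_pM2r ?invr_gt0 ?source_weight_gt0//.
by rewrite lerXn2r ?nnegrE ?normc_ge0// normc_upto.
Qed.

Lemma spacetime_solution :
  (\int[dtdx d T]_p (normc (u p.1 p.2) ^+ 2)%:E <= (T * (nrm u0 + F) ^+ 2)%:E)%E.
Proof.
rewrite integral_dtdx_normc//; last by move=> t; exact: in_L2_solution.
apply: (@le_trans _ _ (\int[leb]_(t in `]0%R, T[) ((nrm u0 + F) ^+ 2)%:E)%E).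
  apply: ge0_le_integral => //.
  - by move=> t _; rewrite lee_fin sqnorm_ge0.
  - by apply/measurable_EFinP/measurable_funTS; exact: measurable_sqnorm.
  move=> t; rewrite /= in_itv/= => /andP[t0 tT]; rewrite lee_fin.
  exact: (sqnorm_solution (introT andP (conj (ltW t0) tT))).
by rewrite integral_cst//= lebesgue_measure_itv/= lte_fin T0 oppr0 adde0 -EFinM mulrC.
Qed.

Let remainder N t x := u t x + (-1) * proj N (u t) x.

Let jremainder N : jointly_measurable (remainder N).
Proof.
apply: cmeasurableD => //; apply: cmeasurableM; first exact: cmeasurable_cst.
exact: jointly_measurable_proj.
Qed.

Lemma remainder_vanishes e : 0 < e ->
  exists N, (\int[dtdx d T]_p (normc (remainder N p.1 p.2) ^+ 2)%:E <= e%:E)%E.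
Proof.
(* The indicator function extends the squared tail by 0, so that the bound by (nrm u0 + F)^2, known
   on (0, T), holds at every time and dominated convergence applies. *)
move=> e0; pose v N (t : RB) : R := \1_(`]0, T[%classic : set RB) t * sqnorm mu (remainder N t).
have mI : measurable_fun setT (\1_(`]0, T[%classic : set RB) : RB -> R) by exact: measurable_indic.
have mv N : measurable_fun setT (v N).
  by apply: measurable_funM => //; exact: measurable_sqnorm (jremainder N).
have lu t : in_L2 mu (u t) := in_L2_solution t.
have tailE N t : sqnorm mu (remainder N t) = tail N (u t) ^+ 2.
  by rewrite /tail sqr_sqrtr// sqnorm_ge0.
have v0 N t : 0 <= v N t by rewrite mulr_ge0// sqnorm_ge0.
have vB N t : `|v N t| <= (nrm u0 + F) ^+ 2.
  rewrite ger0_norm// /v indicE; have [tT|tT] := boolP (t \in _); last by rewrite mul0r sqr_ge0.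
  rewrite mul1r tailE; apply: le_trans (_ : nrm (u t) ^+ 2 <= _).
    by rewrite lerXn2r ?nnegrE ?tail_ge0 ?sqrtr_ge0// tail_le.
  rewrite /nrm sqr_sqrtr ?sqnorm_ge0//.
  move: tT; rewrite inE/= in_itv/= => /andP[t0 tT].
  exact: (sqnorm_solution (introT andP (conj (ltW t0) tT))).
have v_cvg t : v N t @[N --> \oo] --> (0 : R).
  apply/cvgrPdist_le => r r0; have [N0 HN] := parseval_sqr (lu t) r0.
  exists N0 => // N /= /HN tN; rewrite sub0r normrN ger0_norm// /v indicE.
  by case: (_ \in _); [rewrite mul1r tailE|rewrite mul0r ltW].
have tfin : (time_lebesgue T setT < +oo)%E.
  by rewrite -ge0_fin_numE//; exact: time_lebesgue_fin.
have iB : (time_lebesgue T).-integrable setT (EFin \o fun=> (nrm u0 + F) ^+ 2).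
  by apply: bmeas_integrable => //; exact: bmeas_cst.
have [N /(_ N (leqnn N)) HN] := @dominated_Rintegral0 _ _ _ (time_lebesgue T) v _ mv v_cvg iB vB e e0.
exists N; rewrite integral_dtdx_normc//; last by move=> t; exact: in_L2_tail.
have -> : (\int[leb]_(t in `]0%R, T[) (sqnorm mu (remainder N t))%:E =
    \int[time_lebesgue T]_t (v N t)%:E)%E.
  rewrite integral_mrestr//; last by apply/measurable_EFinP; exact: mv.
  by apply: eq_integral => t tT; rewrite /v indicE tT mul1r.
have bv : bmeas (v N) by split => //; exists ((nrm u0 + F) ^+ 2) => t; exact: vB.
rewrite -[leLHS]fineK; last by apply: integrable_fin_num => //; exact: bmeas_integrable.
by rewrite lee_fin; apply: le_trans HN; exact: ler_norm.
Qed.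

Variables (phi : R * torus R d -> R) (kappa M : R).
Hypothesis mphi : measurable_fun setT (phi : RB * torus R d -> R).
Hypothesis phi0 : forall p, 0 <= phi p.
Hypothesis phiM : forall p, phi p <= M.
Hypothesis phi_strip : forall p, ~ strip T p -> phi p = 0.
Hypothesis kappa0 : 0 <= kappa.
Hypothesis phi_kappa : forall K a, uniq K ->
  (\int[dtdx d T]_p (phi p * normc (wsum K a p) ^+ 2)%:E <= (kappa * mass K a)%:E)%E.

Let G N (q : (RB * torus R d) * RB) : R :=
  phi q.1 * (normc (wsum (modes N) (source_coef ^~ q.2) q.1) ^+ 2 / source_weight q.2).

Let mG N : measurable_fun setT (G N).
Proof.
apply: measurable_funM; first exact: (measurableT_comp mphi measurable_fst).
apply: measurable_funM; last exact: (measurableT_comp measurable_inv_weight measurable_snd).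
apply: cmeasurable_normc2; apply: cmeasurable_sum => k; apply: cmeasurableM.
  exact: (cmeasurable_comp measurable_snd (cmeasurable_source_coef k)).
exact: (cmeasurable_comp measurable_fst (cmeasurable_wave k)).
Qed.

Let G0 N q : 0 <= G N q.
Proof.
by rewrite mulr_ge0// mulr_ge0 ?sqr_ge0// invr_ge0 ltW// source_weight_gt0.
Qed.

(** For each s the energy bound gives kappa times the mass of the coefficients divided by the
    weight, hence at most kappa * source_norm s. *)
Let integral_source_energy N :
  (\int[time_lebesgue T]_s \int[dtdx d T]_p (G N (p, s))%:E <= (kappa * F)%:E)%E.
Proof.
apply: (@le_trans _ _ (\int[time_lebesgue T]_s (kappa * source_norm s)%:E)%E); last first.
  rewrite [leLHS](_ : _ = (kappa * F)%:E)//.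
  under eq_integral do rewrite EFinM.
  rewrite integralZl//; last exact: integrable_source_norm.
  rewrite EFinM; congr (_ * _)%E; apply/esym.
  by rewrite (source_massE) L1L2norm_source.
apply: ge0_le_integral => //.
- by move=> s _; apply: integral_ge0 => p _; rewrite lee_fin.
- have mE : measurable_fun setT (EFin \o G N) by apply/measurable_EFinP; exact: mG.
  have E0 q : (0 <= (EFin \o G N) q)%E by rewrite lee_fin; exact: G0.
  by have := @measurable_fun_fubini_tonelli_G _ _ _ _ _ (@strip_lebesgue R d T) _ mE E0.
- apply/measurable_EFinP; apply: measurable_funM => //; exact: measurable_source_norm.
move=> s _; have w0 := source_weight_gt0 s.
rewrite (_ : (fun p => _) = (fun p => ((source_weight s)^-1)%:E *
    (phi p * normc (wsum (modes N) (source_coef ^~ s) p) ^+ 2)%:E)%E); last first.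
  by apply/funext => p; rewrite -EFinM /G/= mulrA mulrC.
rewrite ge0_integralZl//; last 3 first.
- apply/measurable_EFinP; apply: measurable_funM => //; exact: (bmeas_normc_wsum _ _).1.
- by move=> p _; rewrite lee_fin mulr_ge0// sqr_ge0.
- by rewrite lee_fin invr_ge0 ltW.
apply: (@le_trans _ _ (((source_weight s)^-1)%:E * (kappa * mass (modes N) (source_coef ^~ s))%:E)%E).
  by rewrite lee_pmul2l// ?lte_fin ?invr_gt0//; apply: phi_kappa; exact: modes_uniq.
rewrite -EFinM lee_fin mulrCA ler_wpM2l// ler_pdivrMl//.
apply: le_trans (_ : source_norm s ^+ 2 <= _).
  (* Taking the cutoff time equal to s turns the cutoff into 1. *)
  have := mass_source N s s; rewrite lexx.
  by under eq_fun do rewrite mul1r.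
by rewrite expr2 ler_wpM2r ?source_norm_ge0// lerDl.
Qed.

Let energy_pointwise N p :
  ((phi p * normc (proj N (u p.1) p.2) ^+ 2)%:E <=
   (2 * (phi p * normc (wsum (modes N) (hat u0) p) ^+ 2))%:E +
   (2 * (F + T))%:E * \int[time_lebesgue T]_s (G N (p, s))%:E)%E.
Proof.
have FT : 0 <= F + T by rewrite addr_ge0 ?source_mass_ge0// ltW.
have I0 : (0 <= \int[time_lebesgue T]_s (G N (p, s))%:E)%E.
  by apply: integral_ge0 => s _; rewrite lee_fin G0.
have [sp|nsp] := pselect (strip T p); last first.
  rewrite phi_strip// !mul0r mulr0 add0e mule_ge0// lee_fin mulr_ge0//.
case: p sp I0 => t x [/= tT _] I0; move: tT; rewrite in_itv/= => /andP[t0 tT].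
have h := normc_proj_solution N x (introT andP (conj (ltW t0) tT)).
apply: (@le_trans _ _ ((2 * (phi (t, x) * normc (wsum (modes N) (hat u0) (t, x)) ^+ 2))%:E +
    (2 * (F + T))%:E * (\int[time_lebesgue T]_s (G N ((t, x), s)))%R%:E)%E).
  rewrite -EFinM -EFinD lee_fin /G/= RintegralZl//; last first.
    exact: (integrable_weighted (cmeasurable_wsum_source _ _) (fun s => normc_wsum_source _ s _)).
  by have := ler_wpM2l (phi0 (t, x)) h; rewrite mulrDr; lra.
apply: leeD2l; apply: lee_wpmul2l; first by rewrite lee_fin mulr_ge0.
(* A real-valued integral of a nonnegative function is at most the extended one, being 0 by default
   when the latter is infinite. *)
by rewrite /Rintegral; case: (integral _ _ _) I0 => [r| |]; rewrite ?lee_fin//= leey.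
Qed.

Lemma energy_proj_solution N :
  (\int[dtdx d T]_p (phi p * normc (proj N (u p.1) p.2) ^+ 2)%:E <=
   (kappa * (2 * sqnorm mu u0 + 2 * (F + T) * F))%:E)%E.
Proof.
have FT : 0 <= F + T by rewrite addr_ge0 ?source_mass_ge0// ltW.
have mh : measurable_fun setT (fun p : RB * torus R d =>
    (2 * (phi p * normc (wsum (modes N) (hat u0) p) ^+ 2))%:E).
  apply/measurable_EFinP; apply: measurable_funM => //; apply: measurable_funM => //.
  exact: (bmeas_normc_wsum _ _).1.
have h0 (p : RB * torus R d) :
    (0 <= (2 * (phi p * normc (wsum (modes N) (hat u0) p) ^+ 2))%:E)%E.
  by rewrite lee_fin mulr_ge0// mulr_ge0// sqr_ge0.
have mI : measurable_fun setT (fun p : RB * torus R d =>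
    \int[time_lebesgue T]_s (G N (p, s))%:E)%E.
  apply: (@measurable_parametric_integral _ _ _ _ _ (time_lebesgue T) (EFin \o G N)).
  by apply/measurable_EFinP; exact: mG.
have I0 (p : RB * torus R d) : (0 <= \int[time_lebesgue T]_s (G N (p, s))%:E)%E.
  by apply: integral_ge0 => s _; rewrite lee_fin G0.
have c0 : (0 <= (2 * (F + T))%:E)%E by rewrite lee_fin mulr_ge0.
apply: (@le_trans _ _ (\int[dtdx d T]_p
    ((2 * (phi p * normc (wsum (modes N) (hat u0) p) ^+ 2))%:E +
    (2 * (F + T))%:E * \int[time_lebesgue T]_s (G N (p, s))%:E))%E).
  apply: ge0_le_integral => //.
  - by move=> p _; rewrite lee_fin mulr_ge0// sqr_ge0.
  - apply/measurable_EFinP; apply: measurable_funM => //; apply: cmeasurable_normc2.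
    exact: jointly_measurable_proj.
  - by apply: emeasurable_funD => //; exact: measurable_funeM.
rewrite ge0_integralD//; last 2 first.
- by move=> p _; rewrite mule_ge0.
- exact: measurable_funeM.
rewrite ge0_integralZl//.
have -> : (\int[dtdx d T]_p \int[time_lebesgue T]_s (G N (p, s))%:E =
    \int[time_lebesgue T]_s \int[dtdx d T]_p (G N (p, s))%:E)%E.
  have mE : measurable_fun setT (EFin \o G N) by apply/measurable_EFinP; exact: mG.
  have E0 q : (0 <= (EFin \o G N) q)%E by rewrite lee_fin; exact: G0.
  by have := @fubini_tonelli _ _ _ _ _ (@strip_lebesgue R d T) (time_lebesgue T) _ mE E0.
rewrite [kappa * _]mulrDr EFinD; apply: leeD.
  under eq_integral do rewrite EFinM.
  rewrite ge0_integralZl//; last 2 first.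
  - apply/measurable_EFinP; apply: measurable_funM => //; exact: (bmeas_normc_wsum _ _).1.
  - by move=> p _; rewrite lee_fin mulr_ge0// sqr_ge0.
  rewrite mulrCA EFinM; apply: lee_wpmul2l => //.
  apply: le_trans (phi_kappa _ (modes_uniq N)) _.
  by rewrite lee_fin ler_wpM2l// bessel.
rewrite mulrCA (EFinM _ (kappa * F)); apply: lee_wpmul2l => //.
Qed.

(** u is split into its truncation and a remainder, which costs a factor 2. The bound on the
    truncation does not depend on N, and N then makes the remainder negligible. *)
Theorem energy_solution :
  (\int[dtdx d T]_p (phi p * normc (u p.1 p.2) ^+ 2)%:E <=
   (kappa * (4 * sqnorm mu u0 + 4 * (F + T) * F))%:E)%E.
Proof.
have M0 : 0 <= M by apply: le_trans (phi0 (0, point)) (phiM _).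
apply/lee_addgt0Pr => e e0.
(* M + 1 in place of M avoids a division by 0. *)
have e1 : 0 < e / (2 * (M + 1)) by rewrite divr_gt0// mulr_gt0// ltr_wpDl.
have [N HN] := remainder_vanishes e1.
have mp : measurable_fun setT (fun p : RB * torus R d => 
    (phi p * normc (proj N (u p.1) p.2) ^+ 2)%:E).
  apply/measurable_EFinP; apply: measurable_funM => //; apply: cmeasurable_normc2.
  exact: jointly_measurable_proj.
have mr : measurable_fun setT (fun p : RB * torus R d => 
    (normc (remainder N p.1 p.2) ^+ 2)%:E).
  by apply/measurable_EFinP; apply: cmeasurable_normc2; exact: jremainder.
apply: (@le_trans _ _ (\int[dtdx d T]_p
    (2%:E * (phi p * normc (proj N (u p.1) p.2) ^+ 2)%:E +
    (2 * M)%:E * (normc (remainder N p.1 p.2) ^+ 2)%:E))%E).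
  apply: ge0_le_integral => //.
  - by move=> p _; rewrite lee_fin mulr_ge0// sqr_ge0.
  - apply/measurable_EFinP; apply: measurable_funM => //; exact: cmeasurable_normc2.
  - by apply: emeasurable_funD; exact: measurable_funeM.
  move=> p _; rewrite -!EFinM -EFinD lee_fin.
  have -> : u p.1 p.2 = proj N (u p.1) p.2 + remainder N p.1 p.2.
    by rewrite /remainder mulN1r addrC subrK.
  set a := proj _ _ _; set b := remainder _ _ _.
  have h := ler_wpM2l (phi0 p) (normc_sqrD a b); apply: le_trans h _.
  rewrite mulrDr mulrCA lerD2l mulrCA -mulrA ler_wpM2l//.
  by rewrite ler_wpM2r ?sqr_ge0.
have p0 (p : RB * torus R d) : (0 <= (phi p * normc (proj N (u p.1) p.2) ^+ 2)%:E)%E.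
  by rewrite lee_fin mulr_ge0// sqr_ge0.
have r0 (p : RB * torus R d) : (0 <= (normc (remainder N p.1 p.2) ^+ 2)%:E)%E.
  by rewrite lee_fin sqr_ge0.
have M2 : (0 <= (2 * M)%:E)%E by rewrite lee_fin mulr_ge0.
rewrite ge0_integralD//; last 4 first.
- by move=> p _; rewrite mule_ge0// lee_fin.
- exact: measurable_funeM.
- by move=> p _; rewrite mule_ge0.
- exact: measurable_funeM.
rewrite ge0_integralZl// ?lee_fin// ge0_integralZl//.
have h1 := energy_proj_solution N.
apply: leeD.
  rewrite (_ : kappa * _ = 2 * (kappa * (2 * sqnorm mu u0 + 2 * (F + T) * F))); last by ring.
  by rewrite EFinM; apply: lee_wpmul2l => //; rewrite lee_fin.
apply: (@le_trans _ _ ((2 * M)%:E * (e / (2 * (M + 1)))%:E)%E); first exact: lee_wpmul2l.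
rewrite -EFinM lee_fin mulrA ler_pdivrMr ?mulr_gt0 ?ltr_wpDl// mulrC ler_pM2l//.
by rewrite ler_pM2l// lerDl.
Qed.

End duhamel_solutions.

(** * Weak limits *)

Section cutoff.
Context {R : realType} {d : nat}.
Local Notation RB := (measurableTypeR R).

Definition slab (a b : R) : set (R * torus R d) := `[a, b] `*` setT.

Lemma slab_compact a b : compact (slab a b).
Proof. by apply: compact_setX; [exact: segment_compact|exact: torus_compact]. Qed.

Lemma closed_slab a b : closed (slab a b).
Proof.
rewrite (_ : slab a b = fst @^-1` `[a, b]%classic); last first.
  by apply/seteqP; split => p; [case|split].
by apply: closed_comp; [move=> p _; exact: cvg_fst|exact: interval_closed].
Qed.

Lemma measurable_slab a b : measurable (slab a b : set (RB * torus R d)).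
Proof. by apply: measurableX. Qed.

Lemma slab_strip a b T : 0 < a -> b < T -> slab a b `<=` strip T.
Proof.
move=> a0 bT [t x] [/= tab _]; split => //=; move: tab; rewrite !in_itv/= => /andP[at_ tb].
by rewrite (lt_le_trans a0 at_) (le_lt_trans tb bT).
Qed.

(** Passes from the strip (0, T) of the problem to a full period (0, P), where the waves are
    orthogonal. *)
Lemma integral_dtdx_widen (T P : R) (F : RB * torus R d -> \bar R) : T <= P ->
  measurable_fun setT F -> (forall p, 0 <= F p)%E -> (forall p, ~ strip T p -> F p = 0%E) ->
  (\int[dtdx d P]_p F p = \int[dtdx d T]_p F p)%E.
Proof.
move=> TP mF F0 FT; rewrite !integral_dtdx//.
rewrite integral_mkcond [RHS]integral_mkcond; apply: eq_integral => t _; rewrite !patchE.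
have [tT|tT] := boolP (t \in (`]0, T[%classic : set R)).
  rewrite ifT//; move: tT; rewrite !inE/= !in_itv/= => /andP[-> tT].
  exact: lt_le_trans tT TP.
case: ifPn => // _; apply: integral0_eq => x _; apply: FT => -[/= h _].
by move/negP: tT; apply; rewrite inE.
Qed.

Variables (T a b : R) (B : set (R * torus R d)).
Hypotheses (T0 : 0 < T) (a0 : 0 < a) (bT : b < T).
Hypotheses (cB : closed B) (mB : measurable (B : set (RB * torus R d))).
Hypotheses (Bab : B `<=` slab a b) (B0 : B !=set0) (nullB : dtdx d T B = 0%E).

(** Half of the room left by [a, b] inside (0, T), so that [a - c, b + c] still lies in (0, T). *)
Let c := Num.min a (T - b) / 2.

Let c0 : 0 < c. Proof. by rewrite divr_gt0// lt_min a0 subr_gt0. Qed.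

Let ac : 0 < a - c.
Proof.
rewrite subr_gt0 /c ltr_pdivrMr// (le_lt_trans (y := a)) ?ge_min ?lexx//.
by rewrite mulr_natr mulr2n ltrDl.
Qed.

Let bc : b + c < T.
Proof.
rewrite -ltrBrDl /c ltr_pdivrMr// (le_lt_trans (y := T - b)) ?ge_min ?lexx ?orbT//.
by rewrite mulr_natr mulr2n ltrDl subr_gt0.
Qed.

Let slab_dist t := Num.max 0 (a - t) + Num.max 0 (t - b).

Let slab_dist_ge0 t : 0 <= slab_dist t.
Proof. by rewrite addr_ge0// le_max lexx. Qed.

Let slab_dist_lt t : slab_dist t < c -> t \in `[a - c, b + c].
Proof.
move=> h; rewrite in_itv/=; apply/andP; split.
  have : a - t < c.
    apply: le_lt_trans h; apply: le_trans (_ : Num.max 0 (a - t) <= _).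
      by rewrite le_max lexx orbT.
    by rewrite lerDl le_max lexx.
  by move=> /ltW; lra.
rewrite -lerBlDl; apply/ltW; apply: le_lt_trans h; apply: le_trans (_ : Num.max 0 (t - b) <= _).
  by rewrite le_max lexx orbT.
by rewrite lerDr le_max lexx.
Qed.

Let slab_dist0 t : t \in `[a, b] -> slab_dist t = 0.
Proof.
rewrite in_itv/= => /andP[at_ tb]; rewrite /slab_dist.
by rewrite (max_idPl _) ?(max_idPl _) ?addr0// subr_le0.
Qed.

(** To the distance to B is added [slab_dist / c], which is 0 on B and at least 1 off the widened
    slab. All plateau functions of g, the first one included, are then supported in one compact
    subset of the strip. *)
Let separating : exists g : R * torus R d -> R, [/\ continuous g, forall p, 0 <= g p,
  forall p, g p = 0 <-> B p & forall p, g p < 1 -> slab (a - c) (b + c) p].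
Proof.
have kB : compact B := subclosed_compact cB (@slab_compact a b) Bab.
have [g [cg g0 gB]] := distance_strip kB B0.
have d0 t : 0 <= slab_dist t / c by rewrite divr_ge0// ltW.
exists (fun p => g p + slab_dist p.1 / c); split.
- apply: continuous_addf => //; apply: continuous_mulf; last exact: cst_continuous.
  apply: continuous_addf => p.
    apply: (@continuous_max _ _ (fun=> 0) (fun p : R * torus R d => a - p.1)); first exact: cst_continuous.
    apply: continuous_subf => {}p; first exact: cst_continuous.
    exact: cvg_fst.
  apply: (@continuous_max _ _ (fun=> 0) (fun p : R * torus R d => p.1 - b)); first exact: cst_continuous.
  apply: continuous_subf => {}p; last exact: cst_continuous.
  exact: cvg_fst.
- by move=> p; rewrite addr_ge0.
- move=> p; split => [/eqP|Bp].
    by rewrite paddr_eq0// => /andP[/eqP/gB].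
  have [+ _] := Bab Bp; move/slab_dist0 => ->.
  by rewrite mul0r addr0; apply/gB.
move=> p h; split => //; apply: slab_dist_lt.
rewrite -[X in _ < X]mul1r -ltr_pdivrMr//; apply: le_lt_trans h.
by rewrite lerDr.
Qed.

Lemma shrinking_test_functions :
  exists a' b' (phi : nat -> R * torus R d -> R), [/\ 0 < a' /\ b' < T,
      forall j, continuous (phi j) /\ (forall p, ~ slab a' b' p -> phi j p = 0), forall j p, 0 <= phi j p <= 1,
      forall j p, B p -> phi j p = 1 &
      forall e, 0 < e -> exists j, forall K k, uniq K ->
        (\int[dtdx d T]_p (phi j p * normc (wsum K k p) ^+ 2)%:E <=
         (e * mass K k)%:E)%E].
Proof.
have [g [cg g0 gB gslab]] := separating.
pose phi := plateau g.
have phi01 j p : 0 <= phi j p <= 1 by exact: plateau01.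
have phislab j p : ~ slab (a - c) (b + c) p -> phi j p = 0.
  move=> np; have g1 : 1 <= g p by rewrite leNgt; apply/negP => /gslab.
  by apply: plateau_eq0; rewrite (le_trans g1)// ler_peMl// ler1n.
have cphi j : continuous (phi j) by exact: continuous_plateau.
have phistrip j p : ~ strip T p -> phi j p = 0.
  move=> np; apply: phislab => sp; apply: np; exact: (@slab_strip _ _ _ ac bc p sp).
exists (a - c), (b + c), phi; split => //.
- by move=> j; split; [exact: cphi|exact: phislab].
- by move=> j p; exact: plateau_eq1.
(* N exceeds 2 pi T, so that the period P = N / (2 pi) is at least T. *)
move=> e e0; pose N := Num.bound (T * (pi *+ 2)); pose P : R := N%:R / (pi *+ 2).
have pi2 : 0 < pi *+ 2 :> R by rewrite mulrn_wgt0// pi_gt0.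
have TN : T * (pi *+ 2) < N%:R by apply: archi_boundP; rewrite mulr_ge0// ltW.
have N0 : (0 < N)%N by rewrite -(ltr0n R) (lt_trans _ TN)// mulr_gt0.
have P0 : 0 < P by rewrite divr_gt0// ltr0n.
have TP : T <= P by rewrite ler_pdivlMr// ltW.
have phistripP j p : ~ strip P p -> phi j p = 0.
  move=> np; apply: phistrip => -[/= h _]; apply: np; split => //=.
  by move: h; rewrite !in_itv/= => /andP[-> /lt_le_trans]; apply.
have decr i j p : (i <= j)%N -> phi j p <= phi i p by exact: plateau_decr.
have bphi j : bmeas (phi j : RB * torus R d -> R).
  exact: (bmeas_continuous_strip P0 (cphi j) (phistripP j)).
have bB : bmeas (\1_B : RB * torus R d -> R).
  split; first exact: measurable_indic.
  by exists 1 => x; rewrite indicE; case: (_ \in _); rewrite ?normr1 ?normr0.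
(* Since B is null, dominated convergence makes the integrals of the plateau functions tend to 0, as
   [energy_uniformly_small] requires. *)
have intB : (\int[dtdx d P]_p (\1_B p : R) = 0)%R.
  rewrite /Rintegral (@integral_dtdx_widen T P (EFin \o \1_B))//.
  - by rewrite integral_indic// setIT nullB.
  - by apply/measurable_EFinP; exact: bB.1.
  - by move=> p; rewrite /= lee_fin indicE ler0n.
  - move=> p np /=; rewrite indicE memNset// => /Bab sp; apply: np.
    exact: (@slab_strip _ _ _ a0 bT p sp).
have small r : 0 < r -> exists j, (\int[dtdx d P]_p phi j p <= r)%R.
  move=> r0.
  have [||||j Hj] := @dominated_Rintegral0 _ _ _ (dtdx d P) (fun j p => phi j p - \1_B p)
    (fun=> 1) _ _ _ _ _ r0.
  - by move=> j; apply: measurable_funB; [exact: (bphi j).1|exact: bB.1].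
  - by move=> p; exact: cvg_plateau.
  - by apply: bmeas_integrable; [exact: dtdx_lty|exact: bmeas_cst].
  - by move=> j p; exact: plateau_indic.
  exists j; apply: le_trans (Hj j (leqnn _)); apply: le_trans (ler_norm _).
  rewrite le_eqVlt; apply/orP; left; apply/eqP.
  transitivity (\int[dtdx d P]_p ((phi j p - \1_B p) + \1_B p))%R.
    by apply: eq_Rintegral => p _; rewrite subrK.
  rewrite RintegralD_bmeas ?intB ?addr0//.
  - exact: dtdx_lty.
  - exact: bmeasB.
have [J HJ] := @energy_uniformly_small R d N N0 phi cphi phistripP
  (fun j p => proj1 (andP (phi01 j p))) decr small e e0.
exists J => K k uK.
rewrite -(@integral_dtdx_widen T P)//.
- have bE : bmeas (fun p : RB * torus R d => phi J p * normc (wsum K k p) ^+ 2).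
    by apply: bmeasM; [exact: bphi|exact: bmeas_normc_wsum].
  rewrite -[leLHS]fineK; first by rewrite lee_fin; exact: HJ.
  apply: integrable_fin_num => //; apply: bmeas_integrable => //; exact: dtdx_lty.
- apply/measurable_EFinP; apply: measurable_funM; [exact: (bphi J).1|exact: (bmeas_normc_wsum _ _).1].
- by move=> p; rewrite lee_fin mulr_ge0 ?sqr_ge0//; have /andP[] := phi01 J p.
- by move=> p /phistrip ->; rewrite mul0r.
Qed.

End cutoff.

(** * Absolute continuity of the weak limits *)

Section absolute_continuity.
Context {R : realType} {d : nat}.
Local Notation RB := (measurableTypeR R).

Variables (T : R) (T0 : 0 < T) (u : nat -> R -> torus R d -> R[i]) (C0 : R).
Hypothesis C0_ge0 : 0 <= C0.
Hypothesis u_energy : forall (phi : R * torus R d -> R) kappa n,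
  measurable_fun setT (phi : RB * torus R d -> R) -> (forall p, 0 <= phi p <= 1) ->
  (forall p, ~ strip T p -> phi p = 0) -> 0 <= kappa ->
  (forall K a, uniq K -> (\int[dtdx d T]_p (phi p * normc (wsum K a p) ^+ 2)%:E <=
     (kappa * mass K a)%:E)%E) ->
  (\int[dtdx d T]_p (phi p * normc (u n p.1 p.2) ^+ 2)%:E <= (kappa * C0)%:E)%E.

Variable nu : {measure set (RB * torus R d) -> \bar R}.
Hypothesis nu_radon : radon_on_strip T nu.
Hypothesis nu_limit : weak_star_limit T u nu.

(** nu B is at most the nu-integral of a test function equal to 1 on B, which is a limit of weighted
    energies of the u_n, all of them at most e. *)
Lemma limit_null_closed (a b : R) (B : set (R * torus R d)) : 0 < a -> b < T ->
  closed B -> measurable (B : set (RB * torus R d)) -> B `<=` slab a b ->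
  dtdx d T B = 0%E -> nu B = 0%E.
Proof.
move=> a0 bT cB mB Bab nullB; have [B0|/set0P/negP/negPn/eqP ->] := pselect (B !=set0); last first.
  exact: measure0.
have [a' [b' [phi [[a'0 b'T] phi_slab phi01 phiB phi_small]]]] :=
  shrinking_test_functions T0 a0 bT cB mB Bab B0 nullB.
have [sigma _ cvg_sigma] := nu_limit.
have phi_strip j p : ~ strip T p -> phi j p = 0.
  move=> np; apply: (phi_slab j).2 => sp; apply: np; exact: (@slab_strip _ _ _ _ _ a'0 b'T p sp).
have phi_test j : test_function T (phi j).
  split; first exact: (phi_slab j).1; exists (slab a' b'); last exact: (phi_slab j).2.
  by split; [exact: slab_compact|exact: slab_strip].
have mphi j : measurable_fun setT (phi j : RB * torus R d -> R).
  by apply: (bmeas_continuous_strip T0 (phi_slab j).1 _).1; exact: phi_strip.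
apply/eqP; rewrite -measure_le0; apply/lee_addgt0Pr => e e0; rewrite add0e.
have C1 : 0 < C0 + 1 by rewrite ltr_wpDl.
have e1 : 0 < e / (C0 + 1) by rewrite divr_gt0.
have [j Hj] := phi_small _ e1.
have phi0 p : 0 <= phi j p by have /andP[] := phi01 j p.
have limit_le : (\int[nu]_p phi j p <= e)%R.
  have h := cvg_sigma _ (phi_test j).
  rewrite -(cvg_lim _ h)//; apply: limr_le; first by apply/cvg_ex; exists (\int[nu]_p phi j p)%R.
  apply: nearW => k; apply: (@le_trans _ _ (e / (C0 + 1) * C0)); last first.
    by rewrite mulrAC ler_pdivrMr// ler_pM2l// lerDl.
  have := @u_energy (phi j) (e / (C0 + 1)) (sigma k) (mphi j) (phi01 j) (phi_strip j) (ltW e1) Hj.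
  have : (0 <= \int[dtdx d T]_p (phi j p * normc (u (sigma k) p.1 p.2) ^+ 2)%:E)%E.
    by apply: integral_ge0 => p _; rewrite lee_fin mulr_ge0// sqr_ge0.
  by rewrite /Rintegral; case: (integral _ _ _) => [r| |]; rewrite ?lee_fin//= leey.
(* Finiteness on the compact slab carrying [phi j] ensures that the real-valued integral in
   [limit_le] is the extended one, and not the default value 0. *)
have nu_slab : (nu (slab a' b') < +oo)%E.
  by apply: nu_radon.2; [exact: slab_compact|exact: slab_strip].
have mslab := @measurable_slab R d a' b'.
have phi_le p : ((phi j p)%:E <= (\1_(slab a' b') p : R)%:E)%E.
  rewrite lee_fin indicE; have [sp|sp] := boolP (p \in _); first by have /andP[] := phi01 j p.
  by rewrite (phi_slab j).2// => h; move/negP: sp; apply; exact/mem_set.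
have int_indic (A : set (RB * torus R d)) : measurable A -> nu A = (\int[nu]_p (\1_A p : R)%:E)%E.
  by move=> mA; rewrite integral_indic// setIT.
have int_phi : (\int[nu]_p (phi j p)%:E <= nu (slab a' b'))%E.
  rewrite [leRHS](int_indic _ mslab); apply: ge0_le_integral => //.
  - by move=> p _; rewrite lee_fin.
  - exact/measurable_EFinP.
  - by apply/measurable_EFinP; exact: measurable_indic.
have int_phi0 : (0 <= \int[nu]_p (phi j p)%:E)%E by apply: integral_ge0 => p _; rewrite lee_fin.
apply: (@le_trans _ _ (\int[nu]_p (phi j p)%:E)%E).
  rewrite [leLHS](int_indic _ mB); apply: ge0_le_integral => //.
  - by apply/measurable_EFinP; exact: measurable_indic.
  - exact/measurable_EFinP.
  move=> p _; rewrite lee_fin indicE; have [Bp|Bp] := boolP (p \in _); last exact: phi0.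
  by rewrite phiB// -inE.
rewrite -[leLHS]fineK ?lee_fin//.
by rewrite ge0_fin_numE// (le_lt_trans int_phi).
Qed.

(** Restricted to the slab, nu is finite and hence inner regular, and the closed subsets of A are
    null as A is. *)
Let limit_null_slab (a b : R) (A : set (RB * torus R d)) : 0 < a -> b < T ->
  measurable A -> dtdx d T A = 0%E -> nu (A `&` slab a b) = 0%E.
Proof.
move=> a0 bT mA nullA; have mS := @measurable_slab R d a b.
pose m := mrestr nu mS.
have m_fin : (m setT < +oo)%E.
  by rewrite /m/= /mrestr setTI; apply: nu_radon.2; [exact: slab_compact|exact: slab_strip].
have [_ iA _] := strip_regular m_fin mA.
apply/eqP; rewrite -measure_le0; apply/lee_addgt0Pr => e e0; rewrite add0e.
have [B [[cB mB] BA hB]] := iA e e0.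
apply: (@le_trans _ _ (m B + m (A `\` B))%E); last first.
  rewrite (_ : m B = 0%E) ?add0e//.
  apply: (@limit_null_closed a b) => //.
  - apply: closedI => //; exact: closed_slab.
  - exact: measurableI.
  - apply/eqP; rewrite -measure_le0 -nullA; apply: le_measure; rewrite ?inE//.
      exact: measurableI.
    by move=> p [/BA].
apply: (@le_trans _ _ (m (B `|` (A `\` B)))).
  apply: le_measure; rewrite ?inE.
  - exact: measurableI.
  - by apply: measurableI => //; apply: measurableU => //; exact: measurableD.
  by move=> p [Ap sp]; split => //; have [Bp|nBp] := pselect (B p); [left|right].
by apply: measureU2 => //; exact: measurableD.
Qed.

Lemma limit_dominated : nu `<< dtdx d T.
Proof.
move=> N nullN A mA AN; have nullA := nullN A mA AN.
(* The strip is exhausted by countably many compact slabs; nu does not charge its complement. *)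
pose S n : set (R * torus R d) := slab n.+1%:R^-1 (T - n.+1%:R^-1).
have AS : A `<=` (~` (strip T : set (RB * torus R d)) `|` \bigcup_n (A `&` S n)).
  move=> p Ap; have [sp|nsp] := pselect (strip T p); last by left.
  right; case: p Ap sp => t x Ap [/= tT _]; move: tT; rewrite in_itv/= => /andP[t0 tT].
  have r0 : 0 < Num.min t (T - t) by rewrite lt_min t0 subr_gt0.
  have [n ng] := @ltr_add_invr R 0 _ r0; rewrite add0r lt_min in ng.
  have /andP[n1 n2] := ng; exists n => //; split => //; split => //=.
  by rewrite in_itv/= (ltW n1)/= lerBrDl -lerBrDr ltW.
apply: (measure_negligible mA); apply: (negligibleS AS).
apply: negligibleU.
  apply/negligibleP; first by apply: measurableC; exact: measurable_strip.
  exact: nu_radon.1.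
apply: negligible_bigcup => n; apply/negligibleP.
  by apply: measurableI => //; exact: measurable_slab.
apply: limit_null_slab => //.
by rewrite ltrBlDr ltrDl invr_gt0.
Qed.

End absolute_continuity.

Theorem theorem2 (R : realType) (d : nat) (hd : (1 <= d)%N)
    (U : R -> (torus R d -> R[i]) -> torus R d -> R[i])
    (hU : is_schrodinger_group U)
    (u0 : nat -> torus R d -> R[i]) (hu0 : bounded_L2 u0)
    (f : nat -> R -> torus R d -> R[i]) (hf : bounded_L1loc_L2 f)
    (u : nat -> R -> torus R d -> R[i])
    (hu : forall n, duhamel U (u0 n) (f n) (u n))
    (T : R) (hT : 0 < T) :
  let C : \bar R :=
    ((Num.sqrt T)%:E *
      ereal_sup (range (fun n : nat =>
        L2norm (haar R d) (u0 n) + L1L2norm 0 T (f n))))%E in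
  (C < +oo)%E /\
  (forall n, (spacetime_L2norm T (u n) <= C)%E) /\
  property_AC T u.
Proof.
have [lu0 [M0 HM0]] := hu0; have [jf [lf /(_ 0 T)[M1 HM1]]] := hf.
have Lf n : (L1L2norm 0 T (f n) < +oo)%E by exact: le_lt_trans (HM1 n) (ltry _).
have u0E n : L2norm (haar R d) (u0 n) = (Num.sqrt (sqnorm (haar R d) (u0 n)))%:E.
  exact: L2normE.
have fE n : L1L2norm 0 T (f n) = (source_mass T (f n))%:E.
  by rewrite (source_massE (jf n) (lf n) (Lf n)).
have u0_le n : Num.sqrt (sqnorm (haar R d) (u0 n)) <= M0 by rewrite -lee_fin -u0E.
have f_le n : source_mass T (f n) <= M1 by rewrite -lee_fin -fE.
have sT : (0 <= (Num.sqrt T)%:E)%E by rewrite lee_fin sqrtr_ge0.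
move=> C; split; [|split].
- apply: (@le_lt_trans _ _ ((Num.sqrt T)%:E * (M0 + M1)%:E)%E); last by rewrite -EFinM ltry.
  apply: lee_wpmul2l => //; apply: ge_ereal_sup => _ [n _ <-].
  by rewrite u0E fE -EFinD lee_fin lerD.
- move=> n; apply: (@le_trans _ _ ((Num.sqrt T)%:E *
    (L2norm (haar R d) (u0 n) + L1L2norm 0 T (f n)))%E); last first.
    by apply: lee_wpmul2l => //; apply: ereal_sup_ubound; exists n.
  rewrite /spacetime_L2norm L2norm_integral u0E fE -EFinD -EFinM.
  have h := spacetime_solution hT hU (lu0 n) (jf n) (lf n) (Lf n) (hu n).
  set r := Num.sqrt (sqnorm _ _) + _ in h *.
  have r0 : 0 <= r by rewrite addr_ge0 ?sqrtr_ge0 ?source_mass_ge0.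
  (* The square root of T r^2 is written as a power, so that monotonicity of powers gives the bound
     from [spacetime_solution]. *)
  rewrite (_ : (_ * r)%:E = ((T * r ^+ 2)%:E `^ 2^-1)%E).
    apply: gt0_ler_poweR => //; rewrite ?invr_ge0// in_itv/= leey andbT.
      by apply: integral_ge0 => p _; rewrite lee_fin sqr_ge0.
    by rewrite lee_fin mulr_ge0 ?sqr_ge0 ?ltW.
  rewrite poweR_EFin powR12_sqrt; last by rewrite mulr_ge0 ?sqr_ge0 ?ltW.
  by rewrite (sqrtrM _ (ltW hT)) sqrtr_sqr ger0_norm.
move=> nu nu_radon nu_limit.
(* The constant of [energy_solution], with ||u_{n,0}|| and the L^1 norm of f_n over (0, T) replaced
   by their bounds M0 and M1, hence independent of n. *)
pose C0 := 4 * M0 ^+ 2 + 4 * (M1 + T) * M1.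
have M00 : 0 <= M0 by apply: le_trans (u0_le 0%N); exact: sqrtr_ge0.
have M10 : 0 <= M1 by apply: le_trans (f_le 0%N); exact: source_mass_ge0.
have C00 : 0 <= C0 by rewrite addr_ge0// ?mulr_ge0 ?sqr_ge0 ?addr_ge0 ?(ltW hT).
apply: (@limit_dominated R d T hT u C0 C00 _ nu nu_radon nu_limit).
move=> phi kappa n mphi phi01 phi_strip kappa0 phi_kappa.
have phi0 p : 0 <= phi p by have /andP[] := phi01 p.
have phi1 p : phi p <= 1 by have /andP[] := phi01 p.
apply: le_trans (energy_solution hT hU (lu0 n) (jf n) (lf n) (Lf n) (hu n)
  mphi phi0 phi1 phi_strip kappa0 phi_kappa) _.
rewrite lee_fin ler_wpM2l//.
have F0 := source_mass_ge0 T (f n); have F1 := f_le n.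
apply: lerD.
  rewrite ler_wpM2l// -[leLHS]sqr_sqrtr ?sqnorm_ge0//.
  by rewrite lerXn2r ?nnegrE ?sqrtr_ge0.
by apply: ler_pM; rewrite ?mulr_ge0 ?addr_ge0 ?(ltW hT)// ler_wpM2l// lerD2r.
Qed.
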